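(* Let $\Bbbk=\mathbb Q(T)$ be the field of rational functions, let $t=T$, and let $n\in\mathbb N\cup\{\infty\}$. For all $\beta,\delta\in\Lambda(n)_T$, the set $$\mathcal{CB}(\delta,\beta)_T=\Big\{\xi_q\xi_r\ \Big|\ (\xi_q,\xi_r)\in\bigcup_{\lambda\in\Lambda^+(n)_T}Y(\delta,\lambda)_T\times X(\lambda,\beta)_T\Big\}$$ is a $\mathbb Q(T)$-basis of $1_\delta\,\mathbb S_{\mathbb Q(T)}(n,T)\,1_\beta$.
   Context: Combinatorics (for $t$ in a characteristic zero field $\Bbbk$; here $\Bbbk=\mathbb Q(T)$, $t=T$). $\mathbb N=\{1,2,\dots\}$ and $[1,n]=\{1,\dots,n\}$ ($[1,\infty]=\mathbb N$). $\Lambda(n)_t$ is the set of sequences $\beta=(\beta_i)_{i\in[1,n]}$ with $\beta_1\in t-\mathbb Z$, $\beta_i\in\mathbb Z_{\ge 0}$ for $i\ge 2$ (all but finitely many equal to $0$), and $\sum_i\beta_i=t$. $\Lambda^+(n)_t=\{\beta\in\Lambda(n)_t\mid\beta_2\ge\beta_3\ge\cdots\}$. For $\beta,\delta\in\Lambda(n)_t$, $\mathcal{M}at_n(\delta,\beta)_t$ is the set of matrices $q=(q_{i,j})_{i,j\in[1,n]}$ with $q_{1,1}\in t-\mathbb Z$, all other $q_{i,j}\in\mathbb Z_{\ge0}$, $\sum_{i,j}q_{i,j}=t$, column sums $\sum_i q_{i,j}=\beta_j$ and row sums $\sum_j q_{i,j}=\delta_i$. $q^*$ denotes the transpose. Semistandard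 matrices. For an integer $d$, $\lambda(d)$ (resp. $q(d)$) is obtained from $\lambda\in\Lambda(n)_t$ (resp. a matrix $q$) by adding $d-t$ to $\lambda_1$ (resp. $q_{1,1}$). Let $\lambda\in\Lambda^+(n)_t$ and $q\in\mathcal{M}at_n(\lambda,\beta)_t$. For $d$ large, $\lambda(d)$ is a partition of $d$ and $q(d)$ has nonnegative integer entries; the filling of the Young diagram $Y^{\lambda(d)}$ (with $\lambda(d)_i$ left-justified boxes in row $i$) by $q(d)$ is the tableau whose $i$th row contains $q(d)_{i,j}$ entries equal to $j$ for each $j$, arranged weakly increasingly. $q$ is called semistandard if, for all sufficiently large $d$, this filling is strictly increasing down columns. Set $X(\lambda,\beta)_t=\{\xi_r\mid r\in\mathcal{M}at_n(\lambda,\beta)_t\text{ semistandard}\}$ and $Y(\delta,\lambda)_t=\{\xi_q\mid q\in\mathcal{M}at_n(\delta,\lambda)_t,\ q^*\text{ semistandard}\}$. The category. $\mathfrak S_\infty$ is the group of all bijections of $\Omega=\mathbb N$, with the topology in which the pointwise stabilizers of finite subsets of $\Omega$ form a base of open neighborhoods of the identity. An action of an open subgroup $U$ on a set is smooth if all point stabilizers are open. A finitary $\widehat{\mathfrak S}_\infty$-set is a set with a smooth action of some open subgroup $U\subseteq\mathfrak S_\infty$ having finitely many orbits (one may shrink $U$); a finitary $\mathfrak S_\infty$-set is a smooth $\mathfrak S_\infty$-set with finitely many orbits. Let $\mathfrak S(p)$ be the pointwise stabilizer of $\{1,\dots,p\}$. For a finitary $\widehat{\mathfrak S}_\infty$-set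 $X$ there is a unique polynomial $p_X$ with rational coefficients with $p_X(p)=|X^{\mathfrak S(p)}|$ for all sufficiently large integers $p$; set $\mu_t(X)=p_X(t)$. If $f:X\to\Bbbk$ is constant on the orbits of such an open subgroup, put $\int_X f(x)\,dx=\sum_c c\,\mu_t(f^{-1}(c))$, the sum being over the finitely many values $c$ of $f$. The category $\operatorname{Perm}(\mathfrak S_\infty;\mu_t)$ has as objects the finitary $\mathfrak S_\infty$-sets; $\operatorname{Hom}(X,Y)$ is the space of functions $Y\times X\to\Bbbk$ constant on the diagonal $\mathfrak S_\infty$-orbits; composition is $(g\circ f)(z,x)=\int_Y g(z,y)f(y,x)\,dy$. The algebra. For $\beta\in\Lambda(n)_t$ and $k\ge2$ let $\{\beta\}_k=[1+\sum_{i=2}^{k-1}\beta_i,\ \sum_{i=2}^{k}\beta_i]\subset\Omega$ and $\{\beta\}_1=\Omega\setminus\bigcup_{k\ge2}\{\beta\}_k$. $\mathfrak S_\beta\le\mathfrak S_\infty$ is the subgroup preserving each $\{\beta\}_k$, and $\mathcal X^\beta=\mathfrak S_\infty/\mathfrak S_\beta$. $\mathbb S_{\Bbbk}(n,t)=\bigoplus_{\beta,\delta\in\Lambda(n)_t}\operatorname{Hom}_{\operatorname{Perm}(\mathfrak S_\infty;\mu_t)}(\mathcal X^\beta,\mathcal X^\delta)$, with product given by composition (zero if not composable). For $q\in\mathcal{M}at_n(\delta,\beta)_t$, $\xi_q\in\operatorname{Hom}(\mathcal X^\beta,\mathcal X^\delta)$ is the indicator function of the $\mathfrak S_\infty$-orbit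 of $(\mathfrak S_\delta,\sigma\mathfrak S_\beta)$ in $\mathcal X^\delta\times\mathcal X^\beta$, where $\sigma$ is any element with $|\{\delta\}_i\cap\sigma(\{\beta\}_j)|=q_{i,j}$ for all $(i,j)\ne(1,1)$. $1_\beta$ is the identity morphism of $\mathcal X^\beta$, i.e. $1_\beta=\xi_{q_\beta}$ with $q_\beta$ the diagonal matrix with diagonal $\beta$. *)

(* Defs.v *)
(* Indexing conventions.  All indices are 0-based: the index i in [1,n] is
   represented by i-1, so the distinguished entries beta_1 and q_{1,1} are
   [beta 0] and [q 0 0]; likewise Omega = {1, 2, ...} is represented by [nat],
   the point w being represented by w-1.  The parameter n in N u {oo} is an
   [option nat], [None] standing for oo.  Sequences indexed by [1,n] (resp.
   square matrices) are total functions on [nat] (resp. [nat * nat]) that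
   vanish outside the index range. *)
From HB Require Import structures.
From mathcomp Require Import all_boot all_order all_algebra.
From mathcomp Require Import finmap.
From mathcomp Require Import mathcomp_extra boolp classical_sets functions.
From mathcomp Require Import cardinality fsbigop.
From mathcomp Require Import topology.

Set Implicit Arguments.
Unset Strict Implicit.
Unset Printing Implicit Defensive.

Import Order.TTheory GRing.Theory Num.Theory.

Local Open Scope card_scope.
Local Open Scope classical_set_scope.
Local Open Scope ring_scope.

Definition QT : fieldType := {fraction {poly rat}}.

Definition varT : QT := FracField.tofrac ('X : {poly rat}).

Lemma QT_natr_eq0 (m : nat) : (m%:R == 0 :> QT) = (m == 0)%N.
Proof.
rewrite -[m%:R](rmorph_nat (@FracField.tofrac {poly rat})).
by rewrite tofrac_eq0 -polyC_natr polyC_eq0 Num.Theory.pnatr_eq0.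
Qed.

(* The m with x = m%:R, meaningful when x is a nonnegative integer. *)
Definition natq (x : QT) : nat := xget 0%N [set m : nat | x = m%:R].

Lemma QT_natr_inj : injective (fun m : nat => m%:R : QT).
Proof.
move=> a b; wlog le_ab : a b / (a <= b)%N => [wl|] e.
  by case/orP: (leq_total a b) => h; [apply: wl|apply/esym/wl].
apply/eqP; rewrite eqn_leq le_ab -subn_eq0 -QT_natr_eq0 natrB //.
by rewrite -e subrr eqxx.
Qed.

Lemma natqE (m : nat) : natq m%:R = m.
Proof.
rewrite /natq; case: xgetP => [a _ h|/(_ m)/(_ erefl)//].
exact/esym/QT_natr_inj.
Qed.

Definition in_range (n : option nat) (i : nat) : bool :=
  if n is Some m then (i < m)%N else true.

Definition is_weight (n : option nat) (b : nat -> QT) : Prop :=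
  [/\ exists z : int, b 0%N = varT - z%:~R,
      forall i, (0 < i)%N -> exists m : nat, b i = m%:R,
      finite_set [set i | b i != 0],
      forall i, ~~ in_range n i -> b i = 0
    & \sum_(i \in [set: nat]) b i = varT].

Record weight (n : option nat) :=
  Weight { wt :> nat -> QT; wtP : is_weight n wt }.

HB.instance Definition _ (n : option nat) := gen_eqMixin (weight n).
HB.instance Definition _ (n : option nat) := gen_choiceMixin (weight n).

Definition dominant (n : option nat) : set (weight n) :=
  [set b | forall i, (0 < i)%N -> (natq (b i.+1) <= natq (b i))%N].

Definition mat (n : option nat) (delta beta : weight n) :
    set (nat -> nat -> QT) :=
  [set q | [/\ exists z : int, q 0%N 0%N = varT - z%:~R,
               forall i j, (i, j) != (0, 0)%N -> exists m : nat, q i j = m%:R,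
               finite_set [set p : nat * nat | q p.1 p.2 != 0]
             & forall i j, ~~ (in_range n i && in_range n j) -> q i j = 0] /\
           [/\ \sum_(p \in [set: nat * nat]) q p.1 p.2 = varT,
               forall j, \sum_(i \in [set: nat]) q i j = beta j
             & forall i, \sum_(j \in [set: nat]) q i j = delta i]].

Definition transpose (q : nat -> nat -> QT) : nat -> nat -> QT :=
  fun i j => q j i.

Definition shift_weight (d : int) (b : nat -> QT) : nat -> QT :=
  fun i => if i == 0%N then b i + (d%:~R - varT) else b i.

Definition shift_matrix (d : int) (q : nat -> nat -> QT) : nat -> nat -> QT :=
  fun i j => if (i, j) == (0, 0)%N then q i j + (d%:~R - varT) else q i j.

(* [Y i] lists the entries of the i-th row from left to right. *)
Definition is_filling (lam : nat -> QT) (q : nat -> nat -> QT)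
    (Y : nat -> seq nat) : Prop :=
  forall i, [/\ (size (Y i))%:R = lam i,
                sorted leq (Y i)
              & forall j, (count_mem j (Y i))%:R = q i j].

Definition column_strict (Y : nat -> seq nat) : Prop :=
  forall i c, (c < size (Y i.+1))%N -> (nth 0 (Y i) c < nth 0 (Y i.+1) c)%N.

Definition semistandard (lam : nat -> QT) (q : nat -> nat -> QT) : Prop :=
  exists d0 : int, forall d : int, d0 <= d ->
    exists2 Y, is_filling (shift_weight d lam) (shift_matrix d q) Y
             & column_strict Y.

Record sym_inf := SymInf {
  sym_fun :> nat -> nat;
  sym_inv : nat -> nat;
  sym_funK : cancel sym_fun sym_inv;
  sym_invK : cancel sym_inv sym_fun }.

HB.instance Definition _ := gen_eqMixin sym_inf.
HB.instance Definition _ := gen_choiceMixin sym_inf.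

Lemma sym_infP (s s' : sym_inf) : s =1 s' -> s = s'.
Proof.
case: s => f g fK gK; case: s' => f' g' fK' gK' /= ff'.
have ef : f = f' by exact/funext.
have eg : g = g' by apply/funext => w; rewrite -[LHS]fK' -ff' gK.
by subst f' g'; congr SymInf; exact: Prop_irrelevance.
Qed.

Definition sym_one : sym_inf := @SymInf id id (frefl _) (frefl _).

Definition sym_mul (s s' : sym_inf) : sym_inf :=
  SymInf (can_comp (@sym_funK s) (@sym_funK s'))
         (can_comp (@sym_invK s') (@sym_invK s)).

Definition sym_opp (s : sym_inf) : sym_inf :=
  SymInf (@sym_invK s) (@sym_funK s).

Lemma sym_mulA : associative sym_mul.
Proof. by move=> a b c; exact: sym_infP. Qed.

Lemma sym_mul1s : left_id sym_one sym_mul.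
Proof. by move=> a; exact: sym_infP. Qed.

Lemma sym_muls1 : right_id sym_one sym_mul.
Proof. by move=> a; exact: sym_infP. Qed.

Lemma sym_mulVs : left_inverse sym_one sym_opp sym_mul.
Proof. by move=> a; apply: sym_infP => w /=; rewrite sym_funK. Qed.

Lemma sym_mulsV : right_inverse sym_one sym_opp sym_mul.
Proof. by move=> a; apply: sym_infP => w /=; rewrite sym_invK. Qed.

HB.instance Definition _ := isGroup.Build sym_inf
  sym_mulA sym_mul1s sym_muls1 sym_mulVs sym_mulsV.

Lemma sym_mulE (s s' : sym_inf) (w : nat) : (s * s')%g w = s (s' w).
Proof. by []. Qed.

(* [agree (s, F)] is the translate s.Stab(F) of the pointwise stabilizer of F:
   these translates are a base of the group topology in which the Stab(F) are
   a base of neighbourhoods of 1. *)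
Definition agree (p : sym_inf * {fset nat}) : set sym_inf :=
  [set s | forall w, w \in p.2 -> s w = p.1 w].

HB.instance Definition _ := isPointed.Build sym_inf 1%g.

Lemma agree_cover : \bigcup_(p in [set: sym_inf * {fset nat}]) agree p = setT.
Proof. by apply/seteqP; split=> // s _; exists (s, fset0). Qed.

Lemma agree_join (p p' : sym_inf * {fset nat}) (s : sym_inf) :
  setT p -> setT p' -> agree p s -> agree p' s ->
  exists r, [/\ setT r, agree r s & agree r `<=` agree p `&` agree p'].
Proof.
move=> _ _ ps p's; exists (s, (p.2 `|` p'.2)%fset); split=> // s' rs'.
by split=> w wF; rewrite rs' /= ?inE ?wF ?orbT //; [exact: ps | exact: p's].
Qed.

HB.instance Definition _ := isBaseTopological.Build sym_inf
  agree_cover agree_join.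

Lemma open_symP (A : set sym_inf) :
  open A <-> forall s, A s -> exists F : {fset nat}, agree (s, F) `<=` A.
Proof.
split=> [[D _ DA] s As|h].
  have [p Dp ps] : (\bigcup_(p in D) agree p) s by rewrite DA.
  exists p.2 => s' s's; rewrite -DA; exists p => // w wF.
  by rewrite s's //= ps.
exists [set p | agree p `<=` A] => //.
apply/seteqP; split=> [s [p pA ps]|s /[dup] As /h[F FA]]; first exact: pA.
by exists (s, F).
Qed.

Definition fixing (p : nat) : set sym_inf :=
  [set s | forall w, (w < p)%N -> s w = w].

Record finitary := Finitary {
  carrier :> Type;
  act : sym_inf -> carrier -> carrier;
  act1 : forall x, act 1%g x = x;
  actM : forall s s' x, act (s * s')%g x = act s (act s' x);
  act_smooth : forall x, open [set s | act s x = x];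
  finite_orbits : finite_set [set [set act s x | s in setT] | x in setT] }.

Definition fixed_points (X : finitary) (A : set X) (p : nat) : set X :=
  [set x | A x /\ forall s, fixing p s -> act s x = x].

(* A subset A of X stable under an open subgroup U is a finitary set for U;
   as [fixing p] is contained in U for p large, the polynomial below depends
   only on A and not on the choice of U. *)
Definition counts (X : finitary) (A : set X) (P : {poly rat}) : Prop :=
  exists p0 : nat, forall p : nat, (p0 <= p)%N ->
    exists2 m : nat, fixed_points A p #= `I_m & P.[p%:R] = m%:R.

Definition count_poly (X : finitary) (A : set X) : {poly rat} :=
  xget 0 [set P | counts A P].

Definition mu (X : finitary) (A : set X) : QT :=
  (map_poly ratr (count_poly A)).[varT].

Definition integral (X : finitary) (f : X -> QT) : QT :=
  \sum_(c \in range f) c * mu (f @^-1` [set c]).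

Definition hom (X Y : finitary) : set (Y -> X -> QT) :=
  [set f | forall s y x, f (act s y) (act s x) = f y x].

Definition comp (X Y Z : finitary) (g : Z -> Y -> QT) (f : Y -> X -> QT) :
    Z -> X -> QT :=
  fun z x => integral (fun y => g z y * f y x).

Definition idm (X : finitary) : X -> X -> QT :=
  fun y x => (`[< y = x >])%:R.

Definition coset (U : set sym_inf) (s : sym_inf) : set sym_inf :=
  [set (s * u)%g | u in U].

Section CosetSpace.
Variables (U : set sym_inf) (Ugroup : group_closed [in U]) (Uopen : open U).

Definition coset_carrier : Type := set_type (range (coset U)).

Definition coset_pt (s : sym_inf) : coset_carrier :=
  SigSub (mem_set (imageT (coset U) s)).

Lemma coset_act_subproof (s : sym_inf) (x : coset_carrier) :
  [set (s * g)%g | g in val x] \in range (coset U).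
Proof.
case: x => /= A /set_mem[r _ <-]; apply/mem_set; exists (s * r)%g => //.
rewrite /coset image_comp; apply: eq_imagel => u _ /=; exact: esym (mulgA _ _ _).
Qed.

Definition coset_act (s : sym_inf) (x : coset_carrier) : coset_carrier :=
  SigSub (coset_act_subproof s x).

Lemma coset_act1 (x : coset_carrier) : coset_act 1%g x = x.
Proof.
apply: val_inj => /=; rewrite -[RHS](@image_id _ (val x)).
by apply: eq_imagel => g _; exact: mul1g.
Qed.

Lemma coset_actM (s s' : sym_inf) (x : coset_carrier) :
  coset_act (s * s')%g x = coset_act s (coset_act s' x).
Proof.
apply: val_inj; rewrite /= image_comp.
by apply: eq_imagel => g _; exact: esym (mulgA _ _ _).
Qed.

Lemma coset_act_pt (s r : sym_inf) :
  coset_act s (coset_pt r) = coset_pt (s * r)%g.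
Proof.
apply: val_inj; rewrite /= /coset image_comp.
by apply: eq_imagel => g _; exact: mulgA.
Qed.

Lemma coset_ptP (x : coset_carrier) : exists s, x = coset_pt s.
Proof.
case: x => A xA; have [s _ sA] := set_mem xA.
by exists s; apply: val_inj; rewrite /= sA.
Qed.

Lemma coset_pt_eq (s r : sym_inf) :
  coset_pt s = coset_pt r <-> U (r^-1 * s)%g.
Proof.
have [U1 UV] := Ugroup; split.
  move=> /(congr1 val)/= sr; have : coset U s s.
    by exists 1%g; [exact: set_mem U1|exact: mulg1].
  by rewrite sr => -[u Uu <-]; rewrite mulKg.
move=> Urs; apply: val_inj => /=; apply/seteqP; split=> g [u Uu <-] /=.
  exists (r^-1 * s * u)%g; last by rewrite -mulgA mulVKg.
  by apply: set_mem; apply: (group_closedM Ugroup); exact: mem_set.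
exists (s^-1 * r * u)%g; last by rewrite -mulgA mulVKg.
have -> : (s^-1 * r)%g = (r^-1 * s)^-1%g by rewrite invgM invgK.
apply: set_mem; apply: (group_closedM Ugroup); last exact: mem_set.
by apply: (group_closedV Ugroup); exact: mem_set.
Qed.

Lemma coset_smooth (x : coset_carrier) : open [set s | coset_act s x = x].
Proof.
have [r ->] := coset_ptP x; apply/open_symP => s.
rewrite /= coset_act_pt coset_pt_eq => /(proj1 (open_symP U) Uopen)[F FU].
exists [fset r w | w in F]%fset => s' /= s's.
rewrite coset_act_pt coset_pt_eq; apply: FU => w wF /=.
by congr (sym_inv r _); apply: s's; apply/imfsetP; exists w.
Qed.

Lemma coset_finite_orbits :
  finite_set [set [set coset_act s x | s in setT] | x in [set: coset_carrier]].
Proof.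
apply: (@sub_finite_set _ _ [set [set: coset_carrier]]) => // _ [x _ <-] /=.
have [r ->] := coset_ptP x; apply/seteqP; split=> // y _.
have [r' ->] := coset_ptP y; exists (r' * r^-1)%g => //.
by rewrite coset_act_pt mulgVK.
Qed.

Definition coset_space : finitary :=
  Finitary coset_act1 coset_actM coset_smooth coset_finite_orbits.

End CosetSpace.

(* [segment b k] is {b}_{k+1} for k >= 1. *)
Definition segment (b : nat -> QT) (k : nat) : set nat :=
  [set w | (\sum_(1 <= i < k) natq (b i) <= w < \sum_(1 <= i < k.+1) natq (b i))%N].

Definition block (b : nat -> QT) (k : nat) : set nat :=
  if k == 0%N then ~` \bigcup_(j in [set j | (0 < j)%N]) segment b j
  else segment b k.

Definition young (b : nat -> QT) : set sym_inf :=
  [set s | forall k, [set s w | w in block b k] = block b k].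

Lemma young_group (b : nat -> QT) : group_closed [in young b].
Proof.
split; first by apply: mem_set => k; exact: image_id.
move=> s s' /set_mem hs /set_mem hs'; apply: mem_set => k; rewrite -[in LHS](hs' k) -[RHS](hs k) image_comp.
by apply: eq_imagel => w _; exact: congr1 (@sym_funK s' w).
Qed.

Lemma segment_bounded (n : option nat) (b : weight n) :
  exists N, forall k, segment b k `<=` [set w | (w < N)%N].
Proof.
have [_ _ /finite_seqP[r rE] _ _] := wtP b.
have b0 i : (\max_(j <- r) j < i)%N -> natq (b i) = 0%N.
  move=> ri; have [e|/negP bi] := boolP (b i == 0).
    by rewrite (eqP e) -[0]/(0%:R) natqE.
  have : [set` r] i by rewrite -rE /=; exact/negP.
  move=> /= ir; have := @leq_bigmax_seq _ r xpredT id i ir isT.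
  by rewrite leqNgt ri.
exists (\sum_(1 <= i < (\max_(j <- r) j).+1) natq (b i))%N => k w /= /andP[_].
set M := (\max_(j <- r) j).+1 => wk; apply: (leq_trans wk).
have [kM|Mk] := leqP k.+1 M.
  by case: M kM => // M kM; rewrite (@big_cat_nat _ _ _ k.+1 1 M.+1) //= leq_addr.
rewrite (@big_cat_nat _ _ _ M 1 k.+1) //=; last exact: ltnW.
rewrite [X in (_ + X)%N]big_nat_cond [X in (_ + X)%N]big1 ?addn0 //.
by move=> i /andP[/andP[Mi _] _]; exact: b0.
Qed.

Lemma young_open (n : option nat) (b : weight n) : open (young b).
Proof.
have [N bN] := segment_bounded b.
apply/open_symP => s ys; exists [fset w in iota 0 N]%fset => s' s's.
have s'E k : [set s' w | w in segment b k] = [set s w | w in segment b k].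
  apply: eq_imagel => w /bN wN; rewrite s's //= in_fset /= mem_iota.
  by rewrite add0n; exact: wN.
have segE k : (0 < k)%N -> [set s' w | w in segment b k] = segment b k.
  by move=> k0; have := ys k; rewrite /block gtn_eqF // s'E.
have UE : [set s' w | w in \bigcup_(j in [set j | (0 < j)%N]) segment b j] =
          \bigcup_(j in [set j | (0 < j)%N]) segment b j.
  by rewrite image_bigcup; apply: eq_bigcupr => j /= /segE.
move=> k; rewrite /block; case: eqP => [_|/eqP k0]; last by rewrite segE ?lt0n.
apply/seteqP; split=> [_ [w wB <-] wB'|w wB].
  apply: wB; move: wB'; rewrite -[X in X _ -> _]UE => -[v vB /(can_inj (@sym_funK s'))<-].
  exact: vB.
exists (sym_inv s' w); last by rewrite sym_invK.
by move=> wB'; apply: wB; rewrite -UE; exists (sym_inv s' w); rewrite ?sym_invK.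
Qed.

Definition Xsp (n : option nat) (b : weight n) : finitary :=
  coset_space (@young_group b) (young_open b).

Definition Xpt (n : option nat) (b : weight n) (s : sym_inf) : Xsp b :=
  coset_pt (young b) s.

(* The orbit does not depend on sigma, so quantifying existentially over sigma
   gives the indicator of a single orbit. *)
Definition xi (n : option nat) (delta beta : weight n)
    (q : nat -> nat -> QT) : Xsp delta -> Xsp beta -> QT :=
  fun y x => (`[< exists s sigma : sym_inf,
    [/\ forall i j, (i, j) != (0, 0)%N ->
          block delta i `&` [set sigma w | w in block beta j]
            #= `I_(natq (q i j)),
        y = act s (Xpt delta 1%g)
      & x = act s (Xpt beta sigma)] >])%:R.

(* All families of kernels; the entry at (delta, beta) is a kernel
   X^delta * X^beta -> Q(T). *)
Definition family (n : option nat) : Type :=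
  forall p : weight n * weight n, Xsp p.1 -> Xsp p.2 -> QT.

HB.instance Definition _ (n : option nat) := gen_eqMixin (family n).
HB.instance Definition _ (n : option nat) := gen_choiceMixin (family n).

Section FamilyModule.
Variable n : option nat.
Implicit Types a b c : family n.

Definition family0 : family n := fun p => 0.
Definition family_add a b : family n := fun p => a p + b p.
Definition family_opp a : family n := fun p => - a p.
Definition family_scale (k : QT) a : family n := fun p y x => k * a p y x.

Lemma family_addA : associative family_add.
Proof. by move=> a b c; apply: functional_extensionality_dep => p; exact: addrA. Qed.

Lemma family_addC : commutative family_add.
Proof. by move=> a b; apply: functional_extensionality_dep => p; exact: addrC. Qed.

Lemma family_add0 : left_id family0 family_add.
Proof. by move=> a; apply: functional_extensionality_dep => p; exact: add0r. Qed.

Lemma family_addN : left_inverse family0 family_opp family_add.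
Proof. by move=> a; apply: functional_extensionality_dep => p; exact: addNr. Qed.

HB.instance Definition _ := GRing.isZmodule.Build (family n)
  family_addA family_addC family_add0 family_addN.

Lemma family_eqP a b : (forall p y x, a p y x = b p y x) -> a = b.
Proof.
move=> ab; apply: functional_extensionality_dep => p.
by apply/funext => y; apply/funext => x.
Qed.

Lemma family_scaleA (k l : QT) a :
  family_scale k (family_scale l a) = family_scale (k * l) a.
Proof. by apply: family_eqP => p y x; exact: mulrA. Qed.

Lemma family_scale1 : left_id 1 family_scale.
Proof. by move=> a; apply: family_eqP => p y x; exact: mul1r. Qed.

Lemma family_scaleDr : right_distributive family_scale +%R.
Proof. by move=> k a b; apply: family_eqP => p y x; exact: mulrDr. Qed.

Lemma family_scaleDl a : {morph family_scale^~ a : k l / k + l}.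
Proof. by move=> k l; apply: family_eqP => p y x; exact: mulrDl. Qed.

HB.instance Definition _ := GRing.Zmodule_isLmodule.Build QT (family n)
  family_scaleA family_scale1 family_scaleDr family_scaleDl.

End FamilyModule.

(* The direct sum of the spaces Hom(X^beta, X^delta), as a subspace of all
   families; [inhom] is the inclusion of a summand. *)
Definition schur (n : option nat) : set (family n) :=
  [set a | (forall p, hom (a p)) /\ finite_set [set p | a p != 0]].

Definition schur_mul (n : option nat) (a b : family n) : family n :=
  fun p y x =>
    \sum_(g \in [set: weight n]) comp (a (p.1, g)) (b (g, p.2)) y x.

Definition inhom (n : option nat) (delta beta : weight n)
    (f : Xsp delta -> Xsp beta -> QT) : family n :=
  @dfwith _ (fun p : weight n * weight n => Xsp p.1 -> Xsp p.2 -> QT)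
    (fun=> 0) (delta, beta) f.

Definition schur_xi (n : option nat) (delta beta : weight n)
    (q : nat -> nat -> QT) : family n := inhom (@xi n delta beta q).

Definition schur_id (n : option nat) (beta : weight n) : family n :=
  inhom (@idm (Xsp beta)).

Definition corner (n : option nat) (delta beta : weight n) : set (family n) :=
  [set schur_mul (schur_mul (schur_id delta) a) (schur_id beta)
    | a in @schur n].

Definition Xset (n : option nat) (lam beta : weight n) : set (family n) :=
  [set schur_xi lam beta r | r in [set r | mat lam beta r /\
                                           semistandard lam r]].

Definition Yset (n : option nat) (delta lam : weight n) : set (family n) :=
  [set schur_xi delta lam q | q in [set q | mat delta lam q /\
                                     semistandard lam (transpose q)]].

Definition CB (n : option nat) (delta beta : weight n) : set (family n) :=
  [set schur_mul u.1 u.2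
    | u in \bigcup_(lam in @dominant n) (Yset delta lam `*` Xset lam beta)].

Definition linear_combinations (k : fieldType) (V : lmodType k) (B : set V) :
    set V :=
  [set v | exists (s : seq V) (c : V -> k),
     [set` s] `<=` B /\ v = \sum_(b <- s) c b *: b].

Definition linearly_independent (k : fieldType) (V : lmodType k) (B : set V) :
    Prop :=
  forall (s : seq V) (c : V -> k), uniq s -> [set` s] `<=` B ->
    \sum_(b <- s) c b *: b = 0 -> forall b, b \in s -> c b = 0.

Definition is_basis (k : fieldType) (V : lmodType k) (W B : set V) : Prop :=
  [/\ B `<=` W, linearly_independent B & W `<=` linear_combinations B].

(* Main.v *)
(* Reading a point of X^beta as a word with letters in [1,n], the points fixed by
   S(p) are the words of length p of content beta(p), so the coefficients of
   xi_q xi_r are polynomials in T whose values at large integers d are the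
   structure constants of the classical Schur algebra in degree d.

   Linear independence can thus be checked at large d.  Given a relation between
   the products xi_q xi_r, choose among the shapes lambda that occur one that
   maximizes sum_i i lambda_i, and antisymmetrize the relation along the columns
   of its diagram.  A column-antisymmetric function supported on words of content
   lambda' vanishes unless sum_i i lambda'_i >= sum_i i lambda_i, and for equality
   only lambda' = lambda survives, where such functions form a line.  What remains
   is a product of two matrices indexed by semistandard tableaux, both
   unitriangular for the lexicographic order on row sums.

   Spanning follows by counting: the Robinson-Schensted-Knuth correspondence
   injects Mat(delta, beta) into the pairs of semistandard matrices, so there are
   at least as many independent products as basis elements xi_m. *)
From HB Require Import structures.
From mathcomp Require Import all_boot all_order all_fingroup all_algebra.
From mathcomp Require Import mathcomp_extra boolp classical_sets functions.
From mathcomp Require Import cardinality fsbigop.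
From mathcomp Require Import topology.
From mathcomp Require Import zify.
Require Import Defs.
Set Implicit Arguments.
Unset Strict Implicit.
Unset Printing Implicit Defensive.
Import Order.TTheory GRing.Theory Num.Theory.

(** * Column antisymmetrizers *)

Local Open Scope nat_scope.

(** A coefficient in Q(T) need not have a value at T = d, so denominators are cleared first and each
    numerator is shown to vanish at every large d. In degree d only points labelled 0 from position
    d on are used: the polynomial counting middle words is exact from any common bound on the
    supports of the two outer points, and d itself is such a bound. The recurring obstacle is the
    entry [(0, 0)]: it lies in T - Z and its blocks are infinite. Types are therefore compared away
    from this entry, which is recovered in degree d from the total. Growth diagrams are chosen for
    the correspondence because their local rule can be solved backwards for one corner shape and for
    the matrix entry, so that the outer border determines the matrix. The matrices that index the
    orbits then index equally many products, and the square matrix of values of these products at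
    orbit representatives is invertible. *)

Definition joint_count (d : nat) (z y : 'I_d -> nat) (i k : nat) : nat :=
  #|[set w | (z w == i) && (y w == k)]|.

Lemma joint_count_perm d (z y : 'I_d -> nat) (s : 'S_d) i k :
  joint_count (z \o s) (y \o s) i k = joint_count z y i k.
Proof.
rewrite /joint_count -[RHS](card_preimset _ (@perm_inj _ s)).
by apply: eq_card => w; rewrite !inE.
Qed.

Lemma eq_joint_count d (z z' y y' : 'I_d -> nat) i k :
  z =1 z' -> y =1 y' -> joint_count z y i k = joint_count z' y' i k.
Proof. by move=> ez ey; apply: eq_card => w; rewrite !inE ez ey. Qed.

Lemma sum_nat_delta K m (F : nat -> nat) :
  m < K -> \sum_(k < K) F k * (m == k) = F m.
Proof.
move=> mK; rewrite (bigD1 (Ordinal mK)) //= eqxx muln1 big1 ?addn0 // => k.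
by rewrite -val_eqE eq_sym /= => /negbTE->; rewrite muln0.
Qed.

Lemma sum_joint_count d K (z y : 'I_d -> nat) (F : nat -> nat -> nat) :
  (forall w, z w < K) -> (forall w, y w < K) ->
  \sum_(w < d) F (z w) (y w) = \sum_(i < K) \sum_(k < K) F i k * joint_count z y i k.
Proof.
move=> zK yK.
have -> : \sum_(w < d) F (z w) (y w) =
    \sum_(w < d) \sum_(i < K) \sum_(k < K) F i k * ((z w == i) && (y w == k)).
  apply: eq_bigr => w _; rewrite -(sum_nat_delta (F ^~ (y w)) (zK w)).
  apply: eq_bigr => i _; rewrite -(sum_nat_delta (F i) (yK w)) big_distrl /=.
  by apply: eq_bigr => k _; rewrite -mulnA mulnb andbC.
rewrite exchange_big; apply: eq_bigr => i _; rewrite exchange_big.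
apply: eq_bigr => k _; rewrite -big_distrr /=; congr (_ * _).
by rewrite /joint_count -sum1dep_card [RHS]big_mkcond; apply: eq_bigr => w _; case: (_ && _).
Qed.

Lemma card_le_bound (I : finType) (A : {set I}) (f : I -> nat) m :
  {in A &, injective f} -> (forall w, w \in A -> f w < m) -> #|A| <= m.
Proof.
move=> f_inj fm; rewrite cardE -(size_map f) -[m](size_iota 0).
apply: uniq_leq_size => [|_ /mapP[w + ->]]; last by rewrite mem_enum mem_iota => /fm.
by rewrite map_inj_in_uniq ?enum_uniq // => a b; rewrite !mem_enum; apply: f_inj.
Qed.

(** Identifies the d positions of a word with the boxes of a diagram of size d: a tableau becomes a
    word, and the column group a subset of the permutations of ['I_d]. *)
Lemma diagram_boxes (d K : nat) (lam : nat -> nat) :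
  \sum_(i < K) lam i = d -> (forall i, K <= i -> lam i = 0) ->
  exists rc : 'I_d -> nat * nat,
  [/\ injective rc, forall w, (rc w).2 < lam (rc w).1,
      forall i c, c < lam i -> exists w, rc w = (i, c)
    & forall G : nat -> nat -> nat,
        \sum_(w < d) G (rc w).1 (rc w).2 = \sum_(i < K) \sum_(c < lam i) G i c].
Proof.
move=> lamd lam0.
pose s := [seq (i, c) | i <- iota 0 K, c <- iota 0 (lam i)].
have sG (G : nat -> nat -> nat) :
    \sum_(p <- s) G p.1 p.2 = \sum_(i < K) \sum_(c < lam i) G i c.
  have io m : iota 0 m = index_iota 0 m by rewrite /index_iota subn0.
  rewrite /s big_allpairs_dep io big_mkord; apply: eq_bigr => i _.
  by rewrite io big_mkord.
have szs : size s = d.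
  rewrite -lamd -sum1_size (sG (fun _ _ => 1)).
  by apply: eq_bigr => i _; rewrite sum_nat_const card_ord muln1.
have us : uniq s.
  by apply: allpairs_uniq_dep => [|i _|[a b] [a' b'] _ _ [-> ->]] //; exact: iota_uniq.
have ms i c : ((i, c) \in s) = (c < lam i).
  apply/idP/idP => [/allpairsPdep[a [b [_ + [-> ->]]]]|ci].
    by rewrite mem_iota.
  apply/allpairsPdep; exists i, c; split=> //; rewrite mem_iota //= add0n.
  by case: (ltnP i K) => // /lam0 e; rewrite e in ci.
exists (fun w => nth (0, 0) s w); split.
- by move=> w w' /eqP; rewrite nth_uniq ?szs // => /eqP/val_inj.
- move=> w; rewrite -ms -surjective_pairing; apply: mem_nth; by rewrite szs.
- move=> i c; rewrite -ms => /(nthP (0, 0))[w]; rewrite szs => wd <-.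
  by exists (Ordinal wd).
- by move=> G; rewrite -sG (big_nth (0, 0)) szs big_mkord.
Qed.

Section Columns.
Variables (d : nat) (row col : 'I_d -> nat).
Hypothesis rc_inj : forall w w', row w = row w' -> col w = col w' -> w = w'.
Hypothesis rc_down : forall w i, i <= row w ->
  exists2 w', row w' = i & col w' = col w.

Definition colgroup : {set 'S_d} := [set s : 'S_d | [forall w, col (s w) == col w]].

Lemma colgroupP (s : 'S_d) : reflect (forall w, col (s w) = col w) (s \in colgroup).
Proof. by rewrite inE; apply: (iffP forallP) => h w; apply/eqP. Qed.

Lemma colgroupM (s u : 'S_d) : s \in colgroup -> ((s * u)%g \in colgroup) = (u \in colgroup).
Proof.
move=> /colgroupP sC; apply/colgroupP/colgroupP => uC w; last by rewrite permM uC.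
by have := uC ((s^-1)%g w); rewrite permM -[RHS]sC permKV.
Qed.

Lemma colgroupV (s : 'S_d) : ((s^-1)%g \in colgroup) = (s \in colgroup).
Proof.
apply/colgroupP/colgroupP => sC w.
  by rewrite -{2}[w](permK s) sC.
by rewrite -{2}[w](permKV s) sC.
Qed.

(* A box goes to the one of its column whose row is the rank of its entry. *)
Lemma column_rank (y : 'I_d -> nat) :
  (forall w w', col w = col w' -> y w = y w' -> w = w') ->
  exists2 s, s \in colgroup & forall w, row (s w) <= y w.
Proof.
move=> ydist.
pose R w := [set w' | (col w' == col w) && (y w' < y w)].
have rowR w : exists w', row w' = #|R w| /\ col w' = col w.
  case: (boolP [exists w', (row w' == #|R w|) && (col w' == col w)]) => [/existsP[w' /andP[/eqP ? /eqP ?]]|].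
    by exists w'.
  rewrite negb_exists => /forallP nex.
  (* If no box of the column lay in row [#|R w|], then, columns being top-justified, all its boxes
     would lie in smaller rows. The column would have at most [#|R w|] boxes, yet [R w] is a part of
     it that omits [w]. *)
  pose Cw := [set w' | col w' == col w].
  have lt w' : w' \in Cw -> row w' < #|R w|.
    rewrite inE => /eqP cw; case: ltnP => // /rc_down[w'' r'' c''].
    by have := nex w''; rewrite r'' c'' cw !eqxx.
  have : #|Cw| <= #|R w|.
    apply: (@card_le_bound _ _ row) => // a b; rewrite !inE => /eqP ca /eqP cb.
    by move/rc_inj; apply; rewrite ca cb.
  have : #|R w| < #|Cw|.
    apply: proper_card; apply/properP; split.
      by apply/fintype.subsetP => w'; rewrite !inE => /andP[].
    by exists w; rewrite !inE ?eqxx // ltnn.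
  by rewrite ltnNge => /negbTE ->.
have [f fP] := fin_all_exists rowR.
have leR w w' : col w = col w' -> y w < y w' -> #|R w| < #|R w'|.
  move=> cw yw; apply: proper_card; apply/properP; split.
    by apply/fintype.subsetP => v; rewrite !inE cw => /andP[-> /ltn_trans->].
  by exists w; rewrite !inE cw eqxx //= ltnn.
have f_inj : injective f.
  move=> w w' e; have [r c] := fP w; have [r' c'] := fP w'.
  have cc : col w = col w' by rewrite -c -c' e.
  have rr : #|R w| = #|R w'| by rewrite -r -r' e.
  apply: ydist => //; case: (ltngtP (y w) (y w')) => // h.
    by have := leR _ _ cc h; rewrite rr ltnn.
  by have := leR _ _ (esym cc) h; rewrite rr ltnn.
exists (perm f_inj) => [|w].
  by apply/colgroupP => w; rewrite permE; case: (fP w).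
rewrite permE (proj1 (fP w)).
(* The entries of the boxes in [R w] are distinct numbers below [y w]. *)
apply: (@card_le_bound _ _ y) => [a b|a]; rewrite !inE; last by case/andP.
by move=> /andP[/eqP ca _] /andP[/eqP cb _]; apply: ydist; rewrite ca cb.
Qed.

Lemma sum_perm (F : 'I_d -> nat) (s : 'S_d) : \sum_w F (s w) = \sum_w F w.
Proof. by rewrite [RHS](reindex_inj (@perm_inj _ s)). Qed.

(** Up to the column group, [row] is the only filling with distinct entries in each column and least
    total: [column_rank] puts a rearrangement of [row] below [y] pointwise, and equal totals turn
    this into equality. *)
Lemma column_distinct_row (y : 'I_d -> nat) :
  (forall w w', col w = col w' -> y w = y w' -> w = w') ->
  \sum_w y w <= \sum_w row w ->
  exists2 s, s \in colgroup & y =1 row \o s.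
Proof.
move=> /column_rank[s sC sy] ley; exists s => // w /=.
have [_ e] : \sum_w row (s w) <= \sum_w y w ?= iff [forall w, row (s w) == y w].
  by apply: leqif_sum => v _; apply: leqif_eq.
have /forallP/(_ w)/eqP-> // : [forall w, row (s w) == y w].
by rewrite -e eqn_leq leq_sum //= sum_perm.
Qed.

(* For [B] large, comparing these sums amounts to comparing the vectors of row
   sums lexicographically, the top row first. *)
Definition row_stat (B L : nat) (y : 'I_d -> nat) : nat :=
  \sum_w B ^ (L - row w) * y w.

(** Let row [row w1] be the topmost one that [s] moves. Rows above it are unchanged, and each moved
    box of this row receives an entry from further down its column, hence a larger one. So the
    vector of row sums increases lexicographically. *)
Lemma row_stat_perm (K : nat) (T : 'I_d -> nat) (s : 'S_d) :
  (forall w w', col w = col w' -> row w < row w' -> T w < T w') ->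
  (forall w, T w <= K) -> (forall w, row w <= K) ->
  s \in colgroup -> s != 1%g ->
  row_stat (d * K).+1 K.+1 T < row_stat (d * K).+1 K.+1 (T \o s).
Proof.
move=> Tinc TK rowK /colgroupP sC s1.
have [w0 sw0] : exists w, s w != w.
  apply/existsP; rewrite -negb_forall; apply: contra s1 => /forallP h.
  by apply/eqP/permP => w; rewrite perm1; apply/eqP.
case: (@arg_minnP _ w0 (fun w => s w != w) row sw0) => w1 sw1 min1.
have fixs w : row w < row w1 -> s w = w.
  by move=> rw; apply/eqP; case: (boolP (s w == w)) => // /min1; rewrite leqNgt rw.
have up w : row w = row w1 -> s w != w -> row w < row (s w).
  move=> rw sw; rewrite ltn_neqAle; apply/andP; split.
    by apply: contra sw => /eqP e; rewrite eq_sym; apply/eqP/rc_inj; rewrite ?sC.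
  rewrite leqNgt; apply: contra sw => h; have := fixs (s w); rewrite -rw => /(_ h).
  by move/perm_inj => {1}->.
set B := (d * K).+1; pose W w := B ^ (K.+1 - row w).
have B0 : 0 < B by [].
rewrite /row_stat -/B.
rewrite (bigID (fun w => row w <= row w1)) [X in _ < X](bigID (fun w => row w <= row w1)) /=.
(* The boxes below row [row w1] number at most d, with entries at most K and weights at most
   [B ^ (K - row w1)]. As [B] exceeds d K, together they stay below one unit of weight of row
   [row w1]. *)
have lo : \sum_(w | ~~ (row w <= row w1)) B ^ (K.+1 - row w) * T w < B ^ (K.+1 - row w1).
  rewrite (@leq_ltn_trans (\sum_(w : 'I_d) B ^ (K - row w1) * K)) //.
    rewrite [X in _ <= X](bigID (fun w => row w <= row w1)) /= addnC.
    rewrite -[X in X <= _]addn0 leq_add // leq_sum // => w; rewrite -ltnNge => rw.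
    by rewrite leq_mul // leq_pexp2l //; lia.
  rewrite sum_nat_const card_ord subSn // expnSr mulnCA ltn_pmul2l ?expn_gt0 ?B0 //.
rewrite (@leq_trans (\sum_(w | row w <= row w1) B ^ (K.+1 - row w) * T w + B ^ (K.+1 - row w1))) //.
  by rewrite ltn_add2l.
apply: (leq_trans _ (leq_addr _ _)).
rewrite (bigD1 w1) // [X in _ <= X](bigD1 w1) //= addnAC leq_add //.
  rewrite addnC -mulnS leq_mul //; exact: (Tinc _ _ (esym (sC _)) (up _ erefl sw1)).
apply: leq_sum => w /andP[rw _]; rewrite leq_mul //.
move: rw; rewrite leq_eqVlt => /orP[/eqP rw|/fixs->//].
case: (eqVneq (s w) w) => [->//|sw]; apply: ltnW; exact: (Tinc _ _ (esym (sC _)) (up _ rw sw)).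
Qed.

Variable K : nat.
Hypothesis rowK : forall w, row w <= K.
Let B := (d * K).+1.

(** Orbits of pairs of words are indexed by matrices of joint counts. Here the matrix is read from a
    tableau [M], its entry (k, j) being the multiplicity of j in row k. *)
Definition has_type (z y : 'I_d -> nat) (M : nat -> seq nat) : bool :=
  [forall k : 'I_K.+1, forall j : 'I_K.+1, joint_count z y k j == count_mem (j : nat) (M k)].

Lemma has_typeP z y M :
  reflect (forall k j, k <= K -> j <= K -> joint_count z y k j = count_mem j (M k))
          (has_type z y M).
Proof.
apply: (iffP forallP) => [h k j kK jK|h k]; last first.
  by apply/forallP => j; apply/eqP/h; rewrite -ltnS.
by have /forallP/(_ (Ordinal (jK : j < K.+1)))/eqP := h (Ordinal (kK : k < K.+1)).
Qed.

Lemma has_type_perm z y M (s : 'S_d) :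
  has_type (z \o s) (y \o s) M = has_type z y M.
Proof. by apply: eq_forallb => k; apply: eq_forallb => j; rewrite joint_count_perm. Qed.

Lemma eq_has_type z z' y y' M : z =1 z' -> y =1 y' -> has_type z y M = has_type z' y' M.
Proof.
by move=> ez ey; apply: eq_forallb => k; apply: eq_forallb => j; rewrite (eq_joint_count _ _ ez ey).
Qed.

Definition type_stat (M : nat -> seq nat) : nat :=
  \sum_(k < K.+1) \sum_(j < K.+1) B ^ (K.+1 - k) * j * count_mem (j : nat) (M k).

Lemma has_type_stat y M : (forall w, y w <= K) -> has_type row y M ->
  row_stat B K.+1 y = type_stat M.
Proof.
move=> yK /has_typeP h; rewrite /row_stat (@sum_joint_count _ K.+1 _ _ (fun i j => B ^ (K.+1 - i) * j)) //.
by apply: eq_bigr => k _; apply: eq_bigr => j _; rewrite (h k j (leq_ord k) (leq_ord j)).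
Qed.

(* The antisymmetrization over the column group of the indicator of
   [has_type y x M], as a function of [x]. *)
Definition alt_count (x : 'I_d -> nat) (M : nat -> seq nat) (y : 'I_d -> nat) : rat :=
  (\sum_(s in colgroup) (-1) ^+ s * (has_type y (x \o s) M)%:R)%R.

Lemma eq_alt_count x x' M y y' : x =1 x' -> y =1 y' -> alt_count x M y = alt_count x' M y'.
Proof.
move=> ex ey; apply: eq_bigr => s _.
by rewrite (eq_has_type _ ey (_ : x \o s =1 x' \o s)) // => w /=.
Qed.

Lemma alt_count_perm x M y (s : 'S_d) : s \in colgroup ->
  alt_count x M (y \o s) = ((-1) ^+ s * alt_count x M y)%R.
Proof.
move=> sC; rewrite /alt_count (reindex_inj (mulgI s)) /= big_distrr /=.
apply: eq_big => [u|u _]; first exact: colgroupM.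
rewrite odd_permM signr_addb -mulrA; congr (_ * (_ * (nat_of_bool _)%:R))%R.
rewrite -(has_type_perm y (x \o u) M s).
by apply: eq_has_type => // w /=; rewrite permM.
Qed.

(* A transposition of two equal entries of a column fixes [y] and is odd. *)
Lemma alt_count_distinct x M y : alt_count x M y != 0%R ->
  forall w w', col w = col w' -> y w = y w' -> w = w'.
Proof.
move=> g0 w w' cw yw; apply/eqP; apply: contraNT g0 => ww'.
have sC : tperm w w' \in colgroup by apply/colgroupP => v; case: tpermP => // ->.
have := alt_count_perm x M y sC; rewrite odd_tperm ww' expr1 mulN1r.
rewrite (_ : alt_count x M (y \o _) = alt_count x M y) => [/eqP|].
  by rewrite -subr_eq0 opprK -mulr2n mulrn_eq0.
by apply: eq_alt_count => // v /=; case: tpermP => // ->.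
Qed.

(** Triangularity: a nonzero alternating sum has a term [s] with [T \o s] of type [M]. Either [s] is
    the identity, or [row_stat_perm] makes the statistic grow. *)
Lemma alt_count_tri (T : 'I_d -> nat) M0 M :
  (forall w w', col w = col w' -> row w < row w' -> T w < T w') ->
  (forall w, T w <= K) -> has_type row T M0 -> alt_count T M row != 0%R ->
  type_stat M0 < type_stat M \/ has_type row T M.
Proof.
move=> Tinc TK T0 g0.
have [s sC sM] : exists2 s, s \in colgroup & has_type row (T \o s) M.
  apply/exists_inP; apply: contraNT g0; rewrite negb_exists_in => /forall_inP h.
  by rewrite /alt_count big1 // => s /h/negbTE->; rewrite mulr0.
have [s1|s1] := eqVneq s 1%g.
  by right; rewrite -(eq_has_type _ (frefl row) (_ : T \o s =1 T)) // s1 => w /=; rewrite perm1.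
left; rewrite -(has_type_stat TK T0) -(has_type_stat _ sM) => [|w]; last exact: TK.
exact: row_stat_perm.
Qed.

(** Only the identity contributes: any other element of the column group raises the row statistic,
    which the type determines. *)
Lemma alt_count_diag (T : 'I_d -> nat) M :
  (forall w w', col w = col w' -> row w < row w' -> T w < T w') ->
  (forall w, T w <= K) -> has_type row T M -> alt_count T M row = 1%R.
Proof.
move=> Tinc TK TM.
have oneC : 1%g \in colgroup by apply/colgroupP => w; rewrite perm1.
rewrite /alt_count (bigD1 1%g) //= big1 ?addr0 => [|s /andP[sC s1]].
  rewrite odd_perm1 mul1r (eq_has_type _ (frefl row) (_ : T \o (1%g : 'S_d) =1 T)) ?TM // => w /=.
  by rewrite perm1.
case: (boolP (has_type row (T \o s) M)) => [sM|]; last by rewrite mulr0.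
have := row_stat_perm Tinc TK rowK sC s1.
rewrite (has_type_stat TK TM) (has_type_stat _ sM) ?ltnn // => w; exact: TK.
Qed.

End Columns.

Lemma card_sum_bool (I : finType) (P : pred I) : #|[set w | P w]| = \sum_w P w.
Proof. by rewrite -sum1dep_card big_mkcond; apply: eq_bigr => w _; case: (P w). Qed.

Lemma count_mem_nth (s : seq nat) j :
  count_mem j s = \sum_(c < size s) (nth 0 s c == j).
Proof.
rewrite -sum1_count (big_nth 0) big_mkord big_mkcond.
by apply: eq_bigr => c _ /=; case: (_ == _).
Qed.

Lemma sum_count_mem K (s : seq nat) : all (leq^~ K) s ->
  \sum_(j < K.+1) count_mem (j : nat) s = size s.
Proof.
elim: s => [|i s IH] /=; first by rewrite big1.
move=> /andP[iK /IH <-]; rewrite big_split /= -[RHS]add1n; congr (_ + _).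
rewrite -[RHS](@sum_nat_delta K.+1 i (fun=> 1)) //.
by apply: eq_bigr => j _; rewrite mul1n.
Qed.

Lemma has_type_row d K (z y : 'I_d -> nat) M k :
  (forall w, z w <= K) -> (forall w, y w <= K) -> has_type K z y M ->
  all (leq^~ K) (M k) -> k <= K -> #|[set w | z w == k]| = size (M k).
Proof.
move=> zK yK /has_typeP h MK kK.
rewrite card_sum_bool (@sum_joint_count _ K.+1 z y (fun i _ => i == k)) //.
under eq_bigr => i _ do rewrite -big_distrr /= mulnC eq_sym.
rewrite (sum_nat_delta (fun i => \sum_(j < K.+1) joint_count z y i j)) // -(sum_count_mem MK).
by apply: eq_bigr => j _; rewrite h // -ltnS.
Qed.

Lemma has_type_col d K (z y : 'I_d -> nat) M j :
  (forall w, z w <= K) -> (forall w, y w <= K) -> has_type K z y M ->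
  j <= K -> #|[set w | y w == j]| = \sum_(k < K.+1) count_mem j (M k).
Proof.
move=> zK yK /has_typeP h jK.
rewrite card_sum_bool (@sum_joint_count _ K.+1 z y (fun _ k => k == j)) //.
apply: eq_bigr => i _; rewrite -h //; last by rewrite -ltnS.
under eq_bigr => k _ do rewrite mulnC eq_sym.
by rewrite (sum_nat_delta (fun k => joint_count z y i k)).
Qed.

Lemma column_strict_lt (lam : nat -> nat) (Y : nat -> seq nat) :
  (forall i, size (Y i) = lam i) -> (forall i, lam i.+1 <= lam i) ->
  (forall i c, c < size (Y i.+1) -> nth 0 (Y i) c < nth 0 (Y i.+1) c) ->
  forall i i' c, i < i' -> c < lam i' -> nth 0 (Y i) c < nth 0 (Y i') c.
Proof.
move=> szY lamS Ystrict i i' c; elim: i' => // i' IH.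
rewrite ltnS leq_eqVlt => /orP[/eqP<-|ii'] ci; first by apply: Ystrict; rewrite szY.
apply: (ltn_trans (IH ii' (leq_trans ci (lamS _)))).
by apply: Ystrict; rewrite szY.
Qed.

Definition word_val d K (y : {ffun 'I_d -> 'I_K}) (w : 'I_d) : nat := y w.

(** * A linear relation between products in a fixed degree *)

Section Core.
Variables (d K : nat) (I : finType) (Y Z : I -> nat -> seq nat) (c : I -> rat).
Variables (delta beta : nat -> nat).
Hypothesis sizeZ : forall a i, size (Z a i) = size (Y a i).
Hypothesis sizeS : forall a i, size (Y a i.+1) <= size (Y a i).
Hypothesis sizeK : forall a i, K < i -> size (Y a i) = 0.
Hypothesis sized : forall a, \sum_(i < K.+1) size (Y a i) = d.
Hypothesis YK : forall a i, all (leq^~ K) (Y a i).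
Hypothesis ZK : forall a i, all (leq^~ K) (Z a i).
Hypothesis Ystrict : forall a i l,
  l < size (Y a i.+1) -> nth 0 (Y a i) l < nth 0 (Y a i.+1) l.
Hypothesis Zstrict : forall a i l,
  l < size (Z a i.+1) -> nth 0 (Z a i) l < nth 0 (Z a i.+1) l.
Hypothesis contY : forall a j, j <= K -> \sum_(k < K.+1) count_mem j (Y a k) = beta j.
Hypothesis contZ : forall a j, j <= K -> \sum_(k < K.+1) count_mem j (Z a k) = delta j.
Hypothesis YZ_inj : forall a b,
  (forall k j, k <= K -> j <= K -> count_mem j (Y a k) = count_mem j (Y b k)) ->
  (forall k j, k <= K -> j <= K -> count_mem j (Z a k) = count_mem j (Z b k)) ->
  a = b.
(** The cardinal counts the middle words: it is the value at (z, x) of a product of two orbit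
    indicators in the classical Schur algebra of degree d. *)
Hypothesis rel : forall z x : {ffun 'I_d -> 'I_K.+1},
  (forall j, j <= K -> #|[set w | z w == j :> nat]| = delta j) ->
  (forall j, j <= K -> #|[set w | x w == j :> nat]| = beta j) ->
  (\sum_a c a * #|[set y : {ffun 'I_d -> 'I_K.+1} |
     has_type K (word_val y) (word_val z) (Z a) && has_type K (word_val y) (word_val x) (Y a)]|%:R = 0)%R.

Let nn a := \sum_(i < K.+1) i * size (Y a i).

Section Shape.
Variables (a1 : I) (row col : 'I_d -> nat).
Hypothesis rc_inj : forall w w', row w = row w' -> col w = col w' -> w = w'.
Hypothesis rc_down : forall w i, i <= row w ->
  exists2 w', row w' = i & col w' = col w.
Hypothesis rc_lt : forall w, col w < size (Y a1 (row w)).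
Hypothesis rc_sum : forall G : nat -> nat -> nat, \sum_(w < d) G (row w) (col w) =
  \sum_(i < K.+1) \sum_(l < size (Y a1 i)) G i l.

Let word (M : nat -> seq nat) (w : 'I_d) := nth 0 (M (row w)) (col w).

Lemma rowK w : row w <= K.
Proof. by rewrite leqNgt; apply/negP => h; have := rc_lt w; rewrite sizeK. Qed.

Lemma word_le (M : nat -> seq nat) w : (forall i, size (M i) = size (Y a1 i)) ->
  (forall i, all (leq^~ K) (M i)) -> word M w <= K.
Proof. by move=> sM MK; apply: (allP (MK (row w))); apply: mem_nth; rewrite sM rc_lt. Qed.

Lemma word_inc (M : nat -> seq nat) : (forall i, size (M i) = size (Y a1 i)) ->
  (forall i l, l < size (M i.+1) -> nth 0 (M i) l < nth 0 (M i.+1) l) ->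
  forall w w', col w = col w' -> row w < row w' -> word M w < word M w'.
Proof.
move=> sM Minc w w' cw rw; rewrite /word cw.
by apply: (column_strict_lt (lam := fun i => size (Y a1 i))).
Qed.

Lemma word_type (M : nat -> seq nat) : (forall i, size (M i) = size (Y a1 i)) ->
  has_type K row (word M) M.
Proof.
move=> sM; apply/has_typeP => k j kK jK; rewrite /joint_count card_sum_bool.
rewrite (rc_sum (fun r l => (r == k) && (nth 0 (M r) l == j))).
transitivity (\sum_(i < K.+1) count_mem j (M i) * (k == i)).
  apply: eq_bigr => i _; rewrite count_mem_nth sM big_distrl /=.
  by apply: eq_bigr => l _; rewrite mulnb andbC [k == _]eq_sym.
by rewrite (sum_nat_delta (fun i => count_mem j (M i))).
Qed.

Let T := word (Y a1).
Let S := word (Z a1).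
Let C := colgroup col.
Let G a := alt_count col K T (Y a).
Let rowf (s : 'S_d) : {ffun 'I_d -> 'I_K.+1} := [ffun w => inord (row (s w))].

Lemma rowfE s w : rowf s w = row (s w) :> nat.
Proof. by rewrite ffunE inordK // ltnS rowK. Qed.

Lemma ffun_word (U : 'I_d -> nat) : (forall w, U w <= K) ->
  exists f : {ffun 'I_d -> 'I_K.+1}, forall w, f w = U w :> nat.
Proof. by move=> UK; exists [ffun w => inord (U w)] => w; rewrite ffunE inordK ?ltnS. Qed.

(** The content of a middle word [y] is the shape of [a], so [nn a] is the total of its letters. *)
Lemma type_row_stat a (y x : 'I_d -> nat) : (forall w, y w <= K) -> (forall w, x w <= K) ->
  has_type K y x (Y a) -> nn a = \sum_w y w.
Proof.
move=> yK xK h; transitivity (\sum_w \sum_(i < K.+1) i * (y w == i)); last first.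
  by apply: eq_bigr => w _; rewrite (sum_nat_delta (fun i => i)) ?ltnS.
rewrite exchange_big; apply: eq_bigr => i _ /=; rewrite -big_distrr /=; congr (_ * _).
by rewrite -(has_type_row yK xK h (YK a i)) ?card_sum_bool // -ltnS.
Qed.

(** The signed sum over the column group of the instances of [rel] at z = [S] and x = [T \o s].
    These instances are available because rearranging a word keeps its content. *)
Lemma alt_relation :
  (\sum_a c a * \sum_(y : {ffun 'I_d -> 'I_K.+1})
    (has_type K (word_val y) S (Z a))%:R * G a (word_val y) = 0)%R.
Proof.
have TK w : T w <= K by apply: word_le.
have SK w : S w <= K by apply: word_le.
have [z zE] := ffun_word SK.
transitivity (\sum_(s in C) (-1) ^+ s * 0 : rat)%R; last by rewrite big1 // => s; rewrite mulr0.
transitivity (\sum_(s in C) (-1) ^+ s * (\sum_a c a * #|[set y : {ffun 'I_d -> 'I_K.+1} |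
     has_type K (word_val y) S (Z a) && has_type K (word_val y) (T \o s) (Y a)]|%:R))%R; last first.
  apply: eq_bigr => s sC; congr (_ * _)%R.
  have [x xE] := ffun_word (fun w => TK (s w)).
  rewrite -[RHS](rel (z := z) (x := x)) => [|j jK|j jK].
  - apply: eq_bigr => a _; congr (_ * _%:R)%R; apply: eq_card => y; rewrite !inE.
    by congr (_ && _); apply: eq_has_type => // w; rewrite /word_val ?zE ?xE.
  - rewrite -(contZ a1 jK) -(has_type_col rowK SK (word_type (sizeZ a1)) jK).
    by apply: eq_card => w; rewrite !inE zE.
  - have h : has_type K (row \o s) (T \o s) (Y a1).
      by rewrite has_type_perm; apply: word_type.
    rewrite -(contY a1 jK) -(has_type_col _ _ h jK) => [|w|w]; [|exact: rowK|exact: TK].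
    by apply: eq_card => w; rewrite !inE xE.
under [RHS]eq_bigr => s _ do rewrite big_distrr /=.
rewrite [RHS]exchange_big; apply: eq_bigr => a _ /=.
under [RHS]eq_bigr => s _ do rewrite mulrCA.
rewrite -[RHS]big_distrr /=; congr (_ * _)%R.
under [RHS]eq_bigr => s _ do rewrite card_sum_bool natr_sum big_distrr /=.
rewrite [RHS]exchange_big; apply: eq_bigr => y _ /=.
rewrite big_distrr /=; apply: eq_bigr => s _.
by rewrite mulrCA -mulnb natrM.
Qed.

(** A middle word with [G a] nonzero has distinct entries in each column, and its total [nn a] is at
    most that of [row]; by [column_distinct_row] it is [row \o s]. Along this orbit [G a] changes
    only by sign, and the signs together with the types against [S] form the second alternating
    sum. *)
Lemma alt_relation_factor a : nn a <= nn a1 ->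
  (\sum_(y : {ffun 'I_d -> 'I_K.+1})
    (has_type K (word_val y) S (Z a))%:R * G a (word_val y) =
   alt_count col K S (Z a) row * G a row)%R.
Proof.
have TK w : T w <= K by apply: word_le.
move=> le_nn.
have rowf_inj : {in C &, injective rowf}.
  move=> s u /colgroupP sC /colgroupP uC e; apply/permP => w; apply: rc_inj.
    by rewrite -!rowfE e.
  by rewrite sC uC.
rewrite (bigID (mem (rowf @: C))) /= [X in (_ + X)%R]big1 ?addr0 => [|y]; last first.
  apply: contraNeq; rewrite mulf_eq0 negb_or => /andP[_ g0].
  have ydist := alt_count_distinct g0.
  have [s sC sy] : exists2 s, s \in C & has_type K (word_val y) (T \o s) (Y a).
    apply/exists_inP; apply: contraNT g0; rewrite negb_exists_in => /forall_inP h.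
    by rewrite /G /alt_count big1 // => s /h/negbTE->; rewrite mulr0.
  have yK w : word_val y w <= K := leq_ord (y w).
  have TsK w : (T \o s) w <= K by exact: TK.
  have ny := type_row_stat yK TsK sy; have nr := type_row_stat rowK TK (word_type (fun=> erefl)).
  have [|u uC uy] := column_distinct_row rc_inj rc_down ydist.
    by rewrite -ny -nr.
  by apply/imsetP; exists u => //; apply/ffunP => w; apply: val_inj; rewrite [RHS]rowfE -[LHS]/(word_val y w) uy.
(* Replacing the summation index by its inverse moves the permutation from [row] to [S]. *)
rewrite (big_imset _ rowf_inj) /= /alt_count (reindex_inj invg_inj) /= big_distrl /=.
apply: eq_big => s; first by rewrite colgroupV.
rewrite colgroupV => sC; have sVC : (s^-1)%g \in C by rewrite colgroupV.
rewrite /G (@eq_alt_count _ _ _ T T _ _ (row \o (s^-1)%g)) // => [|w]; last exact: rowfE.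
rewrite (alt_count_perm _ _ _ _ sVC) odd_permV mulrA [(_%:R * _)%R]mulrC.
congr (_ * (nat_of_bool _)%:R * _)%R.
rewrite -(has_type_perm _ _ _ _ s); apply: eq_has_type => // w /=.
by rewrite [word_val _ _]rowfE permK.
Qed.

End Shape.

(** The relation is read at an index [a1] extremal among those with nonzero coefficient: [nn] is
    maximal, then the sum of the row statistics of its two tableaux. The term of [a1] is its
    coefficient. In any other term with nonzero coefficient one of the two alternating factors
    vanishes: otherwise [alt_count_tri] would either exceed the maximum or give both tableaux of
    [a1] back, against [YZ_inj]. *)
Theorem codeterminant_core a : c a = 0%R.
Proof.
apply/eqP; apply: contraT => ca.
case: (@arg_maxnP _ a (fun a => c a != 0%R) nn ca) => a0 ca0 max0.
pose st a := type_stat d K (Y a) + type_stat d K (Z a).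
have Pa0 : (c a0 != 0%R) && (nn a0 == nn a0) by rewrite ca0 /=.
case: (@arg_maxnP _ a0 (fun a => (c a != 0%R) && (nn a == nn a0)) st Pa0) => a1 /andP[ca1 /eqP na1] max1.
have [|rc [rc_inj rc_lt rc_ex rc_sum]] := @diagram_boxes d K.+1 (fun i => size (Y a1 i)) (sized a1).
  by move=> i; apply: sizeK.
pose row w := (rc w).1; pose col w := (rc w).2.
have inj w w' : row w = row w' -> col w = col w' -> w = w'.
  by move=> r e; apply: rc_inj; rewrite [LHS]surjective_pairing [RHS]surjective_pairing; congr pair.
have mono i j : i <= j -> size (Y a1 j) <= size (Y a1 i).
  by elim: j => [|j IH]; [rewrite leqn0 => /eqP->|rewrite leq_eqVlt => /predU1P[->//|/IH]; apply: leq_trans].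
have down w i : i <= row w -> exists2 w', row w' = i & col w' = col w.
  move=> /mono ir; have [w' e] := rc_ex i (col w) (leq_trans (rc_lt w) ir).
  by exists w'; rewrite /row /col e.
have TT := word_type rc_sum (M := Y a1) (fun=> erefl).
have ST := word_type rc_sum (sizeZ a1).
have TK w : nth 0 (Y a1 (row w)) (col w) <= K by apply: (@word_le a1).
have SK w : nth 0 (Z a1 (row w)) (col w) <= K by apply: (@word_le a1).
have rK w : row w <= K by apply: (@rowK a1 row col).
have Tinc := @word_inc a1 row col rc_lt (Y a1) (fun=> erefl) (@Ystrict a1).
have Sinc := @word_inc a1 row col rc_lt (Z a1) (sizeZ a1) (@Zstrict a1).
have /= fact := alt_relation_factor inj down rc_lt rc_sum.
have /= := alt_relation rc_lt rc_sum; rewrite (bigD1 a1) //= [X in (_ + X)%R]big1 ?addr0 => [|b ba1].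
  rewrite fact //.
  by rewrite !(alt_count_diag inj rK) // !mulr1 => /eqP; rewrite (negbTE ca1).
have [->|cb] := eqVneq (c b) 0%R; first by rewrite mul0r.
rewrite fact; last by rewrite na1; apply: max0.
apply/eqP; rewrite !mulf_eq0 (negbTE cb) /=; apply/norP => -[kZ kY].
(* Since [kY] is nonzero, [row] is also a middle word for [b], so [nn b] is the total of [row],
   which is [nn a1]. *)
have nb : nn b = nn a0.
  have [s sC sy] : exists2 s, s \in colgroup col & has_type K row ((fun w => nth 0 (Y a1 (row w)) (col w)) \o s) (Y b).
    apply/exists_inP; apply: contraNT kY; rewrite negb_exists_in => /forall_inP h.
    by rewrite /alt_count big1 // => s /h/negbTE->; rewrite mulr0.
  rewrite -na1 (type_row_stat rK _ sy); last by move=> w; exact: TK.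
  by rewrite (type_row_stat rK TK TT).
have := max1 b; rewrite cb nb eqxx => /(_ isT); rewrite /geq /= /st.
have := alt_count_tri inj rK Tinc TK TT kY; have := alt_count_tri inj rK Sinc SK ST kZ.
have statE M x : (forall w, x w <= K) -> has_type K row x M -> row_stat row (d * K).+1 K.+1 x = type_stat d K M.
  by move=> xK; apply: has_type_stat.
case=> [lt1|eq1]; case=> [lt2|eq2].
- by rewrite leqNgt -addSn leq_add // ltnW.
- by rewrite -(statE _ _ TK eq2) (statE _ _ TK TT) leqNgt ltn_add2l lt1.
- by rewrite -(statE _ _ SK eq1) (statE _ _ SK ST) leqNgt ltn_add2r lt2.
- move=> _; case/eqP: ba1; apply: YZ_inj => k j kK jK.
    by rewrite -(has_typeP _ _ _ _ eq2) // (has_typeP _ _ _ _ TT).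
  by rewrite -(has_typeP _ _ _ _ eq1) // (has_typeP _ _ _ _ ST).
Qed.

End Core.

(** * The Robinson-Schensted-Knuth correspondence by local rules *)

(** For partitions: b/a is a horizontal strip. *)
Definition interlace (a b : nat -> nat) : Prop := forall i, b i.+1 <= a i <= b i.

(* Each part of [rho] is reflected in the interval allowed by [mu] and [nu]:
   lambda_(i+1) + rho_i = min(mu_i, nu_i) + max(mu_(i+1), nu_(i+1)). *)
Definition local_rule (k : nat) (rho mu nu : nat -> nat) (i : nat) : nat :=
  if i is i'.+1 then minn (mu i') (nu i') + maxn (mu i) (nu i) - rho i'
  else maxn (mu 0) (nu 0) + k.

Lemma local_rule_interlace k rho mu nu : interlace rho mu -> interlace rho nu ->
  interlace mu (local_rule k rho mu nu) /\ interlace nu (local_rule k rho mu nu).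
Proof.
move=> hm hn; split=> -[|i] /=; move: (hm 0) (hn 0); try move: (hm i) (hn i);
  try move: (hm i.+1) (hn i.+1); lia.
Qed.

(** Interlacing makes the truncated subtraction exact. In this form the rule can be solved for [rho]
    as well. *)
Lemma local_ruleD k rho mu nu i : interlace rho mu -> interlace rho nu ->
  local_rule k rho mu nu i.+1 + rho i = minn (mu i) (nu i) + maxn (mu i.+1) (nu i.+1).
Proof. by move=> /(_ i) hm /(_ i) hn /=; lia. Qed.

Lemma local_rule_sum k rho mu nu L : interlace rho mu -> interlace rho nu ->
  mu L = 0 -> nu L = 0 ->
  \sum_(i < L.+1) local_rule k rho mu nu i + \sum_(i < L) rho i =
  k + \sum_(i < L) mu i + \sum_(i < L) nu i.
Proof.
move=> hm hn m0 n0.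
(* As min + max is the sum, the partial sums agree up to the last maximum. Keeping that term lets
   the induction run for every [L], without the vanishing of [mu L] and [nu L]. *)
suff h : \sum_(i < L.+1) local_rule k rho mu nu i + \sum_(i < L) rho i =
    k + \sum_(i < L) mu i + \sum_(i < L) nu i + maxn (mu L) (nu L).
  by rewrite h m0 n0 addn0.
elim: L {m0 n0} => [|L IH]; first by rewrite big_ord_recl !big_ord0 /=; lia.
rewrite big_ord_recr [\sum_(i < L.+1) rho i]big_ord_recr.
rewrite [\sum_(i < L.+1) mu i]big_ord_recr [\sum_(i < L.+1) nu i]big_ord_recr.
by have := local_ruleD k L hm hn; move: IH; rewrite -/(local_rule k rho mu nu) /=; lia.
Qed.

Section Growth.
Implicit Type m : nat -> nat -> nat.

(** Fomin's growth diagram: the shape attached to the entries with row index below i and column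
    index below j. The inner fixpoint fills one row of shapes from the whole previous row. *)
Fixpoint growth m (i : nat) : nat -> nat -> nat :=
  if i is i'.+1 then
    fix row j := if j is j'.+1
      then local_rule (m i' j') (growth m i' j') (growth m i' j) (row j')
      else fun=> 0
  else fun _ _ => 0.

Arguments growth : simpl never.

Lemma growthS m i j : growth m i.+1 j.+1 =
  local_rule (m i j) (growth m i j) (growth m i j.+1) (growth m i.+1 j).
Proof. by []. Qed.

Lemma growth_j0 m i : growth m i 0 = fun=> 0.
Proof. by case: i. Qed.

Lemma growth_interlace m i j :
  interlace (growth m i j) (growth m i j.+1) /\
  interlace (growth m i j) (growth m i.+1 j).
Proof.
suff [h1 h2] : (forall j, interlace (growth m i j) (growth m i j.+1)) /\
    (forall j, interlace (growth m i j) (growth m i.+1 j)) by [].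
have step i' : (forall j, interlace (growth m i' j) (growth m i' j.+1)) ->
    forall j, interlace (growth m i' j) (growth m i'.+1 j).
  move=> h; elim=> [|j' IH]; first by rewrite !growth_j0.
  by rewrite growthS; case: (local_rule_interlace (m i' j') (h j') IH).
suff h : forall j, interlace (growth m i j) (growth m i j.+1) by split=> //; apply: step.
elim: i => // i IH j'; rewrite growthS.
by case: (local_rule_interlace (m i j') (IH j') (step _ IH j')).
Qed.

Lemma growth_gt_i m i j k : i <= k -> growth m i j k = 0.
Proof.
elim: i k => // i IH [|k] // ik.
by have := (growth_interlace m i j).2 k; rewrite IH // leqn0 => /andP[/eqP].
Qed.

Lemma growth_gt_j m i j k : j <= k -> growth m i j k = 0.
Proof.
elim: j k => [|j IH] [|k] // jk; rewrite ?growth_j0 //.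
by have := (growth_interlace m i j).1 k; rewrite IH // leqn0 => /andP[/eqP].
Qed.

Lemma growth_sum m L i j : i <= L ->
  \sum_(k < L) growth m i j k = \sum_(a < i) \sum_(b < j) m a b.
Proof.
elim: i j L => [|i IH] j L iL; first by rewrite big_ord0 big1.
elim: j => [|j IHj]; first by rewrite growth_j0 !big1 // => a _; rewrite big_ord0.
case: L iL IHj => // L iL IHj.
have [h1 h2] := growth_interlace m i j.
have := local_rule_sum (L := L.+1) (m i j) h1 h2 (growth_gt_i m j.+1 (ltnW iL)) (growth_gt_i m j iL).
rewrite -growthS big_ord_recr [X in X + _]/= (growth_gt_i m j.+1 iL) addn0.
rewrite !IH ?(ltnW iL) // IHj.
have e n : \sum_(a < n) \sum_(b < j.+1) m a b =
    \sum_(a < n) \sum_(b < j) m a b + \sum_(a < n) m a j.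
  by rewrite -big_split; apply: eq_bigr => a _; rewrite big_ord_recr.
rewrite !e [\sum_(a < i.+1) m a j]big_ord_recr /=; lia.
Qed.

(** In each unit square the three outer shapes determine the fourth, by [local_ruleD], and the
    entry, by the first part of the local rule. Starting from the last row and the last column of
    shapes, all squares are recovered by descending induction. *)
Lemma growth_inj m m' K :
  (forall j, j <= K -> growth m K j =1 growth m' K j) ->
  (forall i, i <= K -> growth m i K =1 growth m' i K) ->
  forall i j, i < K -> j < K -> m i j = m' i j.
Proof.
move=> hj hi.
have back i j : growth m i.+1 j.+1 =1 growth m' i.+1 j.+1 ->
    growth m i j.+1 =1 growth m' i j.+1 -> growth m i.+1 j =1 growth m' i.+1 j ->
    growth m i j =1 growth m' i j /\ m i j = m' i j.
  rewrite !growthS => e1 e2 e3; split=> [k|]; last first.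
    by have := e1 0; rewrite /= e2 e3; apply: addnI.
  have [h1 h2] := growth_interlace m i j; have [h1' h2'] := growth_interlace m' i j.
  have := local_ruleD (m i j) k h1 h2; have := local_ruleD (m' i j) k h1' h2'.
  by rewrite e1 !e2 !e3 => <-; apply: addnI.
have eqG a : forall b, a <= K -> b <= K -> growth m (K - a) (K - b) =1 growth m' (K - a) (K - b).
  elim: a => [|a IHa] b aK bK; first by rewrite subn0; apply: hj; apply: leq_subr.
  elim: b bK => [|b IHb] bK; first by rewrite subn0; apply: hi; apply: leq_subr.
  have [ea eb] : (K - a = (K - a.+1).+1) /\ (K - b = (K - b.+1).+1) by lia.
  apply: (proj1 (back _ _ _ _ _)); rewrite -?ea -?eb.
  - by apply: IHa; apply: ltnW.
  - by apply: IHb; apply: ltnW.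
  - by apply: IHa => //; apply: ltnW.
move=> i j iK jK; have eqij i' j' : i' <= K -> j' <= K -> growth m i' j' =1 growth m' i' j'.
  by move=> iK' jK'; rewrite -(subKn iK') -(subKn jK'); apply: eqG; apply: leq_subr.
by have [] := back i j; [apply: eqij|apply: eqij => //; apply: ltnW|apply: eqij => //; apply: ltnW|].
Qed.

End Growth.

Section RSK.
Variables (K : nat).
Implicit Type m : nat -> nat -> nat.

Definition rsk_shape m : nat -> nat := growth m K K.
(** The shapes along the last row of the diagram form a chain of horizontal strips, that is, a
    semistandard tableau; this is the multiplicity of j in its row k. [rsk_col] does the same along
    the last column. *)
Definition rsk_row m k j : nat :=
  if j < K then growth m K j.+1 k - growth m K j k else 0.
Definition rsk_col m k i : nat :=
  if i < K then growth m i.+1 K k - growth m i K k else 0.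

Lemma rsk_row_prefix m k j : \sum_(a < j) rsk_row m k a = growth m K (minn j K) k.
Proof.
elim: j => [|j IH]; first by rewrite big_ord0 min0n growth_j0.
rewrite big_ord_recr /= IH /rsk_row; case: ltnP => jK.
  have := (growth_interlace m K j).1 k.
  by rewrite (minn_idPl jK) => /andP[_ /subnKC].
by rewrite addn0 (minn_idPr (leqW jK)).
Qed.

Lemma rsk_col_prefix m k i : \sum_(a < i) rsk_col m k a = growth m (minn i K) K k.
Proof.
elim: i => [|i IH]; first by rewrite big_ord0 min0n.
rewrite big_ord_recr /= IH /rsk_col; case: ltnP => iK.
  have := (growth_interlace m i K).2 k.
  by rewrite (minn_idPl iK) => /andP[_ /subnKC].
by rewrite addn0 (minn_idPr (leqW iK)).
Qed.

Lemma rsk_shapeS m k : rsk_shape m k.+1 <= rsk_shape m k.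
Proof.
have /andP[h _] := (growth_interlace m K K).1 k.
have /andP[_] := (growth_interlace m K K).1 k.+1.
by move=> h'; apply: leq_trans h.
Qed.

(** Interlacing of consecutive shapes, in the form of column strictness that [column_strict_count]
    takes. Past [K] the chain is constant and the claim is that the shape is decreasing. *)
Lemma rsk_row_semistd m k j :
  \sum_(a < j.+1) rsk_row m k.+1 a <= \sum_(a < j) rsk_row m k a.
Proof.
rewrite !rsk_row_prefix; case: (ltnP j K) => jK.
  by rewrite (minn_idPl jK); case/andP: ((growth_interlace m K j).1 k).
by rewrite (minn_idPr (leqW jK)); apply: rsk_shapeS.
Qed.

Lemma rsk_col_semistd m k j :
  \sum_(a < j.+1) rsk_col m k.+1 a <= \sum_(a < j) rsk_col m k a.
Proof.
rewrite !rsk_col_prefix; case: (ltnP j K) => jK.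
  by rewrite (minn_idPl jK); case/andP: ((growth_interlace m j K).2 k).
by rewrite (minn_idPr (leqW jK)); apply: rsk_shapeS.
Qed.

Lemma rsk_row_sum m k : \sum_(j < K) rsk_row m k j = rsk_shape m k.
Proof. by rewrite rsk_row_prefix minnn. Qed.

Lemma rsk_col_sum m k : \sum_(i < K) rsk_col m k i = rsk_shape m k.
Proof. by rewrite rsk_col_prefix minnn. Qed.

Lemma rsk_row_content m j : j < K -> \sum_(k < K) rsk_row m k j = \sum_(i < K) m i j.
Proof.
move=> jK; apply: (@addnI (\sum_(k < K) growth m K j k)).
rewrite -big_split /= (eq_bigr (fun k : 'I_K => growth m K j.+1 k)) => [|k _].
  rewrite !growth_sum // -big_split; apply: eq_bigr => a _ /=.
  by rewrite big_ord_recr.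
by rewrite /rsk_row jK subnKC //; case/andP: ((growth_interlace m K j).1 k).
Qed.

Lemma rsk_col_content m i : i < K -> \sum_(k < K) rsk_col m k i = \sum_(j < K) m i j.
Proof.
move=> iK; apply: (@addnI (\sum_(k < K) growth m i K k)).
rewrite -big_split /= (eq_bigr (fun k : 'I_K => growth m i.+1 K k)) => [|k _].
  by rewrite !growth_sum // ?(ltnW iK) // big_ord_recr.
by rewrite /rsk_col iK subnKC //; case/andP: ((growth_interlace m i K).2 k).
Qed.

Lemma rsk_row_gt m k j : K <= k -> rsk_row m k j = 0.
Proof. by move=> kK; rewrite /rsk_row !growth_gt_i // if_same. Qed.

Lemma rsk_col_gt m k i : K <= k -> rsk_col m k i = 0.
Proof. by move=> kK; rewrite /rsk_col !growth_gt_j // if_same. Qed.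

Lemma rsk_inj m m' :
  (forall k j, k < K -> j < K -> rsk_row m k j = rsk_row m' k j) ->
  (forall k i, k < K -> i < K -> rsk_col m k i = rsk_col m' k i) ->
  forall i j, i < K -> j < K -> m i j = m' i j.
Proof.
move=> er ec; apply: growth_inj => [j jK k|i iK k].
  rewrite -(minn_idPl jK) -!rsk_row_prefix; apply: eq_bigr => a _.
  have [kK|kK] := ltnP k K; last by rewrite !rsk_row_gt.
  by apply: er => //; apply: leq_trans jK.
rewrite -(minn_idPl iK) -!rsk_col_prefix; apply: eq_bigr => a _.
have [kK|kK] := ltnP k K; last by rewrite !rsk_col_gt.
by apply: ec => //; apply: leq_trans iK.
Qed.

End RSK.

(** * Tableaux with prescribed letter counts *)

Section Tableau.

Lemma sorted_nth_lt (s : seq nat) j l :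
  sorted leq s -> l < size s -> (nth 0 s l < j) = (l < count (fun x => x < j) s).
Proof.
elim: s l => // x s IH l /= xs; have ss := path_sorted xs.
case: (ltnP x j) => [xj|jx].
  by case: l => [|l] //= ls; rewrite IH.
move=> ls; rewrite add0n; have -> : count (fun x => x < j) s = 0.
  apply/eqP; rewrite -leqn0 leqNgt -has_count; apply/hasPn => y ys.
  by rewrite -leqNgt (leq_trans jx) //; apply: (allP (order_path_min leq_trans xs)).
case: l ls => [|l] ls /=; first by rewrite ltnNge jx.
by rewrite ltnNge (leq_trans jx) //; apply: (allP (order_path_min leq_trans xs)); apply: mem_nth.
Qed.

Lemma column_strict_count (Y : nat -> seq nat) : (forall i, sorted leq (Y i)) ->
  (forall i j, count (fun x => x < j.+1) (Y i.+1) <= count (fun x => x < j) (Y i)) ->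
  forall i l, l < size (Y i.+1) -> nth 0 (Y i) l < nth 0 (Y i.+1) l.
Proof.
move=> Ysort Ycount i l ls; set j := nth 0 (Y i.+1) l.
have lj : l < count (fun x => x < j) (Y i).
  by apply: leq_trans (Ycount i j); rewrite -sorted_nth_lt.
by rewrite sorted_nth_lt // (leq_trans lj) // count_size.
Qed.

Definition row_word (r : nat -> nat) (K : nat) : seq nat :=
  flatten [seq nseq (r j) j | j <- iota 0 K].

Lemma count_row_word (P : pred nat) r K :
  count P (row_word r K) = \sum_(j < K) P j * r j.
Proof.
rewrite /row_word; elim: K => [|K IH]; first by rewrite big_ord0.
by rewrite -addn1 iotaD map_cat flatten_cat count_cat IH /= cats0 count_nseq addn1 big_ord_recr.
Qed.

Lemma size_row_word r K : size (row_word r K) = \sum_(j < K) r j.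
Proof. by rewrite -count_predT count_row_word; apply: eq_bigr => j _; rewrite mul1n. Qed.

Lemma count_mem_row_word r K j : j < K -> count_mem j (row_word r K) = r j.
Proof.
move=> jK; rewrite count_row_word (bigD1 (Ordinal jK)) //= eqxx mul1n big1 ?addn0 // => i.
by rewrite -val_eqE /= => /negbTE->.
Qed.

Lemma row_word_lt r K : all (fun x => x < K) (row_word r K).
Proof.
apply/allP => x /flattenP[_ /mapP[j + ->]].
by rewrite mem_iota => jK /nseqP[->].
Qed.

Lemma sorted_row_word r K : sorted leq (row_word r K).
Proof.
elim: K => // K IH; rewrite /row_word -addn1 iotaD map_cat flatten_cat /= cats0 add0n.
rewrite -/(row_word r K) (sorted_pairwise leq_trans) pairwise_cat.
rewrite -!(sorted_pairwise leq_trans) IH /=; apply/andP; split; last first.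
  by apply: (@pairwise_sorted _ leq); elim: (r K) => //= n ->; rewrite andbT; apply/allP => y /nseqP[->].
by apply/allrelP => x y /(allP (row_word_lt _ _)) xK /nseqP[-> _]; apply: ltnW.
Qed.

Lemma count_lt_row_word r K j : (forall i, K <= i -> r i = 0) ->
  count (fun x => x < j) (row_word r K) = \sum_(a < j) r a.
Proof.
move=> r0; rewrite count_row_word.
rewrite (big_ord_widen (maxn j K) (fun i => (i < j) * r i)) ?leq_maxr //.
rewrite (big_ord_widen (maxn j K) r) ?leq_maxl // [LHS]big_mkcond [RHS]big_mkcond /=.
apply: eq_bigr => i _; case: (ltnP i K) => [_|/r0->]; last by rewrite if_same.
by case: (i < j); rewrite ?mul1n.
Qed.

End Tableau.

(** * Polynomiality of word counts *)

Lemma bin_poly (e : nat) :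
  exists P : {poly rat}, forall m : nat, (P.[m%:R] = 'C(m, e)%:R)%R.
Proof.
elim: e => [|e [P PE]]; first by exists 1%R => m; rewrite hornerC bin0.
exists (e.+1%:R^-1 *: (P * ('X - e%:R%:P)))%R => m.
rewrite hornerZ hornerM PE hornerXsubC.
apply: (@mulfI _ (e.+1%:R)%R); first by rewrite pnatr_eq0.
rewrite mulrA divff ?pnatr_eq0 // mul1r -natrM mul_bin_left natrM.
case: (leqP e m) => [em|me]; first by rewrite natrB // mulrC.
by rewrite bin_small // mulr0 mul0r.
Qed.

(* Sums of binomials are closed under sums and discrete antiderivatives. *)
Definition binomial_sum (g : nat -> nat) : Prop :=
  exists s : seq nat, forall m, g m = \sum_(e <- s) 'C(m, e).

Lemma binomial_sum_poly g : binomial_sum g -> forall N,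
  exists P : {poly rat}, forall p, N <= p -> (P.[p%:R] = (g (p - N)%N)%:R)%R.
Proof.
move=> [s gE] N.
suff [P PE] : exists P : {poly rat}, forall m : nat, (P.[m%:R] = (g m)%:R)%R.
  exists (P \Po ('X - N%:R%:P))%R => p Np.
  by rewrite horner_comp hornerXsubC -natrB.
elim: s g gE => [|e s IH] g gE.
  by exists 0%R => m; rewrite gE big_nil horner0.
have [P PE] := IH _ (fun m => erefl (\sum_(e <- s) 'C(m, e))).
have [Q QE] := bin_poly e.
by exists (Q + P)%R => m; rewrite gE big_cons hornerD PE QE natrD.
Qed.

Lemma binomial_sum0 : binomial_sum (fun=> 0).
Proof. by exists [::] => m; rewrite big_nil. Qed.

Lemma binomial_sumD g h : binomial_sum g -> binomial_sum h ->
  binomial_sum (fun m => g m + h m).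
Proof. by move=> [s gE] [u hE]; exists (s ++ u) => m; rewrite big_cat gE hE. Qed.

Lemma eq_binomial_sum g h : g =1 h -> binomial_sum g -> binomial_sum h.
Proof. by move=> e [s gE]; exists s => m; rewrite -e. Qed.

Lemma binomial_sum_big (I : Type) (r : seq I) (P : pred I) (g : I -> nat -> nat) :
  (forall i, P i -> binomial_sum (g i)) ->
  binomial_sum (fun m => \sum_(i <- r | P i) g i m).
Proof.
move=> h; elim: r => [|i r IH].
  by apply: eq_binomial_sum binomial_sum0 => m; rewrite big_nil.
case Pi: (P i); last by apply: eq_binomial_sum IH => m; rewrite big_cons Pi.
by apply: eq_binomial_sum (binomial_sumD (h i Pi) IH) => m; rewrite big_cons Pi.
Qed.

Lemma binomial_sum_step g h : (forall m, g m.+1 = g m + h m) ->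
  binomial_sum h -> binomial_sum g.
Proof.
move=> gS [s hE]; exists (nseq (g 0) 0 ++ map S s) => m.
rewrite big_cat big_nseq big_map /=.
have -> k : iter k (addn 'C(m, 0)) 0 = k by elim: k => //= k ->; rewrite bin0.
elim: m => [|m IH]; first by rewrite big1_seq ?addn0.
by rewrite gS IH hE -addnA -big_split /=; congr (_ + _).
Qed.

Section CountWords.
Variables (A J : finType) (a : nat -> A -> J -> nat).

(** An abstract form of the counts of middle words: the letter k at position w adds [a w k j] to the
    j-th total, and all totals are prescribed. *)
Definition count_words (p : nat) (v : J -> nat) : nat :=
  #|[set y : {ffun 'I_p -> A} | [forall j, \sum_(w < p) a w (y w) j == v j]]|.

Let snoc p (ky : A * {ffun 'I_p -> A}) : {ffun 'I_p.+1 -> A} :=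
  [ffun i => if unlift ord_max i is Some j then ky.2 j else ky.1].

Lemma count_wordsS p v : count_words p.+1 v =
  \sum_(k | [forall j, a p k j <= v j]) count_words p (fun j => v j - a p k j).
Proof.
have snoc_bij : bijective (@snoc p).
  exists (fun f : {ffun 'I_p.+1 -> A} => (f ord_max, [ffun j : 'I_p => f (lift ord_max j)])) => [[k y]|f].
    rewrite ffunE unlift_none /=; congr pair; apply/ffunP => j.
    by rewrite !ffunE liftK.
  by apply/ffunP => i; rewrite ffunE; case: unliftP => [j ->|->]; rewrite ?ffunE.
have widen_lift (i : 'I_p) : widen_ord (leqnSn p) i = lift ord_max i.
  by apply: val_inj; exact: esym (lift_max i).
rewrite /count_words -sum1dep_card (reindex _ (onW_bij _ snoc_bij)) /=.
under [RHS]eq_bigr => k _ do rewrite -sum1dep_card.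
rewrite pair_big_dep /=; apply: eq_bigl => -[k y] /=.
have sumE j : \sum_(w < p.+1) a w (snoc (k, y) w) j = \sum_(w < p) a w (y w) j + a p k j.
  rewrite big_ord_recr /= ffunE unlift_none /=; congr (_ + _); apply: eq_bigr => i _.
  by rewrite ffunE -[in unlift _ _]/(widen_ord (leqnSn p) i) widen_lift liftK.
apply/forallP/andP => [h|[/forallP h1 /forallP h2] j]; last first.
  by rewrite sumE (eqP (h2 j)) subnK.
split; apply/forallP => j; have := h j; rewrite sumE => /eqP<-; first exact: leq_addl.
by rewrite addnK.
Qed.

(** From position [N] on, the letter [k0] adds nothing and any other letter lowers the totals that
    remain. So the difference in the length is a finite sum of counts with smaller totals, and the
    count is an antiderivative of it. *)
Lemma count_words_poly (N : nat) (k0 : A) (v : J -> nat) :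
  (forall w k, N <= w -> a w k = a N k) -> (forall j, a N k0 j = 0) ->
  (forall k, k != k0 -> exists j, 0 < a N k j) ->
  exists P : {poly rat}, forall p, N <= p -> (P.[p%:R] = (count_words p v)%:R)%R.
Proof.
move=> aN a0 apos.
suff h : binomial_sum (fun m => count_words (N + m) v).
  have [P PE] := binomial_sum_poly h N.
  by exists P => p Np; rewrite PE // subnKC.
have [n le_n] := ubnP (\sum_j v j); elim: n v le_n => // n IH v le_n.
pose Q k := [forall j, a N k j <= v j].
apply: (@binomial_sum_step _ (fun m => \sum_(k | Q k && (k != k0)) count_words (N + m) (fun j => v j - a N k j))).
  move=> m; rewrite addnS count_wordsS.
  under eq_bigl => k do rewrite aN ?leq_addr //.
  rewrite (bigD1 k0) /=; last by apply/forallP => j; rewrite a0.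
  congr (_ + _).
    by apply: eq_card => y; rewrite !inE; apply: eq_forallb => j; rewrite aN ?leq_addr // a0 subn0.
  apply: eq_bigr => k _; apply: eq_card => y; rewrite !inE.
  by apply: eq_forallb => j; rewrite aN ?leq_addr.
apply: binomial_sum_big => k /andP[/forallP Qk kk0]; apply: IH.
have [j j0] := apos k kk0; move: le_n; rewrite ltnS; apply: leq_trans.
rewrite (bigD1 j) // [X in _ < X](bigD1 j) //= -addSn leq_add //.
  by have := Qk j; lia.
by apply: leq_sum => i _; apply: leq_subr.
Qed.

End CountWords.

(** * Points of the coset spaces as labellings *)

Local Open Scope card_scope.
Local Open Scope classical_set_scope.
Local Open Scope nat_scope.

Lemma card_uniq_seq (T : eqType) (s : seq T) : uniq s -> [set` s] #= `I_(size s).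
Proof.
case: s => [|x0 s'] us.
  have -> : [set` ([::] : seq T)] = set0 by apply/seteqP; split.
  by rewrite II0 card_eq00.
set s := x0 :: s' in us *.
have -> : [set` s] = nth x0 s @` `I_(size s).
  apply/seteqP; split=> [x /= /(nthP x0)[i]|_ [i /= h <-]]; [by exists i|exact: mem_nth].
by apply: inj_card_eq => i j /set_mem hi /set_mem hj /eqP; rewrite nth_uniq // => /eqP.
Qed.

Lemma card_count (P : pred nat) N : (forall w, P w -> w < N) ->
  [set w | P w] #= `I_(count P (iota 0 N)).
Proof.
move=> PN; rewrite -size_filter.
have -> : [set w | P w] = [set` [seq w <- iota 0 N | P w]].
  apply/seteqP; split=> w /=; rewrite mem_filter mem_iota; last by case/andP.
  by move=> Pw; rewrite Pw PN.
by apply: card_uniq_seq; rewrite filter_uniq ?iota_uniq.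
Qed.

Lemma card_eq_nat T (A : set T) m m' : A #= `I_m -> A #= `I_m' -> m = m'.
Proof. by move=> h h'; apply/card_eq_II; rewrite -(card_eql h). Qed.

Lemma card_count_eq (P : pred nat) N m : (forall w, P w -> w < N) ->
  [set w | P w] #= `I_m <-> count P (iota 0 N) = m.
Proof.
move=> PN; have h := card_count PN; split=> [|<- //]; exact: card_eq_nat h.
Qed.

Section BaseLabel.
Variable b : nat -> QT.

Let start k := \sum_(1 <= i < k) natq (b i).

Lemma startS k : 0 < k -> start k.+1 = start k + natq (b k).
Proof. by move=> k0; rewrite /start big_nat_recr. Qed.

Lemma start_mono k k' : 0 < k -> k <= k' -> start k <= start k'.
Proof. by move=> k0 kk; rewrite /start (@big_cat_nat _ _ _ k 1 k') //= leq_addr. Qed.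

Lemma block_uniq k k' w : block b k w -> block b k' w -> k = k'.
Proof.
wlog lekk : k k' / k <= k' => [wl|].
  by case/orP: (leq_total k k') => h hk hk'; [apply: wl|apply/esym/wl].
rewrite /block; case: eqP => [->|/eqP k0] hk.
  case: eqP => [->//|/eqP k'0] hk'; case: hk; exists k' => //=; by rewrite lt0n.
rewrite gtn_eqF => [hk'|]; last by rewrite (leq_trans _ lekk) // lt0n.
move: lekk; rewrite leq_eqVlt => /orP[/eqP//|kk].
move: hk hk'; rewrite /segment /= => /andP[_ h] /andP[h' _].
have := start_mono (ltn0Sn k) kk; rewrite /start; lia.
Qed.

Lemma block_ex w : exists k, block b k w.
Proof.
have [[k k0 hk]|h] := pselect ((\bigcup_(j in [set j | 0 < j]) segment b j) w); last first.
  by exists 0; rewrite /block eqxx.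
by exists k; rewrite /block gtn_eqF.
Qed.

Definition base_label (w : nat) : nat := xget 0 [set k | block b k w].

Lemma base_labelP k w : block b k w <-> base_label w = k.
Proof.
rewrite /base_label; case: xgetP => [k' _ hk'|h]; last first.
  by have [k' hk'] := block_ex w; case: (h k').
by split=> [|<-//] /(block_uniq hk').
Qed.

Lemma youngP u : young b u <-> forall w, base_label (u w) = base_label w.
Proof.
split=> [h w|h k].
  have /base_labelP hw : base_label w = base_label w by [].
  by apply/base_labelP; rewrite -(h (base_label w)); exists w.
apply/seteqP; split=> [_ [w /base_labelP hw <-]|w /base_labelP hw].
  by apply/base_labelP; rewrite h.
by exists (sym_inv u w); rewrite ?sym_invK //; apply/base_labelP; rewrite -h sym_invK.
Qed.

Lemma card_base_label k : 0 < k -> [set w | base_label w == k] #= `I_(natq (b k)).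
Proof.
move=> k0; apply/(@card_count_eq _ (start k.+1)) => [w /eqP/base_labelP|].
  by rewrite /block gtn_eqF // => /andP[].
rewrite (@eq_count _ _ (fun w => (start k <= w) && (w < start k.+1))) => [|w]; last first.
  apply/eqP/idP => [/base_labelP|h]; first by rewrite /block gtn_eqF.
  by apply/base_labelP; rewrite /block gtn_eqF.
rewrite startS // iotaD count_cat add0n.
rewrite (@eq_in_count _ _ pred0) => [|w]; last by rewrite mem_iota /= => h; lia.
rewrite count_pred0 add0n (@eq_in_count _ _ predT) => [|w]; last by rewrite mem_iota /= => h; lia.
by rewrite count_predT size_iota.
Qed.

End BaseLabel.

Lemma base_label_bounded n (b : weight n) :
  exists N, forall w, N <= w -> base_label b w = 0.
Proof.
have [N bN] := segment_bounded b; exists N => w Nw.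
case E : (base_label b w) => [|k] //.
by have /base_labelP := E; rewrite /block /= => /bN /=; rewrite ltnNge Nw.
Qed.

(** Nothing is assumed on the default label [t0]: below [N] its multiplicity is what the other
    labels leave. The two label sequences of length [N] are then rearrangements of each other, and
    the rearrangement is extended by the identity. *)
Lemma exists_sym (T : eqType) (t0 : T) (l l' : nat -> T) N :
  (forall w, N <= w -> l w = t0) -> (forall w, N <= w -> l' w = t0) ->
  (forall t, t != t0 ->
     count (fun w => l w == t) (iota 0 N) = count (fun w => l' w == t) (iota 0 N)) ->
  exists s : sym_inf, (forall w, N <= w -> s w = w) /\ forall w, l' (s w) = l w.
Proof.
move=> l0 l'0 cnt.
have cE (f : nat -> T) t : count_mem t [tuple f i | i < N] = count (fun w => f w == t) (iota 0 N).
  by rewrite /= count_map -val_enum_ord count_map; apply: eq_count.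
have sz (f : nat -> T) : count_mem t0 [tuple f i | i < N] + count (predC1 t0) [tuple f i | i < N] = N.
  by rewrite (count_predC (pred1 t0)) size_tuple.
have pc : perm_eq [tuple l i | i < N] [tuple l' i | i < N].
  have ne t : t != t0 -> count_mem t [tuple l i | i < N] = count_mem t [tuple l' i | i < N].
    by move=> tt; rewrite !cE cnt.
  have pf : perm_eq (seq.filter (predC1 t0) [tuple l i | i < N]) (seq.filter (predC1 t0) [tuple l' i | i < N]).
    apply/allP => t; rewrite mem_cat !mem_filter => tt.
    have {}tt : t != t0 by case/orP: tt => /andP[].
    rewrite /= !count_filter; apply/eqP.
    transitivity (count_mem t [tuple l i | i < N]).
      by apply: eq_count => v /=; case: eqP => //= ->; rewrite tt.
    rewrite ne //; apply: eq_count => v /=; case: eqP => //= ->; by rewrite tt.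
  apply/allP => t _ /=; case: (eqVneq t t0) => [->|/ne->//].
  have := sz l; have := sz l'; rewrite -!size_filter (perm_size pf) !size_filter => h1 h2.
  by apply/eqP; apply: (@addIn (count (predC1 t0) [tuple l' i | i < N])); rewrite h1 h2.
have /tuple_permP[p pE] := pc.
have lp (i : 'I_N) : l i = l' (p i).
  have /val_inj/(congr1 (fun t => tnth t i)) := pE.
  by rewrite !tnth_mktuple.
pose ext (p : 'S_N) w := if insub w is Some i then (p i : nat) else w.
have extE (q : 'S_N) (i : 'I_N) : ext q i = q i by rewrite /ext valK.
have extN q w : N <= w -> ext q w = w by move=> h; rewrite /ext insubN // -leqNgt.
have extK (q : 'S_N) : cancel (ext q) (ext q^-1%g).
  move=> w; case: (ltnP w N) => [wN|Nw]; last by rewrite !extN.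
  by rewrite -[w]/(nat_of_ord (Ordinal wN)) !extE permK.
have extK' : cancel (ext p^-1%g) (ext p) by have := extK p^-1%g; rewrite invgK.
exists (SymInf (extK p) extK'); split=> w /= => [/extN//|].
case: (ltnP w N) => [wN|Nw]; last by rewrite extN // l0 // l'0.
by rewrite -[w]/(nat_of_ord (Ordinal wN)) extE lp.
Qed.

Definition swap_fun (a b w : nat) : nat :=
  if w == a then b else if w == b then a else w.

Lemma swap_funK a b : cancel (swap_fun a b) (swap_fun a b).
Proof. by move=> w; rewrite /swap_fun; do ![case: eqP => //]; lia. Qed.

Lemma support_lt (l : nat -> nat) N k : 0 < k -> (forall w, N <= w -> l w = 0) ->
  forall w, l w == k -> w < N.
Proof. by move=> k0 h w /eqP lw; rewrite ltnNge; apply/negP => /h; lia. Qed.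

Section Label.
Variables (n : option nat) (b : weight n).
Implicit Type x : Xsp b.

(* The 0-based index of the block of [x] containing [w]. *)
Definition label x (w : nat) : nat :=
  base_label b (sym_inv (xget 1%g [set s | x = Xpt b s]) w).

Lemma label_pt s w : label (Xpt b s) w = base_label b (sym_inv s w).
Proof.
rewrite /label; case: xgetP => [r _ /= sr|/(_ s)/(_ erefl)//].
have /youngP/(_ (sym_inv s w)) : young b (r^-1 * s)%g.
  by apply/(coset_pt_eq (@young_group b)).
by rewrite /= sym_invK.
Qed.

Lemma Xpt_ex x : exists s, x = Xpt b s.
Proof. exact: coset_ptP. Qed.

Lemma label_act g x w : label (act g x) w = label x (sym_inv g w).
Proof.
have [s ->] := Xpt_ex x.
by rewrite [act _ _]coset_act_pt -/(Xpt b _) !label_pt.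
Qed.

Lemma label_inj x y : label x =1 label y -> x = y.
Proof.
have [s ->] := Xpt_ex x; have [r ->] := Xpt_ex y => h.
apply/(coset_pt_eq (@young_group b))/youngP => w /=.
by have := h (s w); rewrite !label_pt sym_funK.
Qed.

Lemma label_bounded x : exists N, forall w, N <= w -> label x w = 0.
Proof.
have [s ->] := Xpt_ex x; have [N bN] := base_label_bounded b.
exists (\max_(v < N) (s v).+1) => w; apply: contraTeq; rewrite label_pt -ltnNge.
case: (leqP N (sym_inv s w)) => [/bN-> //|h _].
by rewrite -[X in X < _](sym_invK s) (@leq_bigmax _ (fun v : 'I_N => (s v).+1) (Ordinal h)).
Qed.

Lemma card_label x k : 0 < k -> [set w | label x w == k] #= `I_(natq (b k)).
Proof.
move=> k0; have [s ->] := Xpt_ex x.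
apply: card_eq_trans (card_base_label b k0).
have -> : [set w | label (Xpt b s) w == k] = s @` [set w | base_label b w == k].
  apply/seteqP; split=> [w /=|_ [v /= h <-]]; rewrite label_pt ?sym_funK //.
  by exists (sym_inv s w); rewrite ?sym_invK.
by apply: inj_card_eq => v v' _ _; apply: (can_inj (@sym_funK s)).
Qed.

Lemma count_label x k N : 0 < k -> (forall w, N <= w -> label x w = 0) ->
  count (fun w => label x w == k) (iota 0 N) = natq (b k).
Proof.
by move=> k0 h; apply/(card_count_eq _ (support_lt k0 h)); exact: card_label.
Qed.

Lemma label_surj (l : nat -> nat) N : (forall w, N <= w -> l w = 0) ->
  (forall k, 0 < k -> count (fun w => l w == k) (iota 0 N) = natq (b k)) ->
  exists x, label x =1 l.
Proof.
move=> l0 lk; have [M bM] := base_label_bounded b.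
have [N0 M0] := (leq_maxl N M, leq_maxr N M).
have := @exists_sym _ 0 l (base_label b) (maxn N M).
case=> [w /(leq_trans N0)/l0|w /(leq_trans M0)/bM|k|s [_ sE]] //.
  rewrite -lt0n => k0; have lN := support_lt k0 l0; have bM' := support_lt k0 bM.
  have <- : count (fun w => l w == k) (iota 0 N) = count (fun w => l w == k) (iota 0 (maxn N M)).
    apply: card_eq_nat (card_count lN) (card_count _) => w /lN h.
    exact: leq_trans h N0.
  rewrite lk //; apply/esym/card_count_eq; last exact: card_base_label.
  by move=> w /bM' h; exact: leq_trans h M0.
by exists (Xpt b s^-1%g) => w; rewrite label_pt /= sE.
Qed.

Lemma fixing_label x p :
  (forall s, fixing p s -> act s x = x) <-> forall w, p <= w -> label x w = 0.
Proof.
split=> [h w pw|h s sp]; last first.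
  apply: label_inj => w; rewrite label_act; case: (ltnP w p) => wp.
    by rewrite -{1}(sp w wp) sym_funK.
  rewrite !h //; rewrite leqNgt; apply/negP => wp'.
  by have := sp _ wp'; rewrite sym_invK => e; move: wp'; rewrite -e ltnNge wp.
(* Exchanging w with the point [v], where the label is 0, fixes every point below p. As it also
   fixes x, the labels at w and at [v] agree. *)
have [N xN] := label_bounded x; pose v := maxn p N.
pose s := SymInf (@swap_funK w v) (@swap_funK w v).
have /h/(congr1 (fun y => label y w)) : fixing p s.
  by move=> a ap; rewrite /= /swap_fun; do ![case: eqP]; rewrite /v; lia.
rewrite label_act /= /swap_fun eqxx => <-; apply: xN; exact: leq_maxr.
Qed.

End Label.

(** Removes the group elements. If z and x are the classes of s and r, then s carries the block
    intersections for sigma = s^-1 r onto the sets of points with given labels. *)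
Lemma xiE n (delta beta : weight n) q (z : Xsp delta) (x : Xsp beta) :
  xi q z x = (`[< forall i j, (i, j) != (0, 0) ->
    [set w | (label z w == i) && (label x w == j)] #= `I_(natq (q i j)) >])%:R%R.
Proof.
rewrite /xi; congr (nat_of_bool _)%:R%R; apply: asbool_equiv_eq.
have E (s sigma : sym_inf) i j : [set w | (label (Xpt delta s) w == i) && (label (Xpt beta (s * sigma)%g) w == j)] =
    s @` (block delta i `&` [set sigma w | w in block beta j]).
  apply/seteqP; split=> [w /=|_ [w [/base_labelP hi [v /base_labelP hj vw]] <-]] /=; last first.
    by rewrite !label_pt /= sym_funK hi -vw sym_funK hj !eqxx.
  rewrite !label_pt /= => /andP[/eqP hi /eqP hj]; exists (sym_inv s w); last exact: sym_invK.
  split; first exact/base_labelP.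
  by exists (sym_inv sigma (sym_inv s w)); [exact/base_labelP|exact: sym_invK].
have C (s : sym_inf) (A : set nat) : s @` A #= A.
  by apply: inj_card_eq => v v' _ _; apply: (can_inj (@sym_funK s)).
split=> [[s [sigma [h -> ->]]] i j ij|h].
  by rewrite ![act _ _]coset_act_pt -!/(Xpt _ _) mulg1 E (card_eql (C _ _)); apply: h.
have [s zs] := Xpt_ex z; have [r xr] := Xpt_ex x; exists s, (s^-1 * r)%g; split.
- move=> i j ij; have := h i j ij; rewrite zs xr -[r in Xpt beta r](mulVKg s) E.
  by rewrite (card_eql (C _ _)).
- by rewrite [act _ _]coset_act_pt mulg1.
- by rewrite [act _ _]coset_act_pt mulVKg.
Qed.

Local Open Scope ring_scope.

(** * Measures and integrals as polynomials in T *)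

Lemma poly_eq_large (P Q : {poly rat}) N :
  (forall p, (N <= p)%N -> P.[p%:R] = Q.[p%:R]) -> P = Q.
Proof.
move=> h; apply/eqP; rewrite -subr_eq0; apply/eqP.
apply: (@roots_geq_poly_eq0 _ _ [seq (N + i)%:R | i <- iota 0 (size (P - Q))]).
- apply/allP => _ /mapP[i _ ->]; rewrite rootE hornerD hornerN h ?leq_addr //.
  by rewrite subrr.
- rewrite map_inj_uniq ?iota_uniq // => i j /eqP.
  by rewrite eqr_nat eqn_add2l => /eqP.
- by rewrite size_map size_iota.
Qed.

Lemma counts_uniq (X : finitary) (A : set X) P Q : counts A P -> counts A Q -> P = Q.
Proof.
move=> [N hP] [M hQ]; apply: (@poly_eq_large _ _ (maxn N M)) => p.
rewrite geq_max => /andP[/hP[m Am ->] /hQ[m' Am' ->]].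
by rewrite (card_eq_nat Am Am').
Qed.

Lemma muE (X : finitary) (A : set X) P : counts A P -> mu A = FracField.tofrac P.
Proof.
move=> AP; have -> : mu A = (map_poly ratr P).[varT].
  rewrite /mu /count_poly; case: xgetP => [Q _ AQ|/(_ P)//].
  by rewrite (counts_uniq AP AQ).
(* [ratr] is the only ring morphism from the rationals to [QT], hence the embedding by constants.
   Evaluating at T is then the inclusion of Q[T] in its fraction field. *)
pose f : {rmorphism rat -> QT} := (@FracField.tofrac {poly rat} \o polyC)%FUN.
rewrite (eq_map_poly (fun a => esym (fmorph_eq_rat f a))).
by rewrite map_poly_comp horner_map -[_.['X]]/(P \Po 'X) comp_polyXr.
Qed.

Lemma mu_set0 (X : finitary) : mu (@set0 X) = 0.
Proof.
rewrite (@muE _ _ 0) ?rmorph0 //; exists 0%N => p _; exists 0%N; last by rewrite horner0.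
have -> : fixed_points (@set0 X) p = set0 by apply/seteqP; split=> // y [].
by rewrite II0 card_eq00.
Qed.

(** The value 0 contributes nothing, whatever the measure of its preimage, so a single level set
    remains. This covers products of two indicators and products with an identity kernel. *)
Lemma integral_two (X : finitary) (f : X -> QT) v : (forall y, f y = 0 \/ f y = v) ->
  integral f = v * mu (f @^-1` [set v]).
Proof.
move=> fv; rewrite /integral (@fsbig_widen _ _ _ _ (range f) setT) //=; last first.
  move=> c [_ cf] /=; rewrite (_ : _ @^-1` _ = set0) ?mu_set0 ?mulr0 //.
  by apply/seteqP; split=> // y /= fy; case: cf; exists y.
transitivity (\sum_(c \in [set v]) c * mu (f @^-1` [set c])); last by rewrite fsbig_set1.
apply/esym/fsbig_widen => // c [_ /= cv].
have [->|c0] := eqVneq c 0; first by rewrite mul0r.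
rewrite (_ : _ @^-1` _ = set0) ?mu_set0 ?mulr0 //.
by apply/seteqP; split=> // y /= fy; case: (fv y) => e; [move/eqP: c0; rewrite -fy e|case: cv; rewrite -fy].
Qed.

Lemma mu_point n (b : weight n) (z : Xsp b) : mu [set z] = 1.
Proof.
have [N zN] := label_bounded z.
rewrite (@muE _ _ 1) ?rmorph1 //; exists N => p Np; exists 1%N; last by rewrite hornerC.
rewrite (_ : fixed_points _ p = (fun=> z) @` `I_1).
  by apply: inj_card_eq => i j /set_mem /= + /set_mem /= +; case: i j => [|?] [|?].
apply/seteqP; split=> [y /= [-> _]|_ [_ _ <-]]; first by exists 0%N.
by split=> //; apply/fixing_label => w pw; apply: zN; exact: leq_trans pw.
Qed.

Local Open Scope nat_scope.

Lemma sum_ord_count (P : pred nat) p : \sum_(w < p) P w = count P (iota 0 p).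
Proof.
have -> : iota 0 p = index_iota 0 p by rewrite /index_iota subn0.
rewrite -sum1_count [RHS]big_mkcond big_mkord.
by apply: eq_bigr => w _; case: (P w).
Qed.

Lemma joint_count_iota (f g : nat -> nat) p i k :
  joint_count (fun w : 'I_p => f w) (fun w : 'I_p => g w) i k =
  count (fun w => (f w == i) && (g w == k)) (iota 0 p).
Proof.
rewrite /joint_count card_sum_bool.
exact: (sum_ord_count (fun w => (f w == i) && (g w == k))).
Qed.

Lemma natq0 : natq 0%R = 0.
Proof. exact: (natqE 0). Qed.

(** * Structure constants as numbers of words *)

Section Words.
Variables (n : option nat) (delta lam beta : weight n) (q r : nat -> nat -> QT).
Variables (K : nat) (z : Xsp delta) (x : Xsp beta).

(** The entry [(0, 0)] is left out: [natq] has no meaning on T - Z. *)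
Definition same_type (f g : nat -> nat) (m : nat -> nat -> QT) (p : nat) : bool :=
  [forall i : 'I_K.+1, forall j : 'I_K.+1, ((i : nat, j : nat) == (0, 0)) ||
    (count (fun w => (f w == i) && (g w == j)) (iota 0 p) == natq (m i j))].

Definition extend p (y : {ffun 'I_p -> 'I_K.+1}) (w : nat) : nat :=
  if insub w is Some i then y i : nat else 0.

Lemma extendE p (y : {ffun 'I_p -> 'I_K.+1}) (w : 'I_p) : extend y w = y w.
Proof. by rewrite /extend valK. Qed.

Lemma extend0 p (y : {ffun 'I_p -> 'I_K.+1}) w : p <= w -> extend y w = 0.
Proof. by move=> pw; rewrite /extend insubN // -leqNgt. Qed.

Lemma extend_le p (y : {ffun 'I_p -> 'I_K.+1}) w : extend y w <= K.
Proof. by rewrite /extend; case: insubP => // i _ _; apply: leq_ord. Qed.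

(* The points y of X^lam fixed by [fixing p], read as words of length [p], with
   (z, y) of type [q] and (y, x) of type [r]. *)
Definition word_mid p : {set {ffun 'I_p -> 'I_K.+1}} :=
  [set y | same_type (label z) (extend y) q p && same_type (extend y) (label x) r p]%SET.

Hypothesis qK : forall i k, (K < i) || (K < k) -> natq (q i k) = 0.
Hypothesis rK : forall i k, (K < i) || (K < k) -> natq (r i k) = 0.
Hypothesis lamK : forall k, K < k -> natq (lam k) = 0.
Hypothesis q_col : forall k, 0 < k -> k <= K ->
  \sum_(i < K.+1) natq (q i k) = natq (lam k).
Hypothesis zK : forall w, label z w <= K.
Hypothesis xK : forall w, label x w <= K.
Variable N : nat.
Hypothesis zN : forall w, N <= w -> label z w = 0.
Hypothesis xN : forall w, N <= w -> label x w = 0.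

Let B : set (Xsp lam) := [set y |
  (forall i j : nat, (i, j) != (0, 0) ->
    [set w | (label z w == i) && (label y w == j)] #= `I_(natq (q i j))) /\
  (forall i j : nat, (i, j) != (0, 0) ->
    [set w | (label y w == i) && (label x w == j)] #= `I_(natq (r i j)))].

Lemma same_typeP (f g : nat -> nat) m p :
  (forall w, f w <= K) -> (forall w, g w <= K) ->
  (forall w, p <= w -> f w = 0) -> (forall w, p <= w -> g w = 0) ->
  (forall i k, (K < i) || (K < k) -> natq (m i k) = 0) ->
  (forall i j : nat, (i, j) != (0, 0) ->
    [set w | (f w == i) && (g w == j)] #= `I_(natq (m i j))) <->
  same_type f g m p.
Proof.
move=> fK gK fp gp mK.
have lt (i j : nat) : (i, j) != (0, 0) -> forall w, (f w == i) && (g w == j) -> w < p.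
  move=> ij w /andP[/eqP fi /eqP gj]; rewrite ltnNge; apply/negP => pw.
  by move: ij; rewrite -fi -gj fp // gp.
split=> [h|/forallP h i j ij].
  apply/forallP => i; apply/forallP => j; case: eqP => //= /eqP ij.
  by apply/eqP/(card_count_eq _ (lt _ _ ij)); apply: h.
apply/(card_count_eq _ (lt _ _ ij)).
have [iK|iK] := leqP i K; last first.
  rewrite mK ?iK // (@eq_count _ _ pred0) ?count_pred0 // => w /=.
  by apply/negP => /andP[/eqP e]; have := fK w; rewrite e leqNgt iK.
have [jK|jK] := leqP j K; last first.
  rewrite mK ?jK ?orbT // (@eq_count _ _ pred0) ?count_pred0 // => w /=.
  by apply/negP => /andP[_ /eqP e]; have := gK w; rewrite e leqNgt jK.
have /forallP/(_ (Ordinal (jK : j < K.+1))) := h (Ordinal (iK : i < K.+1)).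
by rewrite (negbTE ij) /= => /eqP.
Qed.

Lemma label_le m (b : weight m) (y : Xsp b) L :
  (forall k, L < k -> natq (b k) = 0) -> forall w, label y w <= L.
Proof.
move=> b0 w; rewrite leqNgt; apply/negP => Lw.
have [M yM] := label_bounded y.
have l0 : 0 < label y w by apply: leq_trans Lw.
have := count_label l0 yM; rewrite b0 // => /eqP; rewrite eqn0Ngt -has_count => /hasP; case.
exists w; last exact: eqxx.
rewrite mem_iota /= ltnNge; apply/negP => /yM e; by rewrite e in l0.
Qed.

Lemma card_fixed_mid p : N <= p -> fixed_points B p #= `I_#|word_mid p|.
Proof.
move=> Np.
have zp w : p <= w -> label z w = 0 by move=> pw; apply: zN; apply: leq_trans pw.
have xp w : p <= w -> label x w = 0 by move=> pw; apply: xN; apply: leq_trans pw.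
pose psi (y : Xsp lam) : {ffun 'I_p -> 'I_K.+1} := [ffun w : 'I_p => inord (label y w)].
have yK (y : Xsp lam) : forall w, label y w <= K := label_le y lamK.
have psiE (y : Xsp lam) w : (forall w, p <= w -> label y w = 0) -> extend (psi y) w = label y w.
  move=> yp; case: (ltnP w p) => wp; last by rewrite extend0 // yp.
  by rewrite -[w]/(nat_of_ord (Ordinal wp)) extendE ffunE inordK // ltnS.
have memB (y : Xsp lam) (l : nat -> nat) : (forall w, p <= w -> label y w = 0) -> label y =1 l ->
    B y <-> same_type (label z) l q p && same_type l (label x) r p.
  move=> yp /funext <-; have tq := same_typeP zK (yK y) zp yp qK; have tr := same_typeP (yK y) xK yp xp rK.
  split=> [[/tq h1 /tr h2]|/andP[/tq h1 /tr h2]]; last exact: conj h1 h2.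
  by rewrite h1 h2.
suff -> : `I_#|word_mid p| = `I_(size (enum (word_mid p))).
  rewrite -(card_eqr (card_uniq_seq (enum_uniq _))).
  have <- : psi @` fixed_points B p = [set` enum (word_mid p)].
    apply/seteqP; split=> [_ [y [By /fixing_label yp] <-] /=|y0 /=].
      by rewrite mem_enum inE; apply/(memB y) => // w; rewrite psiE.
    rewrite mem_enum inE => hy0; have /andP[hq _] := hy0.
    have ext0 := @extend0 p y0.
    have [k k0|y yE] := @label_surj n lam (extend y0) p ext0.
      have [kK|kK] := leqP k K; last first.
        rewrite lamK // (@eq_count _ _ pred0) ?count_pred0 // => w /=.
        by apply/negP => /eqP e; have := extend_le y0 w; rewrite e leqNgt kK.
      (* The letters k of the word are sorted by the label of z at their position; the type
         condition turns their number into a column sum of q. *)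
      rewrite -q_col //.
      transitivity (\sum_(i < K.+1) count (fun w => (label z w == i) && (extend y0 w == k)) (iota 0 p)).
        rewrite -!sum1_count big_mkcond /=; under [RHS]eq_bigr do rewrite -sum1_count big_mkcond /=.
        rewrite exchange_big; apply: eq_bigr => w _ /=.
        rewrite (bigD1 (Ordinal (zK w : label z w < K.+1))) //= eqxx /= big1 ?addn0 // => i.
        by rewrite -val_eqE /= eq_sym => /negbTE->.
      apply: eq_bigr => i _; have /forallP/(_ i)/forallP/(_ (Ordinal (kK : k < K.+1))) := hq.
      by rewrite xpair_eqE /= [k == 0]gtn_eqF // andbF => /eqP.
    have yp w : p <= w -> label y w = 0 by move=> pw; rewrite yE ext0.
    exists y; last by apply/ffunP => w; rewrite ffunE yE extendE inord_val.
    by split; [apply/(memB y (extend y0))|apply/fixing_label].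
  rewrite card_eq_sym; apply: inj_card_eq => y y' /set_mem[_ /fixing_label yp] /set_mem[_ /fixing_label yp'] e.
  by apply: label_inj => w; rewrite -psiE // e psiE.
by rewrite cardE.
Qed.

Lemma word_mid_poly : exists P : {poly rat},
  forall p, N <= p -> (P.[p%:R] = #|word_mid p|%:R)%R.
Proof.
(* One prescribed total for each entry of q and of r, with both sides set to 0 at [(0, 0)]. From [N]
   on, z and x have label 0, so the letter 0 adds nothing, while a letter k > 0 adds to the entry
   (0, k) of q. *)
pose J := ('I_K.+1 * 'I_K.+1 + 'I_K.+1 * 'I_K.+1)%type.
pose a (w : nat) (k : 'I_K.+1) (j : J) : nat := match j with
  | inl (i, k') => [&& (i : nat, k' : nat) != (0, 0), label z w == i & k == k' :> nat]
  | inr (k', j') => [&& (k' : nat, j' : nat) != (0, 0), k == k' :> nat & label x w == j'] end.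
pose v (j : J) : nat := match j with
  | inl (i, k) => if (i : nat, k : nat) == (0, 0) then 0 else natq (q i k)
  | inr (k, j') => if (k : nat, j' : nat) == (0, 0) then 0 else natq (r k j') end.
have [|j|k k0|P PE] := @count_words_poly _ _ a N ord0 v.
- by move=> w k Nw; apply/funext => -[[i j]|[i j]]; rewrite /a ?zN ?xN.
- by case: j => -[[[|i] ?] [[|j] ?]] //=; rewrite ?zN ?xN //= andbF.
- exists (inl (ord0, k)); rewrite /a zN // xpair_eqE !eqxx.
  by rewrite -[nat_of_ord k == 0]/(k == ord0) (negbTE k0).
exists P => p Np; rewrite PE //; congr (_%:R)%R; apply: eq_card => y; rewrite !inE.
have cnt (f : nat -> nat -> bool) : \sum_(w < p) f w (y w) = count (fun w => f w (extend y w)) (iota 0 p).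
  by rewrite -sum_ord_count; apply: eq_bigr => w _; rewrite extendE.
apply/forallP/andP => [h|[/forallP hq /forallP hr]].
  split; apply/forallP => i; apply/forallP => j.
    have := h (inl (i, j)); rewrite /a /v; case: ((i : nat, j : nat) == (0, 0)) => //=.
    by have /= -> := cnt (fun w k => (label z w == i) && (k == j)).
  have := h (inr (i, j)); rewrite /a /v; case: ((i : nat, j : nat) == (0, 0)) => //=.
  by have /= -> := cnt (fun w k => (k == i) && (label x w == j)).
case=> -[i j].
  have /forallP/(_ j) := hq i; rewrite /a /v; case: ((i : nat, j : nat) == (0, 0)) => //=; first by rewrite big1.
  by have /= -> := cnt (fun w k => (label z w == i) && (k == j)).
have /forallP/(_ j) := hr i; rewrite /a /v; case: ((i : nat, j : nat) == (0, 0)) => //=; first by rewrite big1.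
by have /= -> := cnt (fun w k => (k == i) && (label x w == j)).
Qed.

Lemma comp_xi_poly : exists2 P : {poly rat},
    comp (@xi n delta lam q) (@xi n lam beta r) z x = FracField.tofrac P
  & forall p, N <= p -> (P.[p%:R] = #|word_mid p|%:R)%R.
Proof.
have [P PE] := word_mid_poly; exists P => //.
rewrite /comp (@integral_two _ _ 1%R) => [|y]; last first.
  rewrite !xiE -natrM mulnb; case: (_ && _); [right|left]; exact: erefl.
rewrite mul1r; apply: muE; exists N => p Np; exists #|word_mid p|; last exact: PE.
rewrite (_ : _ @^-1` _ = B); first exact: card_fixed_mid.
have bool1 (c : bool) : (c%:R = 1 :> QT)%R -> c by case: c => // /eqP; rewrite eq_sym oner_eq0.
apply/seteqP; split=> y /=; rewrite !xiE -natrM mulnb.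
  move/bool1 => /andP[/asboolP h1 /asboolP h2]; exact: conj h1 h2.
case=> h1 h2; rewrite (asboolT h1) (asboolT h2); exact: erefl.
Qed.

End Words.

(** * Weights and matrices *)

Local Open Scope ring_scope.

Lemma natqK (x : QT) : (exists m : nat, x = m%:R) -> (natq x)%:R = x.
Proof. by case=> m ->; rewrite natqE. Qed.

Lemma fsbig_bounded (f : nat -> QT) K : (forall i, (K < i)%N -> f i = 0) ->
  \sum_(i \in [set: nat]) f i = \sum_(i < K.+1) f i.
Proof.
move=> f0; rewrite fsbig_ord; apply/esym/fsbig_widen => // i [_ /=] h.
by apply: f0; rewrite ltnNge; apply/negP => h'; apply: h; rewrite ltnS.
Qed.

Lemma fsbig_bounded2 (f : nat -> nat -> QT) K :
  (forall i j, (K < i)%N || (K < j)%N -> f i j = 0) ->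
  \sum_(p \in [set: nat * nat]) f p.1 p.2 = \sum_(i < K.+1) \sum_(j < K.+1) f i j.
Proof.
move=> f0; under [RHS]eq_bigr do rewrite fsbig_ord.
rewrite (fsbig_ord _ _ (fun i => \sum_(j \in `I_K.+1) f i j)) pair_fsbig //.
apply/esym/fsbig_widen => // -[i j] [_ /= h]; apply: f0.
by rewrite !ltnNge -negb_and; apply/negP => /andP[h1 h2]; apply: h; split=> /=; rewrite ltnS.
Qed.

Lemma finite_nat_bound (A : set nat) : finite_set A -> exists K, forall i, A i -> (i <= K)%N.
Proof.
move=> /finite_seqP[s ->]; exists (\max_(j <- s) j)%N => i /= si.
exact: (@leq_bigmax_seq _ s xpredT id i si isT).
Qed.

Section Weight.
Variables (n : option nat).
Implicit Types b : weight n.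

Lemma weight_nat b i : (0 < i)%N -> (natq (b i))%:R = b i.
Proof. by case: (wtP b) => _ h _ _ _ /h/natqK. Qed.

Lemma weight_bound b : exists K, forall i, (K < i)%N -> b i = 0.
Proof.
have [_ _ /finite_nat_bound[K bK] _ _] := wtP b; exists K => i Ki.
by apply/eqP; apply: contraTT Ki => /bK; rewrite -leqNgt.
Qed.

Lemma weight_sum b K : (forall i, (K < i)%N -> b i = 0) -> \sum_(i < K.+1) b i = varT.
Proof. by move=> bK; rewrite -(fsbig_bounded bK); case: (wtP b). Qed.

Lemma weight_inj b b' : b =1 b' -> b = b'.
Proof.
case: b b' => [f fP] [g gP] /= /funext fg; subst g; congr Weight.
exact: Prop_irrelevance.
Qed.

(** The sequence b(d) in natural numbers. It is faithful once d is at least the sum of the entries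
    after the first, as in [contentK]; for smaller d its value at 0 is junk. *)
Definition content (d : nat) (b : nat -> QT) (i : nat) : nat :=
  natq (shift_weight d%:Z b i).

Lemma shift_weightS (d : int) (b : nat -> QT) i : (0 < i)%N -> shift_weight d b i = b i.
Proof. by case: i. Qed.

Lemma contentS d (b : nat -> QT) i : (0 < i)%N -> content d b i = natq (b i).
Proof. by move=> i0; rewrite /content shift_weightS. Qed.

Lemma shift_weight_sum b K d : (forall i, (K < i)%N -> b i = 0) ->
  \sum_(i < K.+1) shift_weight d b i = d%:~R.
Proof.
move=> bK; rewrite big_ord_recl /= /shift_weight /=.
transitivity (\sum_(i < K.+1) b i + (d%:~R - varT)); last by rewrite weight_sum // addrC subrK.
by rewrite big_ord_recl addrAC.
Qed.

Lemma content_sum0 b K d : (forall i, (K < i)%N -> b i = 0) ->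
  shift_weight d%:Z b 0 = d%:R - (\sum_(1 <= i < K.+1) natq (b i))%:R.
Proof.
move=> bK; have := shift_weight_sum d%:Z bK; rewrite big_ord_recl -pmulrn.
rewrite [nat_of_ord ord0]/=; set s0 := shift_weight _ _ 0%N => <-.
rewrite big_add1 big_mkord natr_sum (eq_bigr (fun i : 'I_K => (natq (b i.+1))%:R)) ?addrK // => i _.
by rewrite shift_weightS // weight_nat.
Qed.

Lemma contentK b K d i : (forall i, (K < i)%N -> b i = 0) ->
  (\sum_(1 <= i < K.+1) natq (b i) <= d)%N -> (content d b i)%:R = shift_weight d%:Z b i.
Proof.
move=> bK le_d; apply: natqK; case: i => [|i]; last first.
  by exists (natq (b i.+1)); rewrite shift_weightS // weight_nat.
by rewrite (content_sum0 _ bK) -natrB //; eexists.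
Qed.

Lemma content_sum b K d : (forall i, (K < i)%N -> b i = 0) ->
  (\sum_(1 <= i < K.+1) natq (b i) <= d)%N -> (\sum_(i < K.+1) content d b i = d)%N.
Proof.
move=> bK le_d; apply: QT_natr_inj; rewrite /= natr_sum [RHS]pmulrn -(shift_weight_sum _ bK).
by apply: eq_bigr => i _; rewrite (contentK _ bK).
Qed.

Lemma natq_weight0 b K : (forall i, (K < i)%N -> b i = 0) ->
  forall k, (K < k)%N -> natq (b k) = 0%N.
Proof. by move=> bK k /bK->; rewrite natq0. Qed.

Section Mat.
Variables (delta beta : weight n) (q : nat -> nat -> QT).
Hypothesis qmat : mat delta beta q.

Lemma mat_nat i j : (i, j) != (0, 0)%N -> (natq (q i j))%:R = q i j.
Proof. by move=> ij; case: qmat => -[_ h _ _] _; apply/natqK/h. Qed.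

Lemma mat_bounded : exists M, forall i j, (M < i)%N || (M < j)%N -> q i j = 0.
Proof.
case: qmat => -[_ _ fin _] _.
have [M1 h1] := finite_nat_bound (finite_image fst fin).
have [M2 h2] := finite_nat_bound (finite_image snd fin).
exists (maxn M1 M2) => i j; apply: contraTeq => qij.
have i1 : (i <= M1)%N by apply: h1; exists (i, j).
have j2 : (j <= M2)%N by apply: h2; exists (i, j).
by rewrite negb_or -!leqNgt !leq_max i1 j2 orbT.
Qed.

Lemma mat_row M i : (forall i j, (M < i)%N || (M < j)%N -> q i j = 0) ->
  \sum_(j < M.+1) q i j = delta i.
Proof.
move=> qM; rewrite -fsbig_bounded => [|j Mj]; last by apply: qM; rewrite Mj orbT.
by case: qmat => _ [].
Qed.

Lemma mat_col M j : (forall i j, (M < i)%N || (M < j)%N -> q i j = 0) ->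
  \sum_(i < M.+1) q i j = beta j.
Proof.
move=> qM; rewrite -(fsbig_bounded (f := q ^~ j)) => [|i Mi]; last by apply: qM; rewrite Mi.
by case: qmat => _ [].
Qed.

Lemma sum_natq0 (f : nat -> QT) M : (forall i, (natq (f i))%:R = f i) ->
  \sum_(i < M.+1) f i = 0 -> forall i, (i <= M)%N -> f i = 0.
Proof.
move=> fn; under eq_bigr => i _ do rewrite -fn.
rewrite -natr_sum => /eqP; rewrite QT_natr_eq0 sum_nat_eq0 => /forallP h i iM.
by rewrite -fn; have /= /eqP-> := h (Ordinal (iM : (i < M.+1)%N)).
Qed.

Lemma mat_bound K : (forall i, (K < i)%N -> delta i = 0) ->
  (forall i, (K < i)%N -> beta i = 0) ->
  forall i j, (K < i)%N || (K < j)%N -> q i j = 0.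
Proof.
move=> dK bK i j ij; have [M qM] := mat_bounded.
have ij0 : (i, j) != (0, 0)%N by rewrite xpair_eqE; case: i j ij => [|i] [|j].
have [Mi|iM] := ltnP M i; first by apply: qM; rewrite Mi.
have [Mj|jM] := ltnP M j; first by apply: qM; rewrite Mj orbT.
case/orP: ij => [Ki|Kj].
  apply: (@sum_natq0 (q i) M) => // [j'|]; last by rewrite (mat_row _ qM) dK.
  by apply: mat_nat; rewrite xpair_eqE gtn_eqF // (leq_ltn_trans _ Ki).
apply: (@sum_natq0 (q ^~ j) M) => // [i'|]; last by rewrite (mat_col _ qM) bK.
by apply: mat_nat; rewrite xpair_eqE andbC gtn_eqF // (leq_ltn_trans _ Kj).
Qed.

Lemma mat_col_natq K k : (forall i j, (K < i)%N || (K < j)%N -> q i j = 0) ->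
  (0 < k)%N -> (\sum_(i < K.+1) natq (q i k) = natq (beta k))%N.
Proof.
move=> qK k0; apply: QT_natr_inj; rewrite /= natr_sum weight_nat // -(mat_col _ qK).
by apply: eq_bigr => i _; rewrite mat_nat // xpair_eqE andbC gtn_eqF.
Qed.

End Mat.

End Weight.

(** * Tableaux and linear independence *)

Lemma frac_denom (R : idomainType) (x : {fraction R}) : exists d m : R,
  d != 0 /\ x * FracField.tofrac d = FracField.tofrac m.
Proof.
elim/quotW: x => x; exists \d_x, \n_x; split; first exact: denom_ratioP.
unlock FracField.tofrac; rewrite -[LHS]FracField.pi_mul; apply/eqmodP.
by rewrite /= FracField.equivfE /FracField.mulf !numden_Ratio ?(oner_neq0, mulr1, mulf_neq0, denom_ratioP) // mulrC.
Qed.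

Lemma common_denom (R : idomainType) (I : finType) (x : I -> {fraction R}) :
  exists (d : R) (m : I -> R), d != 0 /\
    forall i, x i * FracField.tofrac d = FracField.tofrac (m i).
Proof.
have /fin_all_exists[d /fin_all_exists[m dm]] i := frac_denom (x i).
exists (\prod_i d i), (fun i => m i * \prod_(j | j != i) d j); split=> [|i].
  by apply/prodf_neq0 => i _; case: (dm i).
by rewrite (bigD1 i) //= !rmorphM /= mulrA (proj2 (dm i)).
Qed.

Section Tableaux.
Variable n : option nat.
Implicit Types delta lam beta : weight n.

Lemma mat_transpose delta lam q : mat delta lam q -> mat lam delta (transpose q).
Proof.
move=> qmat; have [M qM] := mat_bounded qmat.
case: qmat => -[[c q00] qnat qfin qn] [qsum qcol qrow]; split; split.
- by exists c; exact: q00.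
- by move=> i j ij; apply: qnat; rewrite xpair_eqE andbC -xpair_eqE.
- rewrite (_ : [set _ | _] = (fun p => (p.2, p.1)) @` [set p : nat * nat | q p.1 p.2 != 0]).
    exact: finite_image.
  by apply/seteqP; split=> [[i j] h|_ [[i j] h <-]]; [exists (j, i)|exact: h].
- by move=> i j h; apply: qn; rewrite andbC.
- rewrite -qsum (fsbig_bounded2 (f := transpose q) (K := M)) => [|i j h]; last by apply: qM; rewrite orbC.
  by rewrite (fsbig_bounded2 qM) exchange_big.
- exact: qrow.
- exact: qcol.
Qed.

Lemma filling_size d (b : nat -> QT) m Y i :
  is_filling (shift_weight d%:Z b) m Y -> size (Y i) = content d b i.
Proof. by move=> /(_ i)[h _ _]; rewrite /content -h natqE. Qed.

Lemma filling_count d (b : nat -> QT) m Y k j :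
  is_filling (shift_weight d b) (shift_matrix d m) Y ->
  (k, j) != (0, 0)%N -> count_mem j (Y k) = natq (m k j).
Proof.
by move=> /(_ k)[_ _ /(_ j) h] kj; rewrite -[LHS]natqE h /shift_matrix (negbTE kj).
Qed.

Lemma filling_content lam beta r d Y K j : mat lam beta r ->
  (forall i j, (K < i)%N || (K < j)%N -> r i j = 0) ->
  is_filling (shift_weight d%:Z lam) (shift_matrix d%:Z r) Y ->
  (\sum_(k < K.+1) count_mem j (Y k))%N = content d beta j.
Proof.
move=> rmat rK Yfill; rewrite /content -[LHS]natqE natr_sum; congr natq.
rewrite (eq_bigr (fun k : 'I_K.+1 => shift_matrix d%:Z r k j)) => [|k _]; last first.
  by have [_ _ ->] := Yfill k.
rewrite /shift_weight -(mat_col rmat _ rK) /shift_matrix.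
rewrite big_ord_recl [in RHS]big_ord_recl /=.
case: j => [|j] /=; last by congr (_ + _); apply: eq_bigr.
exact: addrAC.
Qed.

Lemma dominant_mono lam : dominant lam ->
  forall i j, (0 < i)%N -> (i <= j)%N -> (natq (lam j) <= natq (lam i))%N.
Proof.
move=> dom i j i0; elim: j => [|j IH]; first by rewrite leqn0 => /eqP e; rewrite e in i0.
rewrite leq_eqVlt => /predU1P[->//|ij]; apply: leq_trans (IH ij).
by apply: dom; exact: leq_trans i0 ij.
Qed.

(* Entries of the i-th row of a column strict tableau are at least i. *)
Lemma semistandard_bound lam beta r K : dominant lam -> mat lam beta r ->
  semistandard lam r -> (forall i, (K < i)%N -> beta i = 0) ->
  forall i, (K < i)%N -> lam i = 0.
Proof.
move=> dom rmat [d0 std] bK i Ki.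
have [//|lami] := eqVneq (lam i) 0.
have i0 : (0 < i)%N by apply: leq_ltn_trans Ki.
have [Y Yfill Ystrict] := std d0 (lexx _).
have sizeY k : (0 < k)%N -> (k <= i)%N -> (0 < size (Y k))%N.
  move=> k0 ki; rewrite (leq_trans _ (_ : (natq (lam k) <= _)%N)) //.
    apply: leq_trans (dominant_mono dom k0 ki).
    by rewrite lt0n; apply: contraNneq lami => e; rewrite -(weight_nat lam i0) e.
  have [h _ _] := Yfill k; rewrite -[X in (_ <= X)%N]natqE h shift_weightS //.
have ent k : (k <= i)%N -> (k <= nth 0%N (Y k) 0)%N.
  elim: k => // k IH ki; apply: leq_ltn_trans (IH (ltnW ki)) (Ystrict _ _ _).
  exact: sizeY.
set j := nth 0%N (Y i) 0; have ij : (i <= j)%N := ent i (leqnn i).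
have Kj : (K < j)%N := leq_trans Ki ij.
have ij0 : (i, j) != (0, 0)%N by rewrite xpair_eqE gtn_eqF.
have : (0 < count_mem j (Y i))%N.
  by rewrite -has_count has_pred1 mem_nth // sizeY.
rewrite (filling_count Yfill ij0) lt0n => /eqP; case.
have [M rM] := mat_bounded rmat.
have [Mi|iM] := ltnP M i; first by rewrite rM ?Mi // natq0.
rewrite (_ : r i j = 0) ?natq0 //; apply: (@sum_natq0 (r ^~ j) M) => //.
  by move=> k; apply: (mat_nat rmat); rewrite xpair_eqE andbC gtn_eqF // (leq_trans i0).
by rewrite (mat_col rmat _ rM) bK.
Qed.

Lemma semistandard_tableau lam beta r K : dominant lam -> mat lam beta r ->
  semistandard lam r -> (forall i, (K < i)%N -> beta i = 0) ->
  exists d0 : nat, forall d : nat, (d0 <= d)%N -> exists Y : nat -> seq nat,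
  [/\ forall i, size (Y i) = content d lam i,
      column_strict Y,
      forall k j, (k, j) != (0, 0)%N -> count_mem j (Y k) = natq (r k j),
      forall j, (\sum_(k < K.+1) count_mem j (Y k))%N = content d beta j
    & forall i, all (leq^~ K) (Y i)].
Proof.
move=> dom rmat std bK; have lamK := semistandard_bound dom rmat std bK.
have rK := mat_bound rmat lamK bK.
case: std => d0 std; exists `|d0|%N => d d0d.
have [|Y Yfill Ystrict] := std d%:Z; first lia.
exists Y; split=> //.
- by move=> i; apply: filling_size Yfill.
- by move=> k j; apply: filling_count Yfill.
- by move=> j; apply: filling_content rmat rK Yfill.
- move=> i; apply/allP => j; rewrite leqNgt; apply: contraL => Kj.
  rewrite -has_pred1 has_count (filling_count Yfill) ?rK ?Kj ?orbT ?natq0 //.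
  by rewrite xpair_eqE andbC gtn_eqF // (leq_ltn_trans _ Kj).
Qed.

Lemma content_step lam K : dominant lam -> (forall i, (K < i)%N -> lam i = 0) ->
  exists d0, forall d, (d0 <= d)%N -> forall i, (content d lam i.+1 <= content d lam i)%N.
Proof.
move=> dom lamK; pose L := (\sum_(1 <= i < K.+1) natq (lam i))%N.
(* Only the first comparison depends on d: row 0 has d - L boxes, which must be at least the length
   of row 1. *)
exists (L + natq (lam 1%N))%N => d Ld [|i]; last by rewrite !contentS //; apply: dom.
rewrite contentS //; have Ld' : (L <= d)%N by apply: leq_trans Ld; apply: leq_addr.
have := content_sum lamK Ld'; rewrite big_ord_recl /=.
rewrite (_ : (\sum_(i < K) _ = L)%N); first by lia.
rewrite /L big_add1 big_mkord; apply: eq_bigr => i _; exact: contentS.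
Qed.

End Tableaux.

(** Both families of counts have total d, so agreement away from [(0, 0)] forces agreement there. *)
Lemma has_type_but d K (y z : 'I_d -> nat) (M : nat -> seq nat) :
  (forall w, y w <= K)%N -> (forall w, z w <= K)%N ->
  (\sum_(k < K.+1) \sum_(j < K.+1) count_mem (j : nat) (M k))%N = d ->
  (forall k j, (k <= K)%N -> (j <= K)%N -> (k, j) != (0, 0)%N -> joint_count y z k j = count_mem j (M k)) ->
  has_type K y z M.
Proof.
move=> yK zK sumM h; apply/has_typeP => k j kK jK.
have [e|kj] := eqVneq (k, j) (0, 0)%N; last exact: h.
case: e => -> ->.
have := @sum_joint_count d K.+1 y z (fun _ _ => 1%N) yK zK.
rewrite sum1_card card_ord -{1}sumM.
rewrite big_ord_recl [\sum_(j < K.+1) _]big_ord_recl [in RHS]big_ord_recl [in X in _ = (X + _)%N]big_ord_recl.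
rewrite /= mul1n -!addnA => e; apply/esym; move: e.
rewrite [X in (_ + X)%N = _](_ : _ = (\sum_(i < K) 1 * joint_count y z (@ord0 K) (lift ord0 i) +
   \sum_(i < K) \sum_(k0 < K.+1) 1 * joint_count y z (lift ord0 i) k0)%N); first by move/addIn.
congr (_ + _)%N; first by apply: eq_bigr => i _; rewrite mul1n h ?leq_ord.
by apply: eq_bigr => i _; apply: eq_bigr => l _; rewrite mul1n h ?leq_ord.
Qed.

Lemma same_typeC K f g m p : same_type K f g m p = same_type K g f (transpose m) p.
Proof.
apply/forallP/forallP => h i; apply/forallP => j; have /forallP/(_ i) := h j;
  by rewrite /transpose xpair_eqE andbC -xpair_eqE; under eq_count do rewrite andbC.
Qed.

Lemma joint_count_extend K d (y z : {ffun 'I_d -> 'I_K.+1}) i k :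
  joint_count (word_val y) (word_val z) i k =
  count (fun w => (extend y w == i) && (extend z w == k)) (iota 0 d).
Proof.
rewrite -joint_count_iota; apply: eq_joint_count => w; by rewrite extendE.
Qed.

Lemma same_type_has K d (y z : {ffun 'I_d -> 'I_K.+1}) m (M : nat -> seq nat) :
  (forall k j, (k, j) != (0, 0)%N -> count_mem j (M k) = natq (m k j)) ->
  (\sum_(k < K.+1) \sum_(j < K.+1) count_mem (j : nat) (M k))%N = d ->
  same_type K (extend y) (extend z) m d = has_type K (word_val y) (word_val z) M.
Proof.
move=> Mm sumM; apply/idP/idP => [h|/has_typeP h].
  apply: has_type_but => // [w|w|k j kK jK kj]; [exact: leq_ord|exact: leq_ord|].
  rewrite joint_count_extend Mm //.
  have /forallP/(_ (Ordinal (kK : (k < K.+1)%N)))/forallP/(_ (Ordinal (jK : (j < K.+1)%N))) := h.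
  by rewrite (negbTE kj) /= => /eqP.
apply/forallP => k; apply/forallP => j; case: eqVneq => //= kj.
by rewrite -joint_count_extend h ?leq_ord // Mm.
Qed.

Lemma mat_ext n (lam lam' beta : weight n) r r' K :
  mat lam beta r -> mat lam' beta r' ->
  (forall i j, (K < i)%N || (K < j)%N -> r i j = 0) ->
  (forall i j, (K < i)%N || (K < j)%N -> r' i j = 0) ->
  (forall i j, (i <= K)%N -> (j <= K)%N -> (i, j) != (0, 0)%N ->
     natq (r i j) = natq (r' i j)) ->
  r = r'.
Proof.
move=> rmat rmat' rK rK' rr.
have ne i j : (i, j) != (0, 0)%N -> r i j = r' i j.
  move=> ij; have [iK|Ki] := leqP i K; last by rewrite rK ?rK' ?Ki.
  have [jK|Kj] := leqP j K; last by rewrite rK ?rK' ?Kj ?orbT.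
  by rewrite -(mat_nat rmat ij) -(mat_nat rmat' ij) rr.
apply/funext => i; apply/funext => j; have [[-> ->]|/ne//] := eqVneq (i, j) (0, 0)%N.
(* The entry [(0, 0)] follows from the sum of its column, which is [beta 0] for both matrices. *)
have := mat_col rmat 0 rK; rewrite -(mat_col rmat' 0 rK') !big_ord_recl /=.
rewrite (eq_bigr (fun i : 'I_K => r' (bump 0 i) 0%N)) => [/addIr//|k _].
exact: ne.
Qed.

Lemma label_word n (b : weight n) K d (y : {ffun 'I_d -> 'I_K.+1}) :
  (forall i, (K < i)%N -> b i = 0) ->
  (forall j, (j <= K)%N -> #|[set w | y w == j :> nat]%SET| = content d b j) ->
  exists x : Xsp b, label x = extend y.
Proof.
move=> bK cy; have [|k k0|x xE] := @label_surj n b (extend y) d; first exact: extend0.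
  have -> : count (fun w => extend y w == k) (iota 0 d) = #|[set w | y w == k :> nat]%SET|.
    rewrite card_sum_bool -(sum_ord_count (fun w => extend y w == k)).
    by apply: eq_bigr => w _; rewrite extendE.
  have [kK|Kk] := leqP k K; first by rewrite cy // contentS.
  rewrite bK // natq0; apply: eq_card0 => w; rewrite inE; apply/negP => /eqP e.
  by have := leq_ord (y w); rewrite e leqNgt Kk.
by exists x; apply/funext.
Qed.

Section StdPairs.
Variables (n : option nat) (delta beta : weight n).

Definition std_pair (lam : weight n) (q r : nat -> nat -> QT) : Prop :=
  [/\ dominant lam, mat delta lam q, semistandard lam (transpose q),
      mat lam beta r & semistandard lam r].

Lemma std_pairs_independent (I : finType) (lam : I -> weight n)
    (q r : I -> nat -> nat -> QT) (C : I -> QT) :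
  (forall a, std_pair (lam a) (q a) (r a)) ->
  (forall a b, lam a = lam b -> q a = q b -> r a = r b -> a = b) ->
  (forall (z : Xsp delta) (x : Xsp beta),
     \sum_a C a * comp (@xi n delta (lam a) (q a)) (@xi n (lam a) beta (r a)) z x = 0) ->
  forall a, C a = 0.
Proof.
move=> std inj rel.
have [K [dK bK]] : exists K, (forall i, (K < i)%N -> delta i = 0) /\
    (forall i, (K < i)%N -> beta i = 0).
  have [K1 h1] := weight_bound delta; have [K2 h2] := weight_bound beta.
  exists (maxn K1 K2); split=> i; rewrite gtn_max => /andP[i1 i2]; [exact: h1|exact: h2].
have dom a : dominant (lam a) by case: (std a).
have qmat a : mat delta (lam a) (q a) by case: (std a).
have qstd a : semistandard (lam a) (transpose (q a)) by case: (std a).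
have rmat a : mat (lam a) beta (r a) by case: (std a).
have rstd a : semistandard (lam a) (r a) by case: (std a).
have lamK a := semistandard_bound (dom a) (rmat a) (rstd a) bK.
have rK a := mat_bound (rmat a) (lamK a) bK.
have qK a := mat_bound (qmat a) dK (lamK a).
have [D1 YD] := fin_all_exists (fun a => semistandard_tableau (dom a) (rmat a) (rstd a) bK).
have [D2 ZD] := fin_all_exists (fun a => semistandard_tableau (dom a) (mat_transpose (qmat a)) (qstd a) dK).
have [D3 step] := fin_all_exists (fun a => content_step (dom a) (lamK a)).
pose D4 a := (\sum_(1 <= i < K.+1) natq (lam a i))%N.
(* From this degree on, all the tableaux exist, their shapes are partitions, and the contents add up
   to d. *)
pose D := (\max_a (maxn (maxn (D1 a) (D2 a)) (maxn (D3 a) (D4 a))))%N.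
have [den [num [den0 numE]]] := common_denom C.
suff num0 a : num a = 0.
  move=> a; have := numE a; rewrite num0 rmorph0 => /eqP; rewrite mulf_eq0 tofrac_eq0 (negbTE den0) orbF.
  by move/eqP.
apply: (@poly_eq_large _ _ D) => d Dd; rewrite horner0.
have {}Dd a' : [/\ (D1 a' <= d)%N, (D2 a' <= d)%N, (D3 a' <= d)%N & (D4 a' <= d)%N].
  have : (maxn (maxn (D1 a') (D2 a')) (maxn (D3 a') (D4 a')) <= d)%N.
    by apply: leq_trans Dd; apply: (@leq_bigmax _ (fun a => maxn (maxn (D1 a) (D2 a)) (maxn (D3 a) (D4 a)))).
  by rewrite !geq_max -andbA => /and4P[].
have /fin_all_exists[Y YP] a' : exists Y, _ := YD a' d (let: And4 h _ _ _ := Dd a' in h).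
have /fin_all_exists[Z ZP] a' : exists Z, _ := ZD a' d (let: And4 _ h _ _ := Dd a' in h).
have sizeY a' i : size (Y a' i) = content d (lam a') i by case: (YP a').
have sizeZ a' i : size (Z a' i) = content d (lam a') i by case: (ZP a').
have sized a' : (\sum_(i < K.+1) content d (lam a') i)%N = d.
  by apply: content_sum (lamK a') _; case: (Dd a').
have countY a' k j : (k, j) != (0, 0)%N -> count_mem j (Y a' k) = natq (r a' k j).
  by case: (YP a') => _ _ + _ _; apply.
have countZ a' k j : (k, j) != (0, 0)%N -> count_mem j (Z a' k) = natq (transpose (q a') k j).
  by case: (ZP a') => _ _ + _ _; apply.
have YK a' i : all (leq^~ K) (Y a' i) by case: (YP a').
have ZK a' i : all (leq^~ K) (Z a' i) by case: (ZP a').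
have sumY a' : (\sum_(k < K.+1) \sum_(j < K.+1) count_mem (j : nat) (Y a' k))%N = d.
  by rewrite -(sized a'); apply: eq_bigr => k _; rewrite sum_count_mem.
have sumZ a' : (\sum_(k < K.+1) \sum_(j < K.+1) count_mem (j : nat) (Z a' k))%N = d.
  by rewrite -(sized a'); apply: eq_bigr => k _; rewrite sum_count_mem.
move: a; apply: (@codeterminant_core d K I Y Z (fun a => (num a).[d%:R]) (content d delta) (content d beta)).
- by move=> a i; rewrite sizeY sizeZ.
- by move=> a i; rewrite !sizeY; apply: step; case: (Dd a).
- by move=> a i Ki; rewrite sizeY contentS ?lamK ?natq0 // (leq_ltn_trans _ Ki).
- by move=> a; rewrite -[RHS](sized a); apply: eq_bigr => i _; rewrite sizeY.
- exact: YK.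
- exact: ZK.
- by move=> a i l; case: (YP a) => _ h _ _ _; apply: h.
- by move=> a i l; case: (ZP a) => _ h _ _ _; apply: h.
- by move=> a j _; case: (YP a).
- by move=> a j _; case: (ZP a).
- move=> a b eY eZ.
  have eqr : r a = r b.
    apply: (mat_ext (rmat a) (rmat b) (rK a) (rK b)) => k j kK jK kj.
    by rewrite -!countY // eY.
  have eqq : transpose (q a) = transpose (q b).
    apply: (mat_ext (mat_transpose (qmat a)) (mat_transpose (qmat b))).
    - move=> k j; rewrite orbC; exact: (qK a j k).
    - move=> k j; rewrite orbC; exact: (qK b j k).
    - by move=> k j kK jK kj; rewrite -!countZ // eZ.
  apply: inj => //.
    apply: weight_inj => i; rewrite -(mat_row (rmat a) i (rK a)) -(mat_row (rmat b) i (rK b)).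
    by rewrite eqr.
  exact: (congr1 transpose eqq).
- move=> z x cz cx.
  (* Words of length d become points with label 0 from d on. The polynomial of [comp_xi_poly] counts
     words from that bound on, so its value at d is the number of middle words of length d. *)
  have [pz zE] := label_word dK cz; have [px xE] := label_word bK cx.
  have comp_ex a : exists P : {poly rat},
      comp (@xi n delta (lam a) (q a)) (@xi n (lam a) beta (r a)) pz px = FracField.tofrac P /\
      P.[d%:R] = #|[set y : {ffun 'I_d -> 'I_K.+1} | has_type K (word_val y) (word_val z) (Z a) &&
                    has_type K (word_val y) (word_val x) (Y a)]%SET|%:R.
    have [||||||||P PE Pd] := @comp_xi_poly n delta (lam a) beta (q a) (r a) K pz px _ _ _ _ _ _ d.
    - by move=> i k /qK->; rewrite natq0.
    - by move=> i k /rK->; rewrite natq0.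
    - by move=> k /lamK->; rewrite natq0.
    - by move=> k k0 _; apply: (mat_col_natq (qmat a) _ k0); apply: qK.
    - by move=> w; rewrite zE; apply: extend_le.
    - by move=> w; rewrite xE; apply: extend_le.
    - by move=> w; rewrite zE; apply: extend0.
    - by move=> w; rewrite xE; apply: extend0.
    exists P; split; first exact: PE.
    rewrite Pd //; congr (_%:R); apply: eq_card => y; rewrite !inE zE xE same_typeC.
    by rewrite (same_type_has _ _ (countZ a)) // (same_type_has _ _ (countY a)).
  have [P PP] := fin_all_exists comp_ex.
  have : \sum_a num a * P a = 0.
    apply/eqP; rewrite -tofrac_eq0 rmorph_sum; apply/eqP => /=.
    transitivity (FracField.tofrac den * \sum_a C a * comp (@xi n delta (lam a) (q a)) (@xi n (lam a) beta (r a)) pz px).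
      rewrite big_distrr; apply: eq_bigr => a _ /=; rewrite rmorphM /= (proj1 (PP a)) -numE mulrA.
      by congr (_ * _); exact: mulrC.
    by rewrite rel mulr0.
  move=> /(congr1 (fun p => p.[d%:R])); rewrite horner_sum horner0 => e; rewrite -[RHS]e.
  by apply: eq_bigr => a _; rewrite hornerM (proj2 (PP a)).
Qed.

End StdPairs.

(** * Orbits and homomorphisms *)

Lemma actK (X : finitary) (s : sym_inf) : cancel (@act X s) (act s^-1%g).
Proof. by move=> x; rewrite -actM mulVg act1. Qed.

Lemma actVK (X : finitary) (s : sym_inf) : cancel (@act X s^-1%g) (act s).
Proof. by move=> x; rewrite -actM mulgV act1. Qed.

(** For p at least [N], [s] permutes the points below p and so normalizes the pointwise stabilizer
    [fixing p]. It then carries the fixed points of [A] onto those of its translate. *)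
Lemma mu_act (X : finitary) (A : set X) (s : sym_inf) N :
  (forall w, (N <= w)%N -> s w = w) -> mu (act s @` A) = mu A.
Proof.
move=> sN; have sVN w : (N <= w)%N -> sym_inv s w = w.
  by move=> Nw; rewrite -{1}(sN w Nw) sym_funK.
have fixE p : (N <= p)%N -> fixed_points (act s @` A) p = act s @` fixed_points A p.
  move=> Np.
  have lt (u v : nat -> nat) w : cancel u v -> (forall w, (N <= w)%N -> v w = w) ->
      (w < p)%N -> (u w < p)%N.
    move=> uK vN wp; rewrite ltnNge; apply/negP => pu.
    by have := uK w; rewrite vN ?(leq_trans Np) // => e; rewrite e leqNgt wp in pu.
  apply/seteqP; split=> [_ [[a Aa <-] fixa]|_ [a [Aa fixa] <-]].
    exists a => //; split=> // g gp; apply: (can_inj (@actK _ s)).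
    rewrite -(fixa (s * g * s^-1)%g) ?actM ?actK // => w wp /=.
    by rewrite gp ?sym_invK //; apply: lt wp; [exact: sym_invK|exact: sN].
  split; first by exists a.
  move=> g gp; apply: (can_inj (@actVK _ s)); rewrite actK -!actM.
  apply: fixa => w wp /=; rewrite gp ?sym_funK //.
  by apply: lt wp; [exact: sym_funK|exact: sVN].
have cardE p : (N <= p)%N -> forall m, (fixed_points (act s @` A) p #= `I_m) = (fixed_points A p #= `I_m).
  move=> Np m; rewrite fixE //; apply/card_eql/inj_card_eq => a b _ _.
  exact: (can_inj (@actK _ s)).
rewrite /mu /count_poly; congr ((map_poly ratr (xget 0 _)).[varT]).
apply/seteqP; split=> P [M h]; exists (maxn M N) => p; rewrite geq_max => /andP[/h[m hm Pm] Np].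
  by exists m; rewrite // -cardE.
by exists m; rewrite // cardE.
Qed.

Lemma integral_act (X : finitary) (f : X -> QT) (s : sym_inf) N :
  (forall w, (N <= w)%N -> s w = w) -> integral (fun y => f (act s^-1%g y)) = integral f.
Proof.
move=> sN; rewrite /integral.
have -> : range (fun y => f (act s^-1%g y)) = range f.
  apply/seteqP; split=> [_ [y _ <-]|_ [y _ <-]]; first by exists (act s^-1%g y).
  by exists (act s y); rewrite ?actK.
apply: eq_fsbigr => c _; congr (_ * _); rewrite -(mu_act (f @^-1` [set c]) sN); congr mu.
apply/seteqP; split=> [y fy|_ [y fy <-]]; last by rewrite /= actK.
by exists (act s^-1%g y); rewrite ?actVK.
Qed.

Section Orbits.
Variable n : option nat.
Implicit Types delta lam beta : weight n.

Lemma same_orbit delta beta (z z' : Xsp delta) (x x' : Xsp beta) N :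
  (forall w, (N <= w)%N -> label z w = 0%N /\ label x w = 0%N) ->
  (forall w, (N <= w)%N -> label z' w = 0%N /\ label x' w = 0%N) ->
  (forall i j, (i, j) != (0, 0)%N ->
     count (fun w => (label z w == i) && (label x w == j)) (iota 0 N) =
     count (fun w => (label z' w == i) && (label x' w == j)) (iota 0 N)) ->
  exists s : sym_inf, [/\ forall w, (N <= w)%N -> s w = w, act s z = z' & act s x = x'].
Proof.
move=> h h' cnt.
have [w /h[-> ->]|w /h'[-> ->]|[i j] ij|s [sN sE]] //=
  := @exists_sym _ (0, 0)%N (fun w => (label z w, label x w)) (fun w => (label z' w, label x' w)) N.
  under eq_count do rewrite xpair_eqE.
  under [RHS]eq_count do rewrite xpair_eqE.
  exact: cnt.
exists s; split=> //; apply: label_inj => w; rewrite label_act.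
  by have [] := sE (sym_inv s w); rewrite sym_invK.
by have [] := sE (sym_inv s w); rewrite sym_invK.
Qed.

Lemma label_bounded2 delta beta (z : Xsp delta) (x : Xsp beta) :
  exists N, forall w, (N <= w)%N -> label z w = 0%N /\ label x w = 0%N.
Proof.
have [N1 h1] := label_bounded z; have [N2 h2] := label_bounded x.
by exists (maxn N1 N2) => w; rewrite geq_max => /andP[/h1-> /h2->].
Qed.

Lemma card_label_act delta beta (z : Xsp delta) (x : Xsp beta) (s : sym_inf) i j :
  [set w | (label (act s z) w == i) && (label (act s x) w == j)] #=
  [set w | (label z w == i) && (label x w == j)].
Proof.
rewrite (_ : [set w | _] = s @` [set w | (label z w == i) && (label x w == j)]).
  by apply: inj_card_eq => a b _ _; apply: (can_inj (@sym_funK s)).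
apply/seteqP; split=> [w|_ [w h <-]]; rewrite /= !label_act; last by rewrite sym_funK.
by exists (sym_inv s w); rewrite ?sym_invK.
Qed.

Lemma xi_hom delta beta q : hom (@xi n delta beta q).
Proof.
move=> s z x; rewrite !xiE; congr (nat_of_bool _)%:R; apply: asbool_equiv_eq.
by split=> h i j /h; rewrite (card_eql (card_label_act z x s i j)).
Qed.

(* The invariance of [mu] is only available for finitely supported permutations,
   which this shows to be enough. *)
Lemma act_finite_support delta beta (z : Xsp delta) (x : Xsp beta) (s : sym_inf) :
  exists (N : nat) (u : sym_inf),
  [/\ forall w, (N <= w)%N -> u w = w, act u z = act s z & act u x = act s x].
Proof.
have [N1 h1] := label_bounded2 z x; have [N2 h2] := label_bounded2 (act s z) (act s x).
exists (maxn N1 N2).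
have h1' w : (maxn N1 N2 <= w)%N -> label z w = 0%N /\ label x w = 0%N.
  by rewrite geq_max => /andP[/h1].
have h2' w : (maxn N1 N2 <= w)%N -> label (act s z) w = 0%N /\ label (act s x) w = 0%N.
  by rewrite geq_max => /andP[_ /h2].
apply: (same_orbit h1' h2') => i j ij.
have bd (l l' : nat -> nat) : (forall w, (maxn N1 N2 <= w)%N -> l w = 0%N /\ l' w = 0%N) ->
    forall w, (l w == i) && (l' w == j) -> (w < maxn N1 N2)%N.
  move=> h w /andP[/eqP li /eqP l'j]; rewrite ltnNge; apply/negP => /h[l0 l'0].
  by move: ij; rewrite -li -l'j l0 l'0.
apply: card_eq_nat (card_count (bd _ _ h1')) _.
by rewrite -(card_eql (card_label_act z x s i j)); apply: card_count (bd _ _ h2').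
Qed.

Lemma comp_hom delta lam beta (g : Xsp delta -> Xsp lam -> QT) (f : Xsp lam -> Xsp beta -> QT) :
  hom g -> hom f -> hom (comp g f).
Proof.
move=> gh fh s z x; have [N [u [uN <- <-]]] := act_finite_support z x s.
rewrite /comp -(integral_act (fun y => g z y * f y x) uN); congr integral.
by apply/funext => y; rewrite -(gh u z) -(fh u _ x) actVK.
Qed.

Lemma exists_seq_count (T : finType) (f : T -> nat) :
  exists s : seq T, size s = (\sum_t f t)%N /\ forall t, count_mem t s = f t.
Proof.
have cnt (P : pred T) : count P (flatten [seq nseq (f t) t | t <- index_enum T]) = (\sum_t P t * f t)%N.
  rewrite count_flatten sumnE !big_map; apply: eq_bigr => t _ /=.
  by rewrite count_nseq.
exists (flatten [seq nseq (f t) t | t <- index_enum T]); split=> [|t].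
  by rewrite -count_predT cnt; apply: eq_bigr => t _; rewrite mul1n.
rewrite cnt (bigD1 t) //= eqxx mul1n big1 ?addn0 // => u /negbTE.
by move=> ->.
Qed.

Lemma exists_point_pair delta beta K d (m : nat -> nat -> nat) :
  (forall i, (K < i)%N -> delta i = 0) -> (forall i, (K < i)%N -> beta i = 0) ->
  (\sum_(i < K.+1) \sum_(j < K.+1) m i j = d)%N ->
  (forall i, (0 < i)%N -> (i <= K)%N -> \sum_(j < K.+1) m i j = natq (delta i))%N ->
  (forall j, (0 < j)%N -> (j <= K)%N -> \sum_(i < K.+1) m i j = natq (beta j))%N ->
  exists (z : Xsp delta) (x : Xsp beta),
  [/\ forall w, (d <= w)%N -> label z w = 0%N /\ label x w = 0%N,
      forall w, (label z w <= K)%N /\ (label x w <= K)%N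
    & forall i j, (i <= K)%N -> (j <= K)%N ->
      count (fun w => (label z w == i) && (label x w == j)) (iota 0 d) = m i j].
Proof.
move=> dK bK md mrow mcol.
(* A sequence listing each pair (i, j) exactly [m i j] times; its two coordinates label z and x. *)
have [s [szs cnts]] := exists_seq_count (fun p : 'I_K.+1 * 'I_K.+1 => m p.1 p.2).
have {}szs : size s = d by rewrite szs -md pair_big.
pose l w := nth (ord0, ord0) s w.
have cntl (P : pred ('I_K.+1 * 'I_K.+1)) : count (fun w => P (l w)) (iota 0 d) = count P s.
  by rewrite -[in RHS](mkseq_nth (ord0, ord0) s) szs count_map.
have cntE (P : pred ('I_K.+1 * 'I_K.+1)) : count P s = (\sum_i \sum_j P (i, j) * m i j)%N.
  rewrite pair_big /= -sum1_count big_mkcond /=.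
  under [RHS]eq_bigr => p _ do rewrite -(cnts p) -sum1_count big_distrr /= big_mkcond.
  rewrite exchange_big; apply: eq_bigr => t _; rewrite (bigD1 t) //= eqxx [X in (_ + X)%N]big1 ?addn0.
    by case: t => a b /=; case: (P _).
  by move=> u; rewrite eq_sym => /negbTE->.
have l0 w : (d <= w)%N -> l w = (ord0, ord0) by move=> dw; rewrite /l nth_default ?szs.
have [w dw|k k0|z zE] := @label_surj n delta (fun w => (l w).1) d; first by rewrite l0.
  have [kK|Kk] := leqP k K; last first.
    rewrite dK // natq0; apply/eqP; rewrite -leqn0 leqNgt -has_count.
    by apply/hasPn => w _; apply/negP => /eqP e; have := leq_ord (l w).1; rewrite e leqNgt Kk.
  rewrite -mrow // (cntl (fun p => p.1 == k :> nat)) cntE.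
  rewrite (bigD1 (Ordinal (kK : (k < K.+1)%N))) //= eqxx [X in (_ + X)%N]big1 ?addn0.
    by apply: eq_bigr => j _; rewrite mul1n.
  by move=> i; rewrite -val_eqE /= => /negbTE->; rewrite big1.
have [w dw|k k0|x xE] := @label_surj n beta (fun w => (l w).2) d; first by rewrite l0.
  have [kK|Kk] := leqP k K; last first.
    rewrite bK // natq0; apply/eqP; rewrite -leqn0 leqNgt -has_count.
    by apply/hasPn => w _; apply/negP => /eqP e; have := leq_ord (l w).2; rewrite e leqNgt Kk.
  rewrite -mcol // (cntl (fun p => p.2 == k :> nat)) cntE exchange_big.
  rewrite (bigD1 (Ordinal (kK : (k < K.+1)%N))) //= eqxx [X in (_ + X)%N]big1 ?addn0.
    by apply: eq_bigr => j _; rewrite mul1n.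
  by move=> i; rewrite -val_eqE /= => /negbTE->; rewrite big1.
exists z, x; split=> [w dw|w|i j iK jK].
- by rewrite zE xE l0.
- by rewrite zE xE !leq_ord.
under eq_count do rewrite zE xE.
rewrite (cntl (fun p => (p.1 == i :> nat) && (p.2 == j :> nat))).
rewrite (@eq_count _ _ (pred1 (Ordinal (iK : (i < K.+1)%N), Ordinal (jK : (j < K.+1)%N)))) ?cnts //.
Qed.

End Orbits.

(** * Spanning *)

Lemma addr_telescope (V : zmodType) (t e k : V) : (t - e) + (e + k - t) = k.
Proof. by rewrite addrACA -opprD addrA [t + e]addrC [_ + k]addrC addrK. Qed.

(* Undoes [shift_weight d]. *)
Definition lift_weight (d : nat) (f : nat -> nat) (i : nat) : QT :=
  (f i)%:R + (if i == 0%N then varT - d%:R else 0).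

Definition lift_mat (d : nat) (m : nat -> nat -> nat) (i j : nat) : QT :=
  (m i j)%:R + (if (i, j) == (0, 0)%N then varT - d%:R else 0).

Lemma lift_weightS d f i : (0 < i)%N -> lift_weight d f i = (f i)%:R.
Proof. by case: i => // i _; rewrite /lift_weight addr0. Qed.

Lemma lift_matS d m i j : (i, j) != (0, 0)%N -> lift_mat d m i j = (m i j)%:R.
Proof. by move=> /negbTE ij; rewrite /lift_mat ij addr0. Qed.

Lemma lift_int (k d : nat) : exists z : int, (k%:R + (varT - d%:R) : QT) = varT - z%:~R.
Proof.
exists (d%:Z - k%:Z); rewrite intrB -!pmulrn opprB addrC -addrA; congr (_ + _).
exact: addrC.
Qed.

Lemma lift_mat_inj d m m' i j : lift_mat d m i j = lift_mat d m' i j -> m i j = m' i j.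
Proof. by move=> /addIr/QT_natr_inj. Qed.

Lemma lift_is_weight n K d f : (forall i, (i <= K)%N -> in_range n i) ->
  (forall i, (K < i)%N -> f i = 0%N) -> (\sum_(i < K.+1) f i = d)%N ->
  is_weight n (lift_weight d f).
Proof.
move=> Kn f0 fd.
have l0 i : (K < i)%N -> lift_weight d f i = 0.
  by move=> Ki; rewrite lift_weightS ?f0 // (leq_ltn_trans _ Ki).
split.
- exact: lift_int.
- by move=> i i0; exists (f i); exact: lift_weightS.
- apply: (sub_finite_set _ (finite_II K.+1)) => i /=; apply: contraNltn.
  by move=> Ki; apply/eqP/l0.
- by move=> i ni; apply: l0; rewrite ltnNge; apply: contra ni; apply: Kn.
- rewrite (fsbig_bounded l0) big_split /= -natr_sum fd big_ord_recl /= big1 => [|i _ //].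
  by rewrite addr0 addrC subrK.
Qed.

Section LiftMat.
Variables (n : option nat) (K d : nat) (delta beta : weight n).
Variables (a b : nat -> nat) (m : nat -> nat -> nat).
Hypothesis Kn : forall i, (i <= K)%N -> in_range n i.
Hypothesis deltaE : forall i, delta i = lift_weight d a i.
Hypothesis betaE : forall i, beta i = lift_weight d b i.
Hypothesis m0 : forall i j, (K < i)%N || (K < j)%N -> m i j = 0%N.
Hypothesis mrow : forall i, (\sum_(j < K.+1) m i j = a i)%N.
Hypothesis mcol : forall j, (\sum_(i < K.+1) m i j = b j)%N.
Hypothesis md : (\sum_(i < K.+1) a i = d)%N.

Lemma lift_mat0 i j : (K < i)%N || (K < j)%N -> lift_mat d m i j = 0.
Proof.
move=> ij; rewrite lift_matS ?m0 //.
by rewrite xpair_eqE; case: i j ij => [|i] [|j].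
Qed.

Lemma lift_row i : \sum_(j < K.+1) lift_mat d m i j = lift_weight d a i.
Proof.
rewrite big_split /= -natr_sum mrow; congr (_ + _).
rewrite big_ord_recl xpair_eqE andbT big1 ?addr0 // => j _.
by rewrite xpair_eqE andbF.
Qed.

Lemma lift_col j : \sum_(i < K.+1) lift_mat d m i j = lift_weight d b j.
Proof.
rewrite big_split /= -natr_sum mcol; congr (_ + _).
by rewrite big_ord_recl xpair_eqE big1 ?addr0.
Qed.

Lemma lift_is_mat : mat delta beta (lift_mat d m).
Proof.
split; split.
- exact: lift_int.
- by move=> i j ij; exists (m i j); exact: lift_matS.
- apply: (sub_finite_set _ (finite_setX (finite_II K.+1) (finite_II K.+1))) => -[i j] /= h.
  split=> /=; apply: contraNltn h => h; apply/eqP/lift_mat0; by rewrite h ?orbT.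
- move=> i j ij; apply: lift_mat0; rewrite !ltnNge -negb_and; apply: contra ij.
  by move=> /andP[/Kn-> /Kn->].
- rewrite (fsbig_bounded2 lift_mat0).
  under eq_bigr => i _ do rewrite lift_row.
  rewrite big_split /= -natr_sum md big_ord_recl /= big1 => [|i _ //].
  by rewrite addr0 addrC subrK.
- move=> j; rewrite (fsbig_bounded (f := lift_mat d m ^~ j) (K := K)) ?lift_col ?betaE // => i Ki.
  by apply: lift_mat0; rewrite Ki.
- move=> i; rewrite (fsbig_bounded (f := lift_mat d m i) (K := K)) ?lift_row ?deltaE // => j Kj.
  by apply: lift_mat0; rewrite Kj orbT.
Qed.

Lemma lift_semistandard :
  (forall k j, \sum_(l < j.+1) m k.+1 l <= \sum_(l < j) m k l)%N ->
  semistandard delta (lift_mat d m).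
Proof.
move=> semi; exists d%:Z => e de.
have [s {de}->] : exists s : nat, e = (d + s)%N%:Z by exists `|(e - d%:Z)%R|%N; lia.
(* Passing from degree d to d + s adds s letters 0 to the first row. This only raises the counts of
   the upper row in the criterion, so column strictness persists. *)
pose m' k j := (m k j + ((k, j) == (0, 0)) * s)%N.
have m'0 k j : (K.+1 <= j)%N -> m' k j = 0%N.
  by move=> Kj; rewrite /m' m0 ?Kj ?orbT // xpair_eqE andbC gtn_eqF // (leq_ltn_trans _ Kj).
have lift_shift (x : QT) (k : nat) : x + (varT - d%:R) + ((d + k)%N%:Z%:~R - varT) = x + k%:R.
  by rewrite -pmulrn natrD -addrA; congr (_ + _); exact: addr_telescope.
exists (fun k => row_word (m' k) K.+1) => [k|]; first split.
- rewrite size_row_word big_split /= mrow natrD /shift_weight deltaE /lift_weight.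
  case: k => [|k] /=; last by rewrite big1 ?addr0 // => j _; rewrite xpair_eqE.
  rewrite lift_shift; congr (_ + _%:R).
  by rewrite big_ord_recl big1 ?addn0 // mul1n.
- exact: sorted_row_word.
- move=> j; have [jK|Kj] := ltnP j K.+1.
    rewrite count_mem_row_word // /m' /shift_matrix /lift_mat; case: eqP => _.
      by rewrite lift_shift mul1n natrD.
    by rewrite mul0n addn0 addr0.
  rewrite (count_memPn _) /shift_matrix ?lift_mat0 ?Kj ?orbT //.
    by rewrite xpair_eqE andbC gtn_eqF // (leq_ltn_trans _ Kj).
  by apply/negP => /(allP (row_word_lt _ _)); rewrite ltnNge Kj.
apply: column_strict_count => [i|i j]; first exact: sorted_row_word.
rewrite !count_lt_row_word; [|exact: m'0|exact: m'0].
rewrite (eq_bigr (fun l : 'I_j.+1 => m i.+1 l)) => [|l _]; last by rewrite /m' addn0.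
by apply: leq_trans (semi i j) _; apply: leq_sum => l _; apply: leq_addr.
Qed.

End LiftMat.

(** [K] must bound the supports, and all [K.+1] rows of a shape produced by the correspondence must
    have indices in range. For n = [Some N.+1] the full range K = N does both. *)
Lemma range_bound n (delta beta : weight n) : n <> Some 0%N ->
  exists K, [/\ forall i, (i <= K)%N -> in_range n i,
    forall i, (K < i)%N -> delta i = 0 & forall i, (K < i)%N -> beta i = 0].
Proof.
case: n delta beta => [[|N]|] delta beta n0 //; last first.
  have [K1 h1] := weight_bound delta; have [K2 h2] := weight_bound beta.
  by exists (maxn K1 K2); split=> // i; rewrite gtn_max => /andP[i1 i2]; [exact: h1|exact: h2].
exists N; split=> [i iN|i Ni|i Ni]; first exact: iN.
  by case: (wtP delta) => _ _ _ h _; apply: h; rewrite /= -leqNgt.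
by case: (wtP beta) => _ _ _ h _; apply: h; rewrite /= -leqNgt.
Qed.

Section Span.
Variables (n : option nat) (delta beta : weight n) (K : nat).
Hypothesis Kn : forall i, (i <= K)%N -> in_range n i.
Hypothesis dK : forall i, (K < i)%N -> delta i = 0.
Hypothesis bK : forall i, (K < i)%N -> beta i = 0.

(** A degree in which every orbit is visible: it makes [cd 0] the sum of the later parts of [beta],
    so the entry [(0, 0)] of any type is nonnegative. *)
Let d := (\sum_(1 <= i < K.+1) natq (delta i) + \sum_(1 <= i < K.+1) natq (beta i))%N.
Let cd := content d delta.
Let cb := content d beta.

Lemma content_sum_delta : (\sum_(i < K.+1) cd i = d)%N.
Proof. by apply: content_sum dK _; apply: leq_addr. Qed.

Lemma content_sum_beta : (\sum_(i < K.+1) cb i = d)%N.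
Proof. by apply: content_sum bK _; apply: leq_addl. Qed.

Lemma lift_content (b : weight n) : (forall i, (K < i)%N -> b i = 0) ->
  (\sum_(1 <= i < K.+1) natq (b i) <= d)%N ->
  forall i, b i = lift_weight d (content d b) i.
Proof.
move=> b0 bd i; rewrite /lift_weight (contentK _ b0 bd) /shift_weight.
case: eqP => _; last by rewrite addr0.
by rewrite -pmulrn -addrA -[varT - _]opprB subrr addr0.
Qed.

(** A common finite index set for the orbits on pairs of points and for the products obtained from
    the correspondence. *)
Definition type_matrix : Type :=
  {m : {ffun 'I_K.+1 * 'I_K.+1 -> 'I_d.+1} |
     [forall i, (\sum_j m (i, j))%N == cd i] && [forall j, (\sum_i m (i, j))%N == cb j]}.

HB.instance Definition _ := Finite.on type_matrix.

Implicit Types m : type_matrix.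

Definition entry m (i j : nat) : nat :=
  if (i <= K)%N && (j <= K)%N then val m (inord i, inord j) : nat else 0%N.

Lemma entryE m (i j : 'I_K.+1) : entry m i j = val m (i, j).
Proof. by rewrite /entry !leq_ord !inord_val. Qed.

Lemma entry_row m i : (i <= K)%N -> (\sum_(j < K.+1) entry m i j = cd i)%N.
Proof.
move=> iK; case/andP: (valP m) => /forallP/(_ (Ordinal (iK : (i < K.+1)%N)))/eqP <- _.
by apply: eq_bigr => j _; rewrite -entryE.
Qed.

Lemma entry_col m j : (j <= K)%N -> (\sum_(i < K.+1) entry m i j = cb j)%N.
Proof.
move=> jK; case/andP: (valP m) => _ /forallP/(_ (Ordinal (jK : (j < K.+1)%N)))/eqP <-.
by apply: eq_bigr => i _; rewrite -entryE.
Qed.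

Lemma entry_inj m m' :
  (forall i j, (i <= K)%N -> (j <= K)%N -> entry m i j = entry m' i j) -> m = m'.
Proof.
move=> h; apply: val_inj; apply/ffunP => -[i j]; apply: val_inj.
by rewrite /= -[LHS]entryE -[RHS]entryE h ?leq_ord.
Qed.

Lemma entry_sum m : (\sum_(i < K.+1) \sum_(j < K.+1) entry m i j = d)%N.
Proof. by rewrite -[RHS]content_sum_delta; apply: eq_bigr => i _; rewrite entry_row ?leq_ord. Qed.

Let shape m := rsk_shape K.+1 (entry m).
Let prow m := rsk_row K.+1 (entry m).
Let pcol m := rsk_col K.+1 (entry m).

Lemma shape0 m k : (K < k)%N -> shape m k = 0%N.
Proof. exact: growth_gt_i. Qed.

Lemma shape_sum m : (\sum_(k < K.+1) shape m k = d)%N.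
Proof. by rewrite growth_sum // entry_sum. Qed.

Definition type_shape m : weight n :=
  Weight (lift_is_weight Kn (@shape0 m) (shape_sum m)).

Lemma rsk_row_out m k j : (K < k)%N || (K < j)%N -> prow m k j = 0%N.
Proof.
by case/orP => [Kk|Kj]; [exact: rsk_row_gt|rewrite /prow /rsk_row ltnNge Kj].
Qed.

Lemma rsk_col_out m k j : (K < k)%N || (K < j)%N -> pcol m k j = 0%N.
Proof.
by case/orP => [Kk|Kj]; [exact: rsk_col_gt|rewrite /pcol /rsk_col ltnNge Kj].
Qed.

Lemma content0 (b : weight n) : (forall i, (K < i)%N -> b i = 0) ->
  forall i, (K < i)%N -> content d b i = 0%N.
Proof. by move=> b0 i Ki; rewrite contentS ?b0 ?natq0 // (leq_ltn_trans _ Ki). Qed.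

Lemma rsk_row_beta m j : (\sum_(k < K.+1) prow m k j = cb j)%N.
Proof.
have [jK|Kj] := leqP j K; first by rewrite rsk_row_content // entry_col.
by rewrite [cb j]content0 // big1 // => k _; rewrite rsk_row_out ?Kj ?orbT.
Qed.

Lemma rsk_col_delta m j : (\sum_(k < K.+1) pcol m k j = cd j)%N.
Proof.
have [jK|Kj] := leqP j K; first by rewrite rsk_col_content // entry_row.
by rewrite [cd j]content0 // big1 // => k _; rewrite rsk_col_out ?Kj ?orbT.
Qed.

Definition type_left m := transpose (lift_mat d (pcol m)).
Definition type_right m := lift_mat d (prow m).

Lemma type_std_pair m : std_pair delta beta (type_shape m) (type_left m) (type_right m).
Proof.
have sE i : type_shape m i = lift_weight d (shape m) i by [].
have dE := lift_content dK (leq_addr _ _); have bE := lift_content bK (leq_addl _ _).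
have rrow k : (\sum_(j < K.+1) prow m k j = shape m k)%N := rsk_row_sum _ _ _.
have rcol k : (\sum_(j < K.+1) pcol m k j = shape m k)%N := rsk_col_sum _ _ _.
split.
- move=> i i0; rewrite !sE !lift_weightS // !natqE; exact: rsk_shapeS.
- apply: mat_transpose.
  exact: (lift_is_mat Kn sE dE (@rsk_col_out m) rcol (rsk_col_delta m) (shape_sum m)).
- rewrite (_ : transpose _ = lift_mat d (pcol m)) //.
  exact: (lift_semistandard sE (@rsk_col_out m) rcol (shape_sum m) (@rsk_col_semistd K.+1 (entry m))).
- exact: (lift_is_mat Kn sE bE (@rsk_row_out m) rrow (rsk_row_beta m) (shape_sum m)).
- exact: (lift_semistandard sE (@rsk_row_out m) rrow (shape_sum m) (@rsk_row_semistd K.+1 (entry m))).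
Qed.

Lemma type_inj m m' : type_left m = type_left m' -> type_right m = type_right m' -> m = m'.
Proof.
move=> el er; apply: entry_inj => i j iK jK.
apply: (@rsk_inj K.+1) => // [k l _ _|k l _ _].
  by apply: (@lift_mat_inj d); rewrite -/(prow m) -/(prow m') -!/(type_right _) er.
exact: (lift_mat_inj (congr1 (fun f => f l k) el)).
Qed.

Lemma type_point m : exists zx : Xsp delta * Xsp beta,
  [/\ forall w, (d <= w)%N -> label zx.1 w = 0%N /\ label zx.2 w = 0%N,
      forall w, (label zx.1 w <= K)%N /\ (label zx.2 w <= K)%N
    & forall i j, (i <= K)%N -> (j <= K)%N ->
      count (fun w => (label zx.1 w == i) && (label zx.2 w == j)) (iota 0 d) = entry m i j].
Proof.
have [i i0 iK|j j0 jK|z [x h]] := exists_point_pair dK bK (entry_sum m).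
- by rewrite entry_row // [cd i]contentS.
- by rewrite entry_col // [cb j]contentS.
- by exists (z, x).
Qed.

Lemma count_row (f g : nat -> nat) N i : (forall w, g w <= K)%N ->
  (\sum_(j < K.+1) count (fun w => (f w == i) && (g w == j)) (iota 0 N) =
   count (fun w => f w == i) (iota 0 N))%N.
Proof.
move=> gK; under eq_bigr => j _ do rewrite -(sum_ord_count (fun w => (f w == i) && (g w == j))).
rewrite exchange_big -(sum_ord_count (fun w => f w == i)); apply: eq_bigr => w _ /=.
rewrite -[RHS](@sum_nat_delta K.+1 (g w) (fun=> (f w == i) : nat)) ?ltnS //.
by apply: eq_bigr => j _; rewrite mulnb.
Qed.

Lemma type_of_pair (z : Xsp delta) (x : Xsp beta) N :
  (forall w, (N <= w)%N -> label z w = 0%N /\ label x w = 0%N) ->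
  exists m, forall i j, (i <= K)%N -> (j <= K)%N -> (i, j) != (0, 0)%N ->
    entry m i j = count (fun w => (label z w == i) && (label x w == j)) (iota 0 N).
Proof.
move=> zxN.
have zK : forall w, (label z w <= K)%N := label_le z (natq_weight0 dK).
have xK : forall w, (label x w <= K)%N := label_le x (natq_weight0 bK).
pose c (i j : nat) := count (fun w => (label z w == i) && (label x w == j)) (iota 0 N).
have crow i : (0 < i)%N -> (\sum_(j < K.+1) c i j = natq (delta i))%N.
  by move=> i0; rewrite count_row // (count_label i0) // => w /zxN[].
have ccol j : (0 < j)%N -> (\sum_(i < K.+1) c i j = natq (beta j))%N.
  move=> j0; rewrite -(@count_label _ _ x j N) // => [|w /zxN[] //].
  rewrite -(count_row _ N j zK); apply: eq_bigr => i _; apply: eq_count => w.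
  exact: andbC.
have cd0 : (cd 0 = \sum_(1 <= j < K.+1) natq (beta j))%N.
  have := content_sum_delta; rewrite big_ord_recl /= /d big_add1 big_mkord.
  rewrite (eq_bigr (fun i : 'I_K => natq (delta i.+1))) => [|i _]; last exact: contentS.
  by rewrite addnC => /addnI.
(* The choice of [d] enters here: the entry [(0, 0)] defined next by subtraction gives row 0 its
   right sum. *)
have le0 : (\sum_(j < K) c 0 j.+1 <= cd 0)%N.
  rewrite cd0 big_add1 big_mkord; apply: leq_sum => j _.
  by rewrite -ccol // big_ord_recl; apply: leq_addr.
pose f (i j : nat) := if (i, j) == (0, 0)%N then (cd 0 - \sum_(j < K) c 0 j.+1)%N else c i j.
have frow i : (i <= K)%N -> (\sum_(j < K.+1) f i j = cd i)%N.
  case: i => [|i] iK; last by rewrite [cd _]contentS // -crow.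
  by rewrite big_ord_recl /f /= subnK.
have fcolS j : (0 < j)%N -> (\sum_(i < K.+1) f i j = cb j)%N.
  move=> j0; rewrite [cb _]contentS // -ccol //; apply: eq_bigr => i _.
  by rewrite /f xpair_eqE andbC gtn_eqF.
(* Column 0 is obtained last, by comparing the totals over all rows and over all columns. *)
have fcol j : (j <= K)%N -> (\sum_(i < K.+1) f i j = cb j)%N.
  case: j => [|j] jK; last exact: fcolS.
  have : (\sum_(j < K.+1) \sum_(i < K.+1) f i j = \sum_(j < K.+1) cb j)%N.
    rewrite content_sum_beta -content_sum_delta exchange_big; apply: eq_bigr => i _; apply: frow; exact: leq_ord.
  rewrite big_ord_recl [in RHS]big_ord_recl /= [X in (_ + X)%N = _](_ : _ = (\sum_(i < K) cb (bump 0 i))%N).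
    by move/addIn.
  by apply: eq_bigr => i _; apply: fcolS.
have fd i j : (i <= K)%N -> (j <= K)%N -> (f i j < d.+1)%N.
  move=> iK jK; rewrite ltnS -content_sum_delta (bigD1 (Ordinal (iK : (i < K.+1)%N))) //=.
  by rewrite -frow // (bigD1 (Ordinal (jK : (j < K.+1)%N))) //= -addnA leq_addr.
pose M : {ffun 'I_K.+1 * 'I_K.+1 -> 'I_d.+1} := [ffun p : 'I_K.+1 * 'I_K.+1 => inord (f p.1 p.2)].
have ME (i j : 'I_K.+1) : M (i, j) = f i j :> nat.
  by rewrite ffunE inordK // fd ?leq_ord.
have PM : [forall i, (\sum_j M (i, j))%N == cd i] && [forall j, (\sum_i M (i, j))%N == cb j].
  apply/andP; split; apply/forallP => i.
    by rewrite -frow ?leq_ord //; apply/eqP/eq_bigr => j _; rewrite ME.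
  by rewrite -fcol ?leq_ord //; apply/eqP/eq_bigr => j _; rewrite ME.
exists (exist _ M PM) => i j iK jK /negbTE ij.
have := entryE (exist _ M PM) (Ordinal (iK : (i < K.+1)%N)) (Ordinal (jK : (j < K.+1)%N)).
by rewrite /= ME /f /= ij.
Qed.

(** An element of [hom] is determined by its values at the representatives [pt m]. The values of the
    products there form a square matrix, whose rows are independent by [std_pairs_independent]; its
    inverse gives the coefficients. *)
Theorem std_pairs_span (f : Xsp delta -> Xsp beta -> QT) : hom f ->
  exists C : type_matrix -> QT, forall z x, f z x = \sum_m C m *
    comp (@xi n delta (type_shape m) (type_left m)) (@xi n (type_shape m) beta (type_right m)) z x.
Proof.
pose g m : Xsp delta -> Xsp beta -> QT :=
  comp (@xi n delta (type_shape m) (type_left m)) (@xi n (type_shape m) beta (type_right m)).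
have ghom m : hom (g m) by apply: comp_hom; apply: xi_hom.
have [pt ptP] := fin_all_exists type_point.
have cover z x : exists m s, act s (pt m).1 = z /\ act s (pt m).2 = x.
  have [N zxN] := label_bounded2 z x; pose N' := maxn d N.
  have zxN' w : (N' <= w)%N -> label z w = 0%N /\ label x w = 0%N.
    by rewrite geq_max => /andP[_ /zxN].
  have [m mE] := type_of_pair zxN'; exists m.
  have [pt0 ptK ptE] := ptP m.
  have pt0' w : (N' <= w)%N -> label (pt m).1 w = 0%N /\ label (pt m).2 w = 0%N.
    by rewrite geq_max => /andP[/pt0].
  have [i j ij|s [_ h1 h2]] := same_orbit pt0' zxN'; last by exists s.
  have zK : forall w, (label z w <= K)%N := label_le z (natq_weight0 dK).
  have xK : forall w, (label x w <= K)%N := label_le x (natq_weight0 bK).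
  have none (u v : nat -> nat) : (forall w, u w <= K)%N -> (forall w, v w <= K)%N ->
      (K < i)%N || (K < j)%N -> count (fun w => (u w == i) && (v w == j)) (iota 0 N') = 0%N.
    move=> uK vK h; rewrite (@eq_count _ _ pred0) ?count_pred0 // => w /=.
    apply/negP => /andP[/eqP ui /eqP vj]; move: h; rewrite -ui -vj !ltnNge uK vK.
    by [].
  have [iK|Ki] := leqP i K; last by rewrite !none ?Ki // => w; case: (ptK w).
  have [jK|Kj] := leqP j K; last by rewrite !none ?Kj ?orbT // => w; case: (ptK w).
  rewrite -mE // -ptE //.
  have bd M : (forall w, (M <= w)%N -> label (pt m).1 w = 0%N /\ label (pt m).2 w = 0%N) ->
      forall w, (label (pt m).1 w == i) && (label (pt m).2 w == j) -> (w < M)%N.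
    move=> h w /andP[/eqP ui /eqP vj]; rewrite ltnNge; apply/negP => /h[u0 v0].
    by move: ij; rewrite -ui -vj u0 v0.
  exact: card_eq_nat (card_count (bd _ pt0')) (card_count (bd _ pt0)).
have hom_eq (u v : Xsp delta -> Xsp beta -> QT) : hom u -> hom v ->
    (forall m, u (pt m).1 (pt m).2 = v (pt m).1 (pt m).2) -> forall z x, u z x = v z x.
  by move=> uh vh uv z x; have [m [s [<- <-]]] := cover z x; rewrite uh vh uv.
have sum_hom (C : type_matrix -> QT) : hom (fun z x => \sum_m C m * g m z x).
  by move=> s z x; apply: eq_bigr => m _; rewrite ghom.
move=> fh.
pose T : finType := type_matrix.
pose A : 'M[QT]_#|T| :=
  \matrix_(i, j) g (enum_val i) (pt (enum_val j)).1 (pt (enum_val j)).2.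
have sumA (u : 'rV[QT]_#|T|) j : (u *m A) 0 j =
    \sum_m u 0 (enum_rank m) * g m (pt (enum_val j)).1 (pt (enum_val j)).2.
  rewrite mxE (reindex (@enum_rank T)) /=; last exact: onW_bij (enum_rank_bij T).
  by apply: eq_bigr => m _; rewrite mxE enum_rankK.
have Afree : row_free A.
  apply: inj_row_free => u uA; apply/rowP => j; rewrite mxE -[j]enum_valK.
  apply: (@std_pairs_independent n delta beta _ type_shape type_left type_right
    (fun m => u 0 (enum_rank m))) => [m|m m' _|z x]; [exact: type_std_pair|exact: type_inj|].
  have h0 : hom (fun (_ : Xsp delta) (_ : Xsp beta) => 0 : QT) by [].
  apply: (hom_eq _ _ (sum_hom (fun m => u 0 (enum_rank m))) h0) => m.
  by have := sumA u (enum_rank m); rewrite uA mxE enum_rankK => <-.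
pose v : 'rV[QT]_#|T| := \row_j f (pt (enum_val j)).1 (pt (enum_val j)).2.
exists (fun m => (v *m invmx A) 0 (enum_rank m)).
apply: (hom_eq _ _ fh (sum_hom _)) => m.
have := sumA (v *m invmx A) (enum_rank m).
by rewrite mulmxKV -?row_free_unit // mxE enum_rankK.
Qed.

End Span.

(** * The corner of the algebra *)

Section Algebra.
Variable n : option nat.
Implicit Types (delta lam beta : weight n) (a b : family n).

Lemma inhomE delta beta (f : Xsp delta -> Xsp beta -> QT) :
  (inhom f : family n) (delta, beta) = f.
Proof. exact: dfwithin. Qed.

Lemma inhom_out delta beta (f : Xsp delta -> Xsp beta -> QT) p :
  p <> (delta, beta) -> (inhom f : family n) p = fun _ _ => 0.
Proof. by move=> ne; apply: dfwithout; apply/eqP => e; apply: ne. Qed.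

Lemma inhom_eqP delta beta (f : Xsp delta -> Xsp beta -> QT) a :
  a (delta, beta) = f -> (forall p, p <> (delta, beta) -> a p = fun _ _ => 0) ->
  a = inhom f.
Proof.
move=> af a0; apply: functional_extensionality_dep => p.
have [->|ne] := pselect (p = (delta, beta)); first by rewrite inhomE.
by rewrite inhom_out // a0.
Qed.

Lemma comp0l (X Y Z : finitary) (f : Y -> X -> QT) :
  comp (fun (_ : Z) (_ : Y) => 0) f = fun _ _ => 0.
Proof.
apply/funext => z; apply/funext => x; rewrite /comp (@integral_two _ _ 0) ?mul0r // => y.
by left; rewrite mul0r.
Qed.

Lemma comp0r (X Y Z : finitary) (g : Z -> Y -> QT) :
  comp g (fun (_ : Y) (_ : X) => 0) = fun _ _ => 0.
Proof.
apply/funext => z; apply/funext => x; rewrite /comp (@integral_two _ _ 0) ?mul0r // => y.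
by left; rewrite mulr0.
Qed.

Lemma integral_point beta (f : Xsp beta -> QT) y0 :
  (forall y, y <> y0 -> f y = 0) -> integral f = f y0.
Proof.
move=> f0; rewrite (@integral_two _ _ (f y0)) => [|y]; last first.
  by have [->|/f0] := pselect (y = y0); [right|left].
have [->|v0] := eqVneq (f y0) 0; first by rewrite mul0r.
rewrite (_ : _ @^-1` _ = [set y0]) ?mu_point ?mulr1 //.
apply/seteqP; split=> [y /= fy|y ->//]; apply/not_notP => /f0 e.
by move/eqP: v0; apply; rewrite -fy e.
Qed.

Lemma comp_idl delta beta (f : Xsp delta -> Xsp beta -> QT) : comp (@idm (Xsp delta)) f = f.
Proof.
apply/funext => z; apply/funext => x; rewrite /comp /idm (@integral_point _ _ z).
  by rewrite asboolT // mul1r.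
by move=> y yz; rewrite asboolF ?mul0r // => e; apply: yz.
Qed.

Lemma comp_idr delta beta (f : Xsp delta -> Xsp beta -> QT) : comp f (@idm (Xsp beta)) = f.
Proof.
apply/funext => z; apply/funext => x; rewrite /comp /idm (@integral_point _ _ x).
  by rewrite asboolT // mulr1.
by move=> y yx; rewrite asboolF ?mulr0.
Qed.

(** Keeps one intermediate weight in the product, which is all that factors supported in a single
    summand require. *)
Lemma schur_mul_single a b delta lam beta :
  (forall g, g <> lam -> a (delta, g) = (fun _ _ => 0) \/ b (g, beta) = fun _ _ => 0) ->
  (schur_mul a b : family n) (delta, beta) = comp (a (delta, lam)) (b (lam, beta)).
Proof.
move=> ab; apply/funext => z; apply/funext => x; rewrite /schur_mul /=.
transitivity (\sum_(g \in [set lam]) comp (a (delta, g)) (b (g, beta)) z x); last by rewrite fsbig_set1.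
apply/esym/fsbig_widen => // g [_ /= gl].
by case: (ab g gl) => ->; rewrite ?comp0l ?comp0r.
Qed.

Lemma schur_mul_inhom delta lam beta (g : Xsp delta -> Xsp lam -> QT)
    (f : Xsp lam -> Xsp beta -> QT) :
  schur_mul (inhom g) (inhom f) = inhom (comp g f).
Proof.
apply: inhom_eqP => [|[p1 p2] ne].
  by rewrite (@schur_mul_single _ _ _ lam) ?inhomE // => h hl; left; apply: inhom_out => -[].
rewrite (@schur_mul_single _ _ _ lam) => [|h hl]; last by left; apply: inhom_out => -[].
have [e|p1d] := pselect (p1 = delta).
  rewrite [X in comp _ X]inhom_out ?comp0r // => -[p2b]; apply: ne.
  by rewrite e p2b.
by rewrite inhom_out ?comp0l // => -[].
Qed.

Lemma schur_mul_id a delta beta :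
  schur_mul (schur_mul (schur_id delta) a) (schur_id beta) = inhom (a (delta, beta)).
Proof.
have idl p2 : (schur_mul (schur_id delta) a : family n) (delta, p2) = a (delta, p2).
  rewrite (@schur_mul_single _ _ _ delta) => [|g gd]; first by rewrite /schur_id inhomE comp_idl.
  by left; apply: inhom_out => -[].
have idl0 p1 p2 : p1 <> delta -> (schur_mul (schur_id delta) a : family n) (p1, p2) = fun _ _ => 0.
  move=> p1d; rewrite (@schur_mul_single _ _ _ delta) => [|g gd].
    by rewrite /schur_id inhom_out ?comp0l // => -[].
  by left; apply: inhom_out => -[].
have idr b p1 : (schur_mul b (schur_id beta) : family n) (p1, beta) = b (p1, beta).
  rewrite (@schur_mul_single _ _ _ beta) => [|g gb]; first by rewrite /schur_id inhomE comp_idr.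
  by right; apply: inhom_out => -[].
have idr0 b p1 p2 : p2 <> beta -> (schur_mul b (schur_id beta) : family n) (p1, p2) = fun _ _ => 0.
  move=> p2b; rewrite (@schur_mul_single _ _ _ beta) => [|g gb].
    by rewrite [X in comp _ X]inhom_out ?comp0r // => -[].
  by right; apply: inhom_out => -[].
apply: inhom_eqP => [|[p1 p2] ne]; first by rewrite idr idl.
have [p2b|p2b] := pselect (p2 = beta); last exact: idr0.
subst p2; rewrite idr idl0 // => p1d; apply: ne; by rewrite p1d.
Qed.

Lemma inhom_schur delta beta (f : Xsp delta -> Xsp beta -> QT) :
  hom f -> schur (inhom f).
Proof.
move=> fh; split=> [p|].
  have [->|ne] := pselect (p = (delta, beta)); first by rewrite inhomE.
  by rewrite inhom_out.
apply: (@sub_finite_set _ _ [set (delta, beta)]) => // p /= p0.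
by apply/not_notP => ne; move/eqP: p0; apply; rewrite inhom_out.
Qed.

Lemma cornerP delta beta : corner delta beta = [set inhom f | f in @hom (Xsp beta) (Xsp delta)].
Proof.
apply/seteqP; split=> [_ [a [ah _] <-]|_ [f fh <-]].
  exists (a (delta, beta)); last by rewrite schur_mul_id.
  exact (ah (delta, beta)).
by exists (inhom f); [exact: inhom_schur|rewrite schur_mul_id inhomE].
Qed.

Lemma CBP delta beta b : CB delta beta b <-> exists lam q r,
  std_pair delta beta lam q r /\ b = inhom (comp (@xi n delta lam q) (@xi n lam beta r)).
Proof.
split=> [[u [lam dom [[q [qm qs] u1] [r [rm rs] u2]]] <-]|[lam [q [r [[dom qm qs rm rs] ->]]]]].
  by exists lam, q, r; split; [|rewrite -u1 -u2 schur_mul_inhom].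
exists (schur_xi delta lam q, schur_xi lam beta r); last exact: schur_mul_inhom.
by exists lam => //; split; [exists q|exists r].
Qed.

Lemma family_sumE (I : Type) (s : seq I) (P : pred I) (F : I -> family n) p y x :
  (\sum_(i <- s | P i) F i) p y x = \sum_(i <- s | P i) F i p y x.
Proof.
elim: s => [|i s IH]; first by rewrite !big_nil.
by rewrite !big_cons; case: (P i) => //; rewrite -IH.
Qed.

End Algebra.

Theorem theorem6p2p1 (n : option nat) (n_gt0 : n <> Some 0%N)
    (delta beta : weight n) :
  is_basis (corner delta beta) (CB delta beta).
Proof.
rewrite cornerP; split.
- move=> _ /CBP[lam [q [r [_ ->]]]]; exists (comp (@xi n delta lam q) (@xi n lam beta r)) => //.
  by apply: comp_hom; apply: xi_hom.
- move=> s c us sCB sum0 b bs.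
  (* A standard pair is chosen for each element of [s]. The pair determines the product, so distinct
     elements receive distinct pairs. *)
  have bi (i : 'I_(size s)) : exists v : weight n * ((nat -> nat -> QT) * (nat -> nat -> QT)),
      std_pair delta beta v.1 v.2.1 v.2.2 /\
      nth 0 s i = inhom (comp (@xi n delta v.1 v.2.1) (@xi n v.1 beta v.2.2)).
    have /sCB/CBP[lam [q [r [h e]]]] : nth 0 s i \in s by apply: mem_nth.
    by exists (lam, (q, r)).
  have [v vP] := fin_all_exists bi.
  have index_b : (index b s < size s)%N by rewrite index_mem.
  rewrite -(nth_index 0 bs) -[index b s]/(nat_of_ord (Ordinal index_b)).
  apply: (@std_pairs_independent n delta beta _ (fun i => (v i).1) (fun i => (v i).2.1)
    (fun i => (v i).2.2) (fun i => c (nth 0 s i))) => [i|i j e1 e2 e3|z x].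
  + by case: (vP i).
  + apply/val_inj/eqP; rewrite /= -(nth_uniq 0 _ _ us) //.
    have ev : v i = v j.
      by case: (v i) (v j) e1 e2 e3 => [l1 [q1 r1]] [l2 [q2 r2]] /= -> -> ->.
    by rewrite (proj2 (vP i)) (proj2 (vP j)) ev.
  + have := congr1 (fun w : family n => w (delta, beta) z x) sum0.
    rewrite family_sumE (big_nth 0) big_mkord => e; rewrite -[RHS]e.
    by apply: eq_bigr => i _; rewrite -[in LHS](inhomE (comp _ _)) -(proj2 (vP i)).
- move=> _ [f fh <-].
  have [K [Kn dK bK]] := range_bound delta beta n_gt0.
  have [C fE] := std_pairs_span Kn dK bK fh.
  pose g (m : type_matrix delta beta K) : family n := inhom (comp (@xi n delta (type_shape Kn dK m) (type_left m))
    (@xi n (type_shape Kn dK m) beta (type_right m))).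
  pose s := [seq g m | m <- index_enum (type_matrix delta beta K)].
  (* Coefficients are attached to elements of the algebra, not to indices: that of b collects all
     [C m] with [g m = b], and duplicates are removed so that each is counted once. *)
  exists (undup s), (fun b => \sum_m if g m == b then C m else 0); split.
    move=> b /=; rewrite mem_undup => /mapP[m _ ->]; apply/CBP.
    by exists (type_shape Kn dK m), (type_left m), (type_right m); split; first exact: type_std_pair.
  transitivity (\sum_m C m *: g m).
    apply/esym/inhom_eqP => [|p ne].
      by apply/funext => z; apply/funext => x; rewrite fE family_sumE; apply: eq_bigr => m _; rewrite /g -[in RHS](inhomE (comp _ _)).
    apply/funext => z; apply/funext => x; rewrite family_sumE big1 // => m _.
    by rewrite -[LHS]/(C m * (g m : family n) p z x) /g inhom_out // mulr0.
  under [RHS]eq_bigr => b _ do rewrite scaler_suml.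
  rewrite exchange_big; apply: eq_bigr => m _ /=.
  rewrite (bigD1_seq (g m)) ?undup_uniq ?mem_undup ?map_f ?mem_index_enum //= eqxx big1 ?addr0 // => b.
  by rewrite eq_sym => /negbTE->; rewrite scale0r.
Qed.
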